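(* Let $d\geqslant 1$ and let $\Omega$ be a bounded open set in $\mathbb{R}^{d}$. For $R>0$ and $x\in\mathbb{R}^d$ let $\mathcal{D}(R\Omega-x)=\sum_{k\in\mathbb{Z}^{d}}\chi_{R\Omega-x}(k)-R^{d}|\Omega|$, viewed as a function of $x\in\mathbb{T}^{d}=\mathbb{R}^d/\mathbb{Z}^d$. Then: (1) If $2\leqslant p<+\infty$ and $1/p+1/q=1$, then for every $R>0$ \[ \|\mathcal{D}(R\Omega-x)\|_{L^{p}(\mathbb{T}^{d})}\leqslant R^{d}\,\big\|\{\widehat{\chi_{\Omega}}(Rn)\}_{n\neq 0}\big\|_{L^{q}(\mathbb{Z}^{d})}. \] (2) If $2<p<+\infty$ and $1/p+1/q=1$, then there is a constant $C$ independent of $R$ such that for every $R>0$ \[ \|\mathcal{D}(R\Omega-x)\|_{\mathrm{Weak}\text{-}L^{p}(\mathbb{T}^{d})}\leqslant C R^{d}\,\big\|\{\widehat{\chi_{\Omega}}(Rn)\}_{n\neq 0}\big\|_{\mathrm{Weak}\text{-}L^{q}(\mathbb{Z}^{d})}. \] (3) If $2<p<+\infty$ and $1/p+1/q=1$, then there is a constant $C$ independent of $R$ such that for every $R>0$ \[ \|\mathcal{D}(R\Omega-x)\|_{L^{p}(\mathbb{T}^{d})}\leqslant C R^{d}\log^{1/p}(2+R)\,\big\|\{\widehat{\chi_{\Omega}}(Rn)\}_{n\neq 0}\big\|_{\mathrm{Weak}\text{-}L^{q}(\mathbb{Z}^{d})}. \] (4) If $1\leqslant p\leqslant+\infty$,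 then for every $R>0$ \[ \|\mathcal{D}(R\Omega-x)\|_{L^{p}(\mathbb{T}^{d})}\geqslant \sup_{n\neq 0}\big|R^{d}\widehat{\chi_{\Omega}}(Rn)\big|. \]
   Context: $\chi_A$ denotes the characteristic function of a set $A$, $|\Omega|$ the Lebesgue measure, and $\widehat{\chi_{\Omega}}(\xi)=\int_{\mathbb{R}^d}\chi_{\Omega}(y)e^{-2\pi i\xi\cdot y}\,dy$. The torus $\mathbb{T}^d$ carries normalized Lebesgue measure and $\mathbb{Z}^d$ counting measure; sequences indexed by $n\in\mathbb{Z}^d\setminus\{0\}$ are regarded as functions on $\mathbb{Z}^d$ (vanishing at $0$). For $0<p<\infty$, $\|f\|_{L^{p}(\mathbb{X},\mu)}=(\int|f|^{p}d\mu)^{1/p}$, $\|f\|_{\mathrm{Weak}\text{-}L^{p}(\mathbb{X},\mu)}=\sup_{t>0}(t^{p}\mu\{|f|>t\})^{1/p}$, and $\|f\|_{L^\infty}$ is the essential supremum. *)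

(* Defs.v *)
From HB Require Import structures.
From mathcomp Require Import all_boot all_order all_algebra.
From mathcomp Require Import all_classical all_reals all_analysis.
Set Implicit Arguments.
Unset Strict Implicit.
Unset Printing Implicit Defensive.
Import Order.TTheory GRing.Theory Num.Theory.
Import numFieldNormedType.Exports.
Local Open Scope classical_set_scope.
Local Open Scope ring_scope.

Section Defs.
Variables (R : realType) (d : nat).

Definition Rd : measurableType _ := g_sigma_algebraType (@open 'rV[R]_d).

Definition box (a b : 'rV[R]_d) : set 'rV[R]_d :=
  [set x | forall i, a 0 i <= x 0 i <= b 0 i].

(* lam is the d-dimensional Lebesgue measure on the Borel sets of R^d
   (uniquely characterized by its values on boxes). *)
Definition is_lebesgue_measure (lam : {measure set Rd -> \bar R}) : Prop :=
  forall a b : 'rV[R]_d, (forall i, a 0 i <= b 0 i) ->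
    lam (box a b) = (\prod_i (b 0 i - a 0 i))%:E.

(* fundamental domain [0,1)^d of the torus T^d = R^d / Z^d *)
Definition torus_dom : set Rd := [set x | forall i, 0 <= x 0 i < 1].

Lemma measurable_torus_dom : measurable torus_dom.
Proof.
have -> : torus_dom = \bigcap_(i in [set: 'I_d])
   ([set x : 'rV[R]_d | 0 <= x 0 i] `&` [set x : 'rV[R]_d | x 0 i < 1]).
  apply/seteqP; split => [x /= hx i _|x /= hx i]; first by have /andP[] := hx i.
  by have [] := hx i Logic.I => -> ->.
apply: fin_bigcap_measurable; first exact: finite_finset.
move=> i _; apply: measurableI.
- have hc : closed [set x : 'rV[R]_d | 0 <= x 0 i].
    have h := @preimage_closed _ _ (fun x : 'rV[R]_d => x 0 i) [set r : R | 0 <= r].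
    apply: h; last exact: closed_ge.
    move=> x _; exact: coord_continuous.
  rewrite -[X in measurable X]setCK; apply: measurableC.
  by apply: sub_sigma_algebra; exact: closed_openC.
- apply: sub_sigma_algebra.
  have h := @open_comp _ _ (fun x : 'rV[R]_d => x 0 i) [set r : R | r < 1].
  apply: h; last exact: open_lt.
  move=> x _; exact: coord_continuous.
Qed.

Definition torus_measure (lam : {measure set Rd -> \bar R}) :=
  mrestr lam measurable_torus_dom.

Definition intvec (k : 'rV[int]_d) : 'rV[R]_d := map_mx (fun z : int => z%:~R) k.

Definition dil_trans (Om : set 'rV[R]_d) (r : R) (x : 'rV[R]_d) : set 'rV[R]_d :=
  [set r *: y - x | y in Om].

Definition lattice_count (Om : set 'rV[R]_d) (r : R) (x : 'rV[R]_d) : \bar R :=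
  (\esum_(k in [set: 'rV[int]_d]) (\1_(dil_trans Om r x) (intvec k))%:E)%E.

Definition discrepancy (lam : {measure set Rd -> \bar R}) (Om : set 'rV[R]_d)
    (r : R) (x : 'rV[R]_d) : R :=
  fine (lattice_count Om r x) - r ^+ d * fine (lam Om).

Definition dotR (u v : 'rV[R]_d) : R := \sum_i u 0 i * v 0 i.

(* |hat chi_Omega (xi)| where hat chi_Omega(xi) = int_Omega e^{-2 pi i xi.y} dy
   = int_Omega cos(2 pi xi.y) dy - i int_Omega sin(2 pi xi.y) dy *)
Definition ft_re (lam : {measure set Rd -> \bar R}) (Om : set 'rV[R]_d) (xi : 'rV[R]_d) : R :=
  Rintegral lam Om (fun y => cos (2 * pi * dotR xi y)).
Definition ft_im (lam : {measure set Rd -> \bar R}) (Om : set 'rV[R]_d) (xi : 'rV[R]_d) : R :=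
  - Rintegral lam Om (fun y => sin (2 * pi * dotR xi y)).
Definition abs_ft_chi (lam : {measure set Rd -> \bar R}) (Om : set 'rV[R]_d) (xi : 'rV[R]_d) : R :=
  Num.sqrt (ft_re lam Om xi ^+ 2 + ft_im lam Om xi ^+ 2).

Definition seq_Lnorm (q : R) (c : 'rV[int]_d -> R) : \bar R :=
  poweR (\esum_(n in [set n : 'rV[int]_d | n != 0%R]) (`|c n| `^ q)%:E)%E q^-1.

Definition seq_weakLnorm (q : R) (c : 'rV[int]_d -> R) : \bar R :=
  ereal_sup [set poweR ((t `^ q)%:E *
      \esum_(n in [set n : 'rV[int]_d | n != 0%R /\ (t < `|c n|)%R]) 1)%E q^-1
    | t in [set t : R | 0 < t]].

Definition weakLnorm (mu : {measure set Rd -> \bar R}) (p : R) (f : Rd -> R) : \bar R :=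
  ereal_sup [set poweR ((t `^ p)%:E * mu [set x | (t < `|f x|)%R])%E p^-1
    | t in [set t : R | 0 < t]].

End Defs.

(* Main.v *)
(** A finite orthonormal system of unimodular functions satisfies the
    Hausdorff-Young inequality with some loss: split the coefficients into pieces
    of constant modulus and interpolate the sup and L^2 bounds of each piece by
    hand.  Applied to tensor powers the loss is polynomial in the power, hence it
    disappears.  For trigonometric polynomials on the torus the inequality follows
    by averaging over translates by a finite grid, where the characters become
    characters of a finite group.

    The lattice count is a bounded, integer valued, lower semicontinuous periodic
    function, so it is a bounded pointwise limit of trigonometric polynomials, and
    the Fourier series of the discrepancy, whose coefficients are the numbers
    [R^d hat(chi_Om)(R n)], converges to it in L^2.  Part (1) follows by passing to
    the limit in Hausdorff-Young; part (2) by cutting the series at a level of the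
    coefficients, the large ones being summed in the sup norm and the small ones
    in L^2; part (3) by adding up (2) over the O(log (2+R)) dyadic levels between
    1/2 and the maximum of the discrepancy, which takes its values in a translate
    of the integers; part (4) is the bound of a coefficient by the L^1 norm. *)
From mathcomp Require Import all_boot all_order all_algebra.
From mathcomp Require Import all_classical all_reals all_analysis.
From mathcomp Require Import measurable_realfun ess_sup_inf complex ring lra zify.
Require Import Defs.
Set Implicit Arguments.
Unset Strict Implicit.
Unset Printing Implicit Defensive.
Import Order.TTheory GRing.Theory Num.Theory.
Import numFieldNormedType.Exports.
Local Open Scope classical_set_scope.
Local Open Scope ring_scope.

(** Part (1) has constant 1, so no fixed loss is tolerable; it is removed already for finite
    systems, where the number of moduli in a tensor power is polynomial. The boundary of an open set
    may have positive measure, so the count need not be continuous almost everywhere. Openness only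
    gives lower semicontinuity, hence the detour through Lipschitz minorants. The Fourier series is
    controlled only in L^2: each upper bound is proved for finite partial sums and carried over with
    an error made small by the boundedness of the discrepancy (strong bounds) or by Chebyshev's
    inequality (weak bounds). Conjugate exponents enter as q(p-1) = p. The constants in (2) and (3)
    come from geometric series of ratios 2^(1-q) and 2^(q-2), convergent because 1 < q < 2. *)

(* Working with one packed field instance keeps the operations on complex numbers
   syntactically uniform. *)
Definition Cx (R : realType) : fieldType := complex R.

(** * Complex numbers: real and imaginary parts, conjugation, modulus *)

Section ReIm.
Variable R : realType.
Implicit Types z w : Cx R.

Definition re z : R := complex.Re (z : complex R).
Definition im z : R := complex.Im (z : complex R).
Definition cplx (x y : R) : Cx R := Complex x y.
Definition ofR (x : R) : Cx R := cplx x 0.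
Definition cj z : Cx R := cplx (re z) (- im z).
Definition cmod z : R := Num.sqrt (re z ^+ 2 + im z ^+ 2).

Lemma re_cplx x y : re (cplx x y) = x. Proof. by []. Qed.
Lemma im_cplx x y : im (cplx x y) = y. Proof. by []. Qed.
Lemma re_ofR x : re (ofR x) = x. Proof. by []. Qed.
Lemma im_ofR x : im (ofR x) = 0. Proof. by []. Qed.
Lemma re_cj z : re (cj z) = re z. Proof. by []. Qed.
Lemma im_cj z : im (cj z) = - im z. Proof. by []. Qed.
Lemma re0 : re 0 = 0. Proof. by []. Qed.
Lemma im0 : im 0 = 0. Proof. by []. Qed.
Lemma re1 : re 1 = 1. Proof. by []. Qed.
Lemma im1 : im 1 = 0. Proof. by []. Qed.
Lemma reD z w : re (z + w) = re z + re w. Proof. by case: z w => [? ?] []. Qed.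
Lemma imD z w : im (z + w) = im z + im w. Proof. by case: z w => [? ?] []. Qed.
Lemma reN z : re (- z) = - re z. Proof. by case: z. Qed.
Lemma imN z : im (- z) = - im z. Proof. by case: z. Qed.
Lemma reM z w : re (z * w) = re z * re w - im z * im w.
Proof. by case: z w => [? ?] []. Qed.
Lemma imM z w : im (z * w) = re z * im w + im z * re w.
Proof. by case: z w => [? ?] []. Qed.

End ReIm.

Notation reimE := (re_cplx, im_cplx, re_ofR, im_ofR, re_cj, im_cj, re0, im0,
  re1, im1, reD, imD, reN, imN, reM, imM).

Section Modulus.
Variable R : realType.
Implicit Types z w : Cx R.

Lemma complex_ext z w : re z = re w -> im z = im w -> z = w.
Proof. by case: z w => [a b] [c e]; rewrite /re /im /= => -> ->. Qed.

Lemma cj0 : cj 0 = 0 :> Cx R. Proof. by apply: complex_ext; rewrite !reimE ?oppr0. Qed.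
Lemma cj1 : cj 1 = 1 :> Cx R. Proof. by apply: complex_ext; rewrite !reimE ?oppr0. Qed.
Lemma cjD z w : cj (z + w) = cj z + cj w.
Proof. by apply: complex_ext; rewrite !reimE ?opprD. Qed.
Lemma cjN z : cj (- z) = - cj z.
Proof. by apply: complex_ext; rewrite !reimE. Qed.
Lemma cjM z w : cj (z * w) = cj z * cj w.
Proof. by apply: complex_ext; rewrite !reimE; ring. Qed.
Lemma cjK z : cj (cj z) = z.
Proof. by apply: complex_ext; rewrite !reimE ?opprK. Qed.
Lemma ofR0 : ofR 0 = 0 :> Cx R. Proof. by []. Qed.
Lemma ofR1 : ofR 1 = 1 :> Cx R. Proof. by []. Qed.
Lemma ofRD (x y : R) : ofR (x + y) = ofR x + ofR y.
Proof. by apply: complex_ext; rewrite !reimE ?addr0. Qed.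
Lemma ofRN (x : R) : ofR (- x) = - ofR x.
Proof. by apply: complex_ext; rewrite !reimE ?oppr0. Qed.
Lemma ofRM (x y : R) : ofR (x * y) = ofR x * ofR y.
Proof. by apply: complex_ext; rewrite !reimE; ring. Qed.
Lemma ofR_inj : injective (@ofR R). Proof. by move=> x y /(congr1 (@re R)). Qed.
Lemma ofR_nat n : ofR n%:R = n%:R :> Cx R.
Proof. by elim: n => [|n IH]; rewrite ?ofR0// -!natr1 ofRD IH ofR1. Qed.

Section Big.
Variables (I : Type) (s : seq I) (P : pred I).

Lemma cj_sum (F : I -> Cx R) :
  cj (\sum_(i <- s | P i) F i) = \sum_(i <- s | P i) cj (F i).
Proof. by elim/big_rec2: _ => [|i x z Pi <-]; rewrite ?cj0 ?cjD. Qed.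

Lemma cj_prod (F : I -> Cx R) :
  cj (\prod_(i <- s | P i) F i) = \prod_(i <- s | P i) cj (F i).
Proof. by elim/big_rec2: _ => [|i x z Pi <-]; rewrite ?cj1 ?cjM. Qed.

Lemma ofR_sum (F : I -> R) :
  ofR (\sum_(i <- s | P i) F i) = \sum_(i <- s | P i) ofR (F i).
Proof. by elim/big_rec2: _ => [|i x z Pi <-]; rewrite ?ofR0 ?ofRD. Qed.

Lemma ofR_prod (F : I -> R) :
  ofR (\prod_(i <- s | P i) F i) = \prod_(i <- s | P i) ofR (F i).
Proof. by elim/big_rec2: _ => [|i x z Pi <-]; rewrite ?ofR1 ?ofRM. Qed.
End Big.

Lemma cmod_ge0 z : 0 <= cmod z. Proof. exact: sqrtr_ge0. Qed.

Lemma cmod_normc z : cmod z = Normc.normc (z : complex R). Proof. by case: z. Qed.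

Lemma cmodM z w : cmod (z * w) = cmod z * cmod w.
Proof. by rewrite !cmod_normc; exact: Normc.normcM. Qed.

Lemma cmodD z w : cmod (z + w) <= cmod z + cmod w.
Proof. by rewrite !cmod_normc; exact: (@le_normcD R z w). Qed.

Lemma cmod_ofR (x : R) : cmod (ofR x) = `|x|.
Proof. by rewrite /cmod !reimE expr0n/= addr0 sqrtr_sqr. Qed.

Lemma cmod0 : cmod 0 = 0 :> R. Proof. by rewrite -ofR0 cmod_ofR normr0. Qed.

Lemma cmod1 : cmod 1 = 1 :> R. Proof. by rewrite -ofR1 cmod_ofR normr1. Qed.

Lemma cmodN z : cmod (- z) = cmod z.
Proof. by rewrite /cmod !reimE !sqrrN. Qed.

Lemma cmodJ z : cmod (cj z) = cmod z.
Proof. by rewrite /cmod !reimE !sqrrN. Qed.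

Lemma cmod_sqr z : cmod z ^+ 2 = re z ^+ 2 + im z ^+ 2.
Proof. by rewrite sqr_sqrtr// addr_ge0// sqr_ge0. Qed.

Lemma cmod_sqrC z : ofR (cmod z ^+ 2) = z * cj z.
Proof. by rewrite cmod_sqr; apply: complex_ext; rewrite !reimE; ring. Qed.

Lemma cmod_sqrE z : cmod z ^+ 2 = re (z * cj z).
Proof. by rewrite -cmod_sqrC. Qed.

Lemma cmod_sum (I : Type) (s : seq I) (P : pred I) (F : I -> Cx R) :
  cmod (\sum_(i <- s | P i) F i) <= \sum_(i <- s | P i) cmod (F i).
Proof.
elim/big_rec2: _ => [|i x z Pi h]; first by rewrite cmod0.
by apply: le_trans (cmodD _ _) _; rewrite lerD2l.
Qed.

Lemma cmod_prod (I : Type) (s : seq I) (P : pred I) (F : I -> Cx R) :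
  cmod (\prod_(i <- s | P i) F i) = \prod_(i <- s | P i) cmod (F i).
Proof. by elim/big_rec2: _ => [|i x z Pi <-]; rewrite ?cmod1 ?cmodM. Qed.

Lemma abs_re_le z : `|re z| <= cmod z.
Proof.
rewrite /cmod -sqrtr_sqr ler_sqrt; first by rewrite lerDl sqr_ge0.
by rewrite addr_ge0 ?sqr_ge0.
Qed.

End Modulus.

(** * Real powers and the limit behind the tensor power argument *)

Section PowR.
Variable R : realType.

Lemma ler_powR2 (r x y : R) : 0 <= r -> 0 <= x -> x <= y -> x `^ r <= y `^ r.
Proof.
move=> r0 x0 xy; apply: (ge0_ler_powR r0) => //; rewrite nnegrE//.
exact: le_trans xy.
Qed.

Lemma powR_exprn (x r : R) (n : nat) : 0 <= x -> (x ^+ n) `^ r = (x `^ r) ^+ n.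
Proof.
move=> x0; elim: n => [|n IH]; first by rewrite !expr0 powR1.
by rewrite !exprS powRM ?exprn_ge0 // IH.
Qed.

Lemma powR_prod (I : Type) (s : seq I) (F : I -> R) (r : R) :
  (forall i, 0 <= F i) -> (\prod_(i <- s) F i) `^ r = \prod_(i <- s) F i `^ r.
Proof.
move=> F0; elim: s => [|i s IH]; first by rewrite !big_nil powR1.
by rewrite !big_cons powRM ?prodr_ge0 // IH.
Qed.

(** If a exceeded b, then (1+h)^m would be at most (m+1)^D for some h > 0 and all m. Along m =
    k(D+1), Bernoulli bounds the left side below by a multiple of (k+1)^(D+1), which outgrows the
    right side, of order (k+1)^D. *)
Lemma exp_le_poly_exp (a b : R) (D : nat) : 0 <= a -> 0 <= b ->
  (forall m : nat, a ^+ m <= m.+1%:R ^+ D * b ^+ m) -> a <= b.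
Proof.
move=> a0 b0 H; rewrite leNgt; apply/negP => ba.
have {b0 H ba} [h [h0 h1 H]] : exists h, [/\ 0 < h, h <= 1 &
   forall m : nat, (1 + h) ^+ m <= (m.+1%:R : R) ^+ D].
  move: b0; rewrite le_eqVlt => /orP[/eqP b0|b0].
    by move: (H 1%N); rewrite -b0 !expr1 mulr0 leNgt b0 ba.
  (* The cap at 1 gives h(k+1) <= 1 + kh below, so that Bernoulli yields a pure power of k+1. *)
  exists (Num.min 1 (a / b - 1)); split.
  - by rewrite lt_min ltr01 /= subr_gt0 ltr_pdivlMr// mul1r.
  - by rewrite ge_min lexx.
  move=> m; have hab : 1 + Num.min 1 (a / b - 1) <= a / b.
    by rewrite -lerBrDl ge_min lexx orbT.
  apply: (@le_trans _ _ ((a / b) ^+ m)).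
    apply: lerXn2r => //; rewrite nnegrE; last by rewrite divr_ge0// ltW.
    by rewrite addr_ge0// le_min ler01 /= subr_ge0 ler_pdivlMr// mul1r ltW.
  by rewrite expr_div_n ler_pdivrMr ?exprn_gt0.
pose E := D.+1.
have H2 (k : nat) : h ^+ E * k.+1%:R <= (E%:R : R) ^+ D.
  have /= := H (k * E)%N; rewrite exprM => Hk.
  have bern : 1 + k%:R * h <= (1 + h) ^+ k.
    elim: (k) => [|j IH]; first by rewrite mul0r addr0 expr0.
    rewrite exprS; apply: (@le_trans _ _ ((1 + h) * (1 + j%:R * h))).
      have : 0 <= j%:R * (h * h) by rewrite !mulr_ge0// ltW.
      by rewrite -natr1; nra.
    by rewrite ler_pM2l//; lra.
  have hk : h * k.+1%:R <= (1 + h) ^+ k.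
    apply: le_trans bern; rewrite -natr1 mulrDr mulr1 mulrC; lra.
  have : (h * k.+1%:R) ^+ E <= (k.+1%:R * E%:R) ^+ D.
    apply: (@le_trans _ _ (((1 + h) ^+ k) ^+ E)).
      by apply: lerXn2r => //; rewrite nnegrE ?mulr_ge0 ?exprn_ge0// ltW// addr_gt0.
    apply: le_trans Hk _; apply: lerXn2r; rewrite ?nnegrE ?mulr_ge0//.
    by rewrite -natrM ler_nat mulSn addnC -addn1 leq_add2l.
  rewrite !exprMn [k.+1%:R ^+ E]exprSr mulrCA ler_pM2l ?exprn_gt0//.
have := archi_boundP (x := (E%:R : R) ^+ D / h ^+ E).
rewrite divr_ge0 ?exprn_ge0 ?(ltW h0)// => /(_ isT).
rewrite ltr_pdivrMr ?exprn_gt0// mulrC ltNge => /negP; apply.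
apply: le_trans (H2 _); rewrite ler_pM2l ?exprn_gt0// ler_nat.
by apply: leqW.
Qed.

(** The sum is at most #|T| times its largest term. The crude factor is harmless, since #|T| will be
    polynomial in the tensor power. *)
Lemma powR_sum_le (T : finType) (a : T -> R) (p : R) : 0 < p ->
  (forall t, 0 <= a t) ->
  (\sum_t a t) `^ p <= #|T|%:R `^ p * \sum_t a t `^ p.
Proof.
move=> p0 a0; case: (pickP T) => [t0 _|T0]; last first.
  by rewrite big_pred0 // [X in _ * X]big_pred0 // powR0 ?mulr0// gt_eqF.
have [t ht] : exists t, forall u, a u <= a t.
  by case: (@arg_maxP _ _ _ t0 predT a isT) => t _ ht; exists t => u; exact: ht.
apply: (@le_trans _ _ ((#|T|%:R * a t) `^ p)).
  apply: ler_powR2; [exact: ltW|exact: sumr_ge0|].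
  by rewrite mulr_natl -sumr_const; apply: ler_sum.
rewrite powRM// ler_wpM2l ?powR_ge0// (bigD1 t)//= lerDl.
by apply: sumr_ge0 => *; exact: powR_ge0.
Qed.
End PowR.

(** * Hausdorff-Young on finite sets *)

Section FiniteHausdorffYoung.
Variables (R : realType) (p q : R).
Hypotheses (p2 : 2 <= p) (pq : q * (p - 1) = p).

Let p0 : 0 < p. Proof. by apply: lt_le_trans p2; exact: ltr0Sn. Qed.

Lemma orthonormal_sum_sqr (X I : finType) (phi : I -> X -> Cx R) (c : I -> Cx R) :
  (forall i j, \sum_x phi i x * cj (phi j x) = #|X|%:R *+ (i == j)) ->
  \sum_x cmod (\sum_i c i * phi i x) ^+ 2 = #|X|%:R * \sum_i cmod (c i) ^+ 2.
Proof.
move=> orth; apply: (@ofR_inj R); rewrite ofRM ofR_nat !ofR_sum.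
under eq_bigr do rewrite cmod_sqrC cj_sum mulr_suml.
rewrite exchange_big /= mulr_sumr; apply: eq_bigr => i _.
under eq_bigr do rewrite mulr_sumr.
rewrite exchange_big /= (bigD1 i) //= [X in _ + X]big1 ?addr0 => [|j ji].
  under eq_bigr => x _ do rewrite cjM mulrACA.
  by rewrite -mulr_sumr orth eqxx mulr1n cmod_sqrC mulrC.
under eq_bigr => x _ do rewrite cjM mulrACA.
by rewrite -mulr_sumr orth eq_sym (negPf ji) mulr0n mulr0.
Qed.

(* With N terms of modulus sg the sup norm is at most N sg and the mean square is
   N sg^2, whence N^(p-1) sg^p = (N sg^q)^(p-1). *)
Lemma constant_modulus_HY (X I : finType) (phi : I -> X -> Cx R) (c : I -> Cx R)
    (P : pred I) (sg : R) :
  (forall i j, \sum_x phi i x * cj (phi j x) = #|X|%:R *+ (i == j)) ->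
  (forall i x, cmod (phi i x) <= 1) ->
  (forall i, P i -> cmod (c i) = sg) ->
  \sum_x cmod (\sum_(i | P i) c i * phi i x) `^ p <=
    #|X|%:R * (\sum_(i | P i) cmod (c i) `^ q) `^ (p - 1).
Proof.
move=> orth phi1 csg; have hp2 := p2.
have pB1 : 0 < p - 1 by lra.
case: (pickP P) => [i0 Pi0|P0]; last first.
  rewrite big1 ?mulr_ge0 ?powR_ge0// => x _.
  by rewrite big_pred0// cmod0 powR0// gt_eqF.
have sg0 : 0 <= sg by rewrite -(csg _ Pi0) cmod_ge0.
pose N : R := \sum_(i | P i) 1.
have N0 : 0 <= N by apply: sumr_ge0.
have fB x : cmod (\sum_(i | P i) c i * phi i x) <= N * sg.
  apply: le_trans (cmod_sum _ _ _) _.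
  rewrite mulr_suml; apply: ler_sum => i Pi; rewrite cmodM (csg _ Pi) mul1r.
  by rewrite ler_piMr.
have L2 : \sum_x cmod (\sum_(i | P i) c i * phi i x) ^+ 2 = #|X|%:R * (N * sg ^+ 2).
  have := orthonormal_sum_sqr (fun i => if P i then c i else 0) orth.
  have E x : \sum_i (if P i then c i else 0) * phi i x = \sum_(i | P i) c i * phi i x.
    by rewrite [RHS]big_mkcond; apply: eq_bigr => i _; case: ifP; rewrite ?mul0r.
  under eq_bigr do rewrite E.
  move=> ->; congr (_ * _).
  rewrite (eq_bigr (fun i => if P i then sg ^+ 2 else 0)).
    by rewrite -big_mkcond /= mulr_suml; apply: eq_bigr => i _; rewrite mul1r.
  by move=> i _; case: ifP => [Pi|_]; rewrite ?csg// cmod0 expr0n.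
apply: (@le_trans _ _ (\sum_x (N * sg) `^ (p - 2) *
    cmod (\sum_(i | P i) c i * phi i x) ^+ 2)).
  apply: ler_sum => x _.
  have pE (a : R) : 0 <= a -> a `^ p = a `^ (p - 2) * a ^+ 2.
    move=> a0; have {1}-> : p = (p - 2) + 2 by lra.
    rewrite powRD; first by rewrite powR_mulrn.
    by apply/implyP => /eqP; lra.
  rewrite pE ?cmod_ge0// ler_wpM2r ?sqr_ge0//.
  by apply: ler_powR2; rewrite ?subr_ge0 ?cmod_ge0.
rewrite -mulr_sumr L2 mulrCA ler_wpM2l//.
rewrite (eq_bigr (fun=> 1 * sg `^ q)) => [|i Pi]; last by rewrite csg// mul1r.
rewrite -mulr_suml -/N !powRM ?powR_ge0// -powRrM pq le_eqVlt; apply/orP; left.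
apply/eqP; rewrite mulrACA; congr (_ * _).
  rewrite -[X in _ * X]powRr1// -powRD; last by apply/implyP => /eqP; lra.
  by congr (_ `^ _); lra.
rewrite -powR_mulrn// -powRD; last by apply/implyP => /eqP; lra.
by congr (_ `^ _); lra.
Qed.

(** [ty] sorts the indices into classes of constant modulus. Splitting the sum into classes costs
    #|T|^p; each class obeys the constant modulus bound, with its coefficient sum enlarged to the
    full one, and adding up the classes costs another #|T|. *)
Lemma typed_HY (X I T : finType) (phi : I -> X -> Cx R) (c : I -> Cx R)
    (ty : I -> T) (sg : T -> R) :
  (forall i j, \sum_x phi i x * cj (phi j x) = #|X|%:R *+ (i == j)) ->
  (forall i x, cmod (phi i x) <= 1) ->
  (forall i, cmod (c i) = sg (ty i)) ->
  \sum_x cmod (\sum_i c i * phi i x) `^ p <=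
    #|T|%:R `^ p * (#|T|%:R * (#|X|%:R * (\sum_i cmod (c i) `^ q) `^ (p - 1))).
Proof.
move=> orth phi1 csg; have hp2 := p2.
pose f t x := cmod (\sum_(i | ty i == t) c i * phi i x).
apply: (@le_trans _ _ (\sum_x #|T|%:R `^ p * \sum_t f t x `^ p)).
  apply: ler_sum => x _.
  apply: le_trans (powR_sum_le p0 (fun t => cmod_ge0 _)).
  apply: ler_powR2; [exact: ltW|exact: cmod_ge0|].
  by rewrite (partition_big ty predT)//=; exact: cmod_sum.
rewrite -mulr_sumr ler_wpM2l ?powR_ge0// exchange_big /=.
rewrite mulr_natl -sumr_const; apply: ler_sum => t _.
have := @constant_modulus_HY _ _ _ c (fun i => ty i == t) (sg t) orth phi1.
move=> /(_ _)/le_trans; apply; first by move=> i /eqP <-.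
rewrite ler_wpM2l//; apply: ler_powR2; first lra.
  by apply: sumr_ge0 => *; exact: powR_ge0.
rewrite [leRHS](bigID (fun i => ty i == t)) /= lerDl.
by apply: sumr_ge0 => *; exact: powR_ge0.
Qed.

(* Tensor powers: the coefficients of the m-th power take at most (m+1)^#|I|
   moduli, so the loss in [typed_HY] is polynomial in m and disappears. *)
Lemma finite_HY (X I : finType) (phi : I -> X -> Cx R) (c : I -> Cx R) :
  (forall i j, \sum_x phi i x * cj (phi j x) = #|X|%:R *+ (i == j)) ->
  (forall i x, cmod (phi i x) <= 1) ->
  \sum_x cmod (\sum_i c i * phi i x) `^ p <=
    #|X|%:R * (\sum_i cmod (c i) `^ q) `^ (p - 1).
Proof.
move=> orth phi1; have hp2 := p2.
(* With u = (m+1)^#|I| types the loss of [typed_HY] is u^p u, at most u to the power [archi_bound p]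
   + 1. *)
pose D := (#|I| * (Num.Def.archi_bound p).+1)%N.
apply: (@exp_le_poly_exp _ _ _ D).
- by apply: sumr_ge0 => *; exact: powR_ge0.
- by rewrite mulr_ge0// powR_ge0.
move=> m.
pose Xm : finType := {ffun 'I_m -> X}; pose Im : finType := {ffun 'I_m -> I}.
pose Tm : finType := {ffun I -> 'I_m.+1}.
pose phim (i : Im) (x : Xm) := \prod_l phi (i l) (x l).
pose cm (i : Im) := \prod_l c (i l).
(* The type of a multi-index records how often each index occurs, which determines the modulus of
   the product coefficient; the counts are at most m, so [inord] truncates nothing. *)
pose tym (i : Im) : Tm := [ffun j => inord #|[pred l | i l == j]|].
pose sgm (t : Tm) := \prod_j cmod (c j) ^+ t j.
have orthm (i j : Im) : \sum_x phim i x * cj (phim j x) = #|Xm|%:R *+ (i == j).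
  rewrite /phim; under eq_bigr do rewrite cj_prod -big_split /=.
  rewrite -(bigA_distr_bigA (fun l x => phi (i l) x * cj (phi (j l) x))) /=.
  under eq_bigr do rewrite orth.
  have [->|ij] := eqVneq i j.
    under eq_bigr do rewrite eqxx mulr1n.
    by rewrite prodr_const card_ffun !card_ord natrX.
  have [l hl] : exists l, i l != j l.
    apply/existsP; rewrite -negb_forall; apply: contra ij => /forallP h.
    by apply/eqP/ffunP => l; exact/eqP.
  by rewrite (bigD1 l)//= (negPf hl) mulr0n mul0r.
have phim1 i x : cmod (phim i x) <= 1.
  rewrite cmod_prod; apply: prodr_ile1 => l _; rewrite cmod_ge0 /=.
  exact: phi1.
have cmsg i : cmod (cm i) = sgm (tym i).
  rewrite cmod_prod (partition_big i predT)//=; apply: eq_bigr => j _.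
  rewrite (eq_bigr (fun=> cmod (c j))) => [|l /eqP <- //].
  rewrite prodr_const ffunE inordK// ltnS -[leqRHS](card_ord m).
  exact: max_card.
have := typed_HY orthm phim1 cmsg.
have -> : \sum_x cmod (\sum_i cm i * phim i x) `^ p =
    (\sum_x cmod (\sum_i c i * phi i x) `^ p) ^+ m.
  under eq_bigr do under eq_bigr do rewrite /cm /phim -big_split /=.
  rewrite -[in RHS](card_ord m) -prodr_const.
  rewrite (bigA_distr_bigA (fun _ x => cmod (\sum_i c i * phi i x) `^ p)) /=.
  apply: eq_bigr => x _.
  rewrite -(bigA_distr_bigA (fun l i => c i * phi i (x l))) /=.
  by rewrite cmod_prod powR_prod// => *; exact: cmod_ge0.
have -> : \sum_i cmod (cm i) `^ q = (\sum_i cmod (c i) `^ q) ^+ m.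
  rewrite -[in RHS](card_ord m) -prodr_const.
  rewrite (bigA_distr_bigA (fun _ i => cmod (c i) `^ q)) /=.
  apply: eq_bigr => i _.
  by rewrite cmod_prod powR_prod// => *; exact: cmod_ge0.
move=> /le_trans; apply.
rewrite powR_exprn; last by apply: sumr_ge0 => *; exact: powR_ge0.
rewrite mulrA exprMn /Xm /Tm !card_ffun !card_ord !natrX.
rewrite ler_wpM2r ?mulr_ge0 ?exprn_ge0 ?powR_ge0// /D exprM.
set u : R := m.+1%:R ^+ #|I|.
have u1 : 1 <= u by rewrite /u -natrX ler1n expn_gt0.
rewrite exprSr ler_pM ?powR_ge0//; first by lra.
rewrite -powR_mulrn; last by lra.
by apply: ler_powR => //; apply: ltW; exact: archi_boundP (ltW p0).
Qed.

End FiniteHausdorffYoung.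

(** * Characters of the torus and of its finite grids *)

Section Exponential.
Variable R : realType.
Implicit Types (s t : R).

Definition ee t : Cx R := cplx (cos (2 * pi * t)) (sin (2 * pi * t)).

Lemma eeD s t : ee (s + t) = ee s * ee t.
Proof.
by apply: complex_ext; rewrite !reimE mulrDr ?cosD ?sinD//; ring.
Qed.

Lemma ee0 : ee 0 = 1.
Proof. by apply: complex_ext; rewrite /ee !reimE mulr0 ?cos0 ?sin0. Qed.

Lemma cj_ee t : cj (ee t) = ee (- t).
Proof. by apply: complex_ext; rewrite /ee !reimE mulrN ?cosN ?sinN. Qed.

Lemma cmod_ee t : cmod (ee t) = 1.
Proof. by rewrite /cmod /ee !reimE cos2Dsin2 sqrtr1. Qed.

Lemma ee_mulrn t n : ee (n%:R * t) = ee t ^+ n.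
Proof.
elim: n => [|n IH]; first by rewrite mul0r ee0 expr0.
by rewrite -natr1 mulrDl mul1r eeD IH exprSr.
Qed.

Lemma ee1 : ee 1 = 1.
Proof.
apply: complex_ext; rewrite /ee !reimE mulr1 mulr2n mulrDl mul1r.
  by rewrite cosD cospi sinpi; ring.
by rewrite sinD cospi sinpi; ring.
Qed.

Lemma ee_nat n : ee n%:R = 1.
Proof. by rewrite -[n%:R]mulr1 ee_mulrn ee1 expr1n. Qed.

Lemma ee_int (k : int) : ee k%:~R = 1.
Proof.
case: k => n; first exact: ee_nat.
by rewrite NegzE mulrNz -cj_ee ee_nat cj1.
Qed.

Lemma ee_half : ee (2^-1) = -1.
Proof.
have -> : ee (2^-1) = cplx (cos pi) (sin pi).
  by rewrite /ee; congr cplx; congr (_ _); rewrite mulrAC divff ?mul1r.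
by rewrite cospi sinpi; apply: complex_ext; rewrite !reimE ?oppr0.
Qed.

Lemma ee_neq1_pos t : 0 < t -> t < 1 -> ee t != 1.
Proof.
move=> t0 t1; apply/eqP => /(congr1 (@re R)); rewrite /ee !reimE => h.
have : 0 < sin (pi * t).
  apply: sin_gt0_pi; rewrite mulr_gt0 ?pi_gt0//=.
  by rewrite -[ltRHS]mulr1 ltr_pM2l ?pi_gt0.
have e : 2 * pi * t = pi * t + pi * t by ring.
move: h; rewrite e cosD; have := cos2Dsin2 (pi * t); nra.
Qed.

Lemma ee_neq1 (k : int) (M : nat) : k != 0 -> (`|k| < M)%N -> ee (k%:~R / M%:R) != 1.
Proof.
move=> k0 kM.
have M0 : (0 < M%:R :> R) by rewrite ltr0n; case: (M) kM.
have pos (n : nat) : (0 < n)%N -> (n < M)%N -> ee (n%:R / M%:R) != 1.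
  move=> n0 nM; apply: ee_neq1_pos; first by rewrite divr_gt0// ltr0n.
  by rewrite ltr_pdivrMr// mul1r ltr_nat.
case: k k0 kM => n k0 kM; first by apply: pos; rewrite // lt0n.
rewrite NegzE mulrNz mulNr -cj_ee; apply/eqP => /(congr1 (@cj R)).
by rewrite cjK cj1 => /eqP; apply/negP; apply: pos.
Qed.

(** Geometric sum of ratio z = ee(k/M): z^M = 1, and |k| < M excludes z = 1 unless k = 0. *)
Lemma sum_ee (k : int) (M : nat) : (`|k| < M)%N ->
  \sum_(j < M) ee (k%:~R * (j%:R / M%:R)) = M%:R *+ (k == 0).
Proof.
move=> kM.
have M0 : (M%:R != 0 :> R) by rewrite pnatr_eq0; case: (M) kM.
have [->|k0] := eqVneq k 0.
  under eq_bigr do rewrite mul0r ee0.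
  by rewrite sumr_const card_ord mulr1n.
rewrite mulr0n; have z1 := ee_neq1 k0 kM.
set z := ee _ in z1.
under eq_bigr => j _.
  rewrite (_ : _ * _ = j%:R * (k%:~R / M%:R)); last by ring.
  rewrite ee_mulrn -/z; over.
apply: (mulfI (x := z - 1)); first by rewrite subr_eq0.
rewrite -subrX1 mulr0 /z -ee_mulrn mulrC divfK//.
by rewrite ee_int subrr.
Qed.

End Exponential.

Section Characters.
Variables (R : realType) (d : nat).
Implicit Types (n m : 'rV[int]_d) (x y : 'rV[R]_d).

Definition ech n x : Cx R := ee (dotR (intvec R n) x).

Lemma dotRDr (u x y : 'rV[R]_d) : dotR u (x + y) = dotR u x + dotR u y.
Proof. by rewrite /dotR -big_split; apply: eq_bigr => i _; rewrite mxE mulrDr. Qed.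

Lemma dotRDl (u x y : 'rV[R]_d) : dotR (x + y) u = dotR x u + dotR y u.
Proof. by rewrite /dotR -big_split; apply: eq_bigr => i _; rewrite mxE mulrDl. Qed.

Lemma dotRNl (u x : 'rV[R]_d) : dotR (- x) u = - dotR x u.
Proof. by rewrite /dotR -sumrN; apply: eq_bigr => i _; rewrite mxE mulNr. Qed.

Lemma intvecD n m : intvec R (n + m) = intvec R n + intvec R m.
Proof. by apply/rowP => i; rewrite !mxE intrD. Qed.

Lemma intvecN n : intvec R (- n) = - intvec R n.
Proof. by apply/rowP => i; rewrite !mxE mulrNz. Qed.

Lemma echDr n x y : ech n (x + y) = ech n x * ech n y.
Proof. by rewrite /ech dotRDr eeD. Qed.

Lemma echDl n m x : ech (n + m) x = ech n x * ech m x.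
Proof. by rewrite /ech intvecD dotRDl eeD. Qed.

Lemma cj_ech n x : cj (ech n x) = ech (- n) x.
Proof. by rewrite /ech intvecN dotRNl cj_ee. Qed.

Lemma cmod_ech n x : cmod (ech n x) = 1. Proof. exact: cmod_ee. Qed.

Lemma ech0 x : ech 0 x = 1.
Proof.
rewrite /ech (_ : dotR _ _ = 0) ?ee0// /dotR big1// => i _.
by rewrite !mxE mul0r.
Qed.

Lemma ech_prod n x : ech n x = \prod_i ee ((n 0 i)%:~R * x 0 i).
Proof.
rewrite /ech /dotR; elim/big_rec2: _ => [|i y z _ <-]; first exact: ee0.
by rewrite eeD !mxE.
Qed.

Lemma ech_int n (k : 'rV[int]_d) : ech n (intvec R k) = 1.
Proof. by rewrite ech_prod big1// => i _; rewrite mxE -intrM ee_int. Qed.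

Lemma ech_periodic n x (k : 'rV[int]_d) : ech n (x + intvec R k) = ech n x.
Proof. by rewrite echDr ech_int mulr1. Qed.

Definition grid_point (M : nat) (J : {ffun 'I_d -> 'I_M}) : 'rV[R]_d :=
  \row_i ((J i)%:R / M%:R).

(** No aliasing: the sum over the product grid factors, and a coordinate in which n and m differ, by
    less than M, makes its factor vanish. *)
Lemma grid_orth (M : nat) n m : (forall i, (absz ((n - m)%R 0%R i) < M)%N) ->
  \sum_J ech n (@grid_point M J) * cj (ech m (grid_point J)) =
  #|{ffun 'I_d -> 'I_M}|%:R *+ (n == m).
Proof.
move=> nm; under eq_bigr do rewrite cj_ech -echDl ech_prod.
under eq_bigr do under eq_bigr do rewrite [grid_point _ _ _]mxE.
rewrite -(bigA_distr_bigA
  (fun i (j : 'I_M) => ee (((n - m) 0 i)%:~R * (j%:R / M%:R)))) /=.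
rewrite (eq_bigr (fun i => M%:R *+ (n 0 i == m 0 i))) => [|i _]; last first.
  by rewrite sum_ee// !mxE subr_eq0.
have [->|nm0] := eqVneq n m.
  under eq_bigr do rewrite eqxx mulr1n.
  by rewrite prodr_const card_ffun !card_ord natrX mulr1n.
have [i hi] : exists i, n 0 i != m 0 i.
  apply/existsP; rewrite -negb_forall; apply: contra nm0 => /forallP h.
  by apply/eqP/rowP => l; exact/eqP.
by rewrite (bigD1 i)//= (negPf hi) mulr0n mul0r.
Qed.

Lemma seq_int_bound (G : seq 'rV[int]_d) :
  exists B : nat, forall n, n \in G -> forall i, (absz (n 0%R i) <= B)%N.
Proof.
elim: G => [|n G [B hB]]; first by exists 0%N.
exists (B + \sum_i absz (n 0%R i))%N => m; rewrite inE => /predU1P[->|/hB h] i.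
  by rewrite (bigD1 i)//= addnCA leq_addr.
by apply: leq_trans (h i) _; rewrite leq_addr.
Qed.

(* The shift x is absorbed by the coefficients, whose moduli do not change. *)
Lemma grid_HY (p q : R) (G : seq 'rV[int]_d) (B : nat) (c : 'rV[int]_d -> Cx R) x :
  2 <= p -> q * (p - 1) = p -> uniq G ->
  (forall n, n \in G -> forall i, (absz (n 0%R i) <= B)%N) ->
  \sum_J cmod (\sum_(n <- G) c n * ech n (x + @grid_point (2 * B).+1 J)) `^ p <=
  #|{ffun 'I_d -> 'I_(2 * B).+1}|%:R * (\sum_(n <- G) cmod (c n) `^ q) `^ (p - 1).
Proof.
(* Frequencies with coordinates in [-B, B] differ by at most 2B, so 2B+1 grid points per axis keep
   their characters orthogonal. *)
move=> p2 pq uG hB; set M := (2 * B).+1.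
pose nn (i : 'I_(size G)) := nth 0 G i.
have nG i : nn i \in G by rewrite mem_nth.
have := @finite_HY R p q p2 pq {ffun 'I_d -> 'I_M} 'I_(size G)
  (fun i J => ech (nn i) (grid_point J)) (fun i => c (nn i) * ech (nn i) x).
move=> /(_ _ _)/le_trans => h.
under eq_bigr => J _.
  rewrite (big_nth 0) big_mkord.
  under eq_bigr do rewrite echDr mulrA.
  over.
apply: h.
- move=> i j; rewrite grid_orth.
    by rewrite /nn nth_uniq.
  move=> l; rewrite !mxE /M; move: (hB _ (nG i) l) (hB _ (nG j) l).
  by move: (nn i _ l) (nn j _ l) => a b; lia.
- by move=> i J; rewrite cmod_ech.
rewrite (big_nth 0) big_mkord.
by under eq_bigr do rewrite cmodM cmod_ech mulr1.
Qed.

End Characters.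

(** * Trigonometric approximation of lower semicontinuous functions *)

Section Fejer.
Variable R : realType.

(** The Fejer kernel (sin(pi M t) / (M sin(pi t)))^2, normalised so that its translates by the M
    grid points of a period sum to 1. *)
Definition fejer (M : nat) (t : R) : R :=
  cmod (\sum_(a < M) ee (a%:R * t)) ^+ 2 / M%:R ^+ 2.

Lemma fejer_ge0 M t : 0 <= fejer M t.
Proof. by rewrite divr_ge0 ?sqr_ge0. Qed.

(** Parseval on Z/M: as a function of j the inner sum is a combination of M orthogonal characters
    with unimodular coefficients, of total square M * M. *)
Lemma sum_fejer (M : nat) (t : R) : (0 < M)%N ->
  \sum_(j < M) fejer M (t - j%:R / M%:R) = 1.
Proof.
move=> M0; have M0' : (M%:R != 0 :> R) by rewrite pnatr_eq0 -lt0n.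
rewrite -mulr_suml.
have := @orthonormal_sum_sqr R 'I_M 'I_M
  (fun a j => ee (- (a%:R * (j%:R / M%:R)))) (fun a => ee (a%:R * t)).
under eq_bigr => j _ do under eq_bigr => a _ do rewrite -eeD -mulrBr.
move=> ->.
  under eq_bigr do rewrite cmod_ee expr1n.
  by rewrite sumr_const !card_ord -expr2 divff// expf_neq0.
move=> i j; under eq_bigr do rewrite cj_ee opprK -eeD addrC -mulrBl.
have -> : (j%:R - i%:R : R) = ((j : int) - (i : int))%:~R by rewrite intrD mulrNz.
rewrite sum_ee; last by have := ltn_ord i; have := ltn_ord j; lia.
rewrite card_ord; congr (_ *+ _); congr nat_of_bool.
by apply/eqP/eqP => [h|->]; [apply: val_inj => /=; lia|rewrite subrr].
Qed.

(** Multiplication by 1 - ee t telescopes the geometric sum to 1 - ee(M t), whose modulus is at most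
    2. *)
Lemma fejer_mul_dist (M : nat) (t : R) : (0 < M)%N ->
  fejer M t * cmod (1 - ee t) ^+ 2 <= 4 / M%:R ^+ 2.
Proof.
move=> M0; rewrite mulrAC ler_pM2r ?invr_gt0 ?exprn_gt0 ?ltr0n//.
rewrite -exprMn -cmodM.
under eq_bigr do rewrite ee_mulrn.
rewrite mulrC -opprB mulNr -subrX1 cmodN -ee_mulrn.
have h : cmod (ee (M%:R * t) - 1) <= 2.
  by apply: le_trans (cmodD _ _) _; rewrite cmodN cmod1 cmod_ee.
have := cmod_ge0 (ee (M%:R * t) - 1); nra.
Qed.

(** u <= s/2 + u^2/(2s) reduces the first moment to the total mass 1 and the second moment, at most
    M * 4/M^2; s is left free, to be balanced against M. *)
Lemma sum_fejer_dist (M : nat) (t s : R) : (0 < M)%N -> 0 < s ->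
  \sum_(j < M) fejer M (t - j%:R / M%:R) * cmod (ee t - ee (j%:R / M%:R)) <=
  s / 2 + 2 / (s * M%:R).
Proof.
move=> M0 s0; have M0' : (0 < M%:R :> R) by rewrite ltr0n.
pose u j := cmod (1 - ee (t - j%:R / M%:R)).
have uE j : cmod (ee t - ee (j%:R / M%:R)) = u j.
  have -> : ee t - ee (j%:R / M%:R) = - (ee (j%:R / M%:R) * (1 - ee (t - j%:R / M%:R))).
    by rewrite mulrBr mulr1 -eeD addrCA subrr addr0 opprB.
  by rewrite cmodN cmodM cmod_ee mul1r.
under eq_bigr do rewrite uE.
apply: (@le_trans _ _ (\sum_(j < M) (s / 2 * fejer M (t - j%:R / M%:R) +
    (2 * s)^-1 * (fejer M (t - j%:R / M%:R) * u j ^+ 2)))).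
  apply: ler_sum => j _.
  have -> : s / 2 * fejer M (t - j%:R / M%:R) +
    (2 * s)^-1 * (fejer M (t - j%:R / M%:R) * u j ^+ 2) =
    fejer M (t - j%:R / M%:R) * (s / 2 + (2 * s)^-1 * u j ^+ 2) by ring.
  rewrite ler_wpM2l ?fejer_ge0// -subr_ge0.
  have -> : s / 2 + (2 * s)^-1 * u j ^+ 2 - u j = (2 * s)^-1 * (s - u j) ^+ 2.
    by field; rewrite gt_eqF.
  by rewrite mulr_ge0 ?sqr_ge0// invr_ge0 mulr_ge0// ltW.
rewrite big_split /= -!mulr_sumr sum_fejer// mulr1 lerD2l.
apply: (@le_trans _ _ ((2 * s)^-1 * \sum_(j < M) 4 / M%:R ^+ 2)).
  rewrite ler_wpM2l ?invr_ge0 ?mulr_ge0 ?(ltW s0)//.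
  by apply: ler_sum => j _; exact: fejer_mul_dist.
rewrite sumr_const card_ord -mulr_natl le_eqVlt; apply/orP; left; apply/eqP.
by field; rewrite !gt_eqF.
Qed.

End Fejer.

Section TrigApprox.
Variables (R : realType) (d : nat).
Implicit Types (x y : 'rV[R]_d).

(** The list may repeat frequencies, so that sums and products are mere list operations;
    [trigp_expand] collects equal frequencies afterwards. *)
Definition trigp (f : 'rV[R]_d -> Cx R) : Prop :=
  exists s : seq (Cx R * 'rV[int]_d), forall x, f x = \sum_(u <- s) u.1 * ech u.2 x.

Lemma trigp_ext f g : f =1 g -> trigp f -> trigp g.
Proof. by move=> fg [s h]; exists s => x; rewrite -fg. Qed.

Lemma trigp_cst a : trigp (fun=> a).
Proof. by exists [:: (a, 0)] => x; rewrite big_seq1 ech0 mulr1. Qed.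

Lemma trigp_ech n : trigp (@ech R d n).
Proof. by exists [:: (1, n)] => x; rewrite big_seq1 mul1r. Qed.

Lemma trigpD f g : trigp f -> trigp g -> trigp (fun x => f x + g x).
Proof. by move=> [s h] [t k]; exists (s ++ t) => x; rewrite big_cat /= h k. Qed.

Lemma trigpM f g : trigp f -> trigp g -> trigp (fun x => f x * g x).
Proof.
move=> [s h] [t k]; exists [seq (u.1 * v.1, u.2 + v.2) | u <- s, v <- t] => x.
rewrite big_allpairs_dep /= h k mulr_suml; apply: eq_bigr => u _.
by rewrite mulr_sumr; apply: eq_bigr => v _; rewrite /= echDl mulrACA.
Qed.

Lemma trigp_cj f : trigp f -> trigp (fun x => cj (f x)).
Proof.
move=> [s h]; exists [seq (cj u.1, - u.2) | u <- s] => x.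
by rewrite big_map h cj_sum; apply: eq_bigr => u _; rewrite cjM cj_ech.
Qed.

Lemma trigp_sum (I : Type) (s : seq I) (F : I -> 'rV[R]_d -> Cx R) :
  (forall i, trigp (F i)) -> trigp (fun x => \sum_(i <- s) F i x).
Proof.
move=> h; elim: s => [|i s IH].
  by apply: trigp_ext (trigp_cst 0) => x; rewrite big_nil.
by apply: trigp_ext (trigpD (h i) IH) => x; rewrite big_cons.
Qed.

Lemma trigp_prod (I : Type) (s : seq I) (F : I -> 'rV[R]_d -> Cx R) :
  (forall i, trigp (F i)) -> trigp (fun x => \prod_(i <- s) F i x).
Proof.
move=> h; elim: s => [|i s IH].
  by apply: trigp_ext (trigp_cst 1) => x; rewrite big_nil.
by apply: trigp_ext (trigpM (h i) IH) => x; rewrite big_cons.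
Qed.

Lemma trigp_coord (a : nat) (i : 'I_d) : trigp (fun x => ee (a%:R * x 0 i)).
Proof.
apply: trigp_ext (trigp_ech (\row_j (a%:Z *+ (j == i)))) => x.
rewrite ech_prod (bigD1 i)//= big1 => [|j ji]; last first.
  by rewrite !mxE (negPf ji) mulr0n mul0r ee0.
by rewrite !mxE eqxx mulr1n mulr1.
Qed.

Lemma trigp_fejer (M : nat) (i : 'I_d) (t : R) :
  trigp (fun x => ofR (fejer M (x 0 i - t))).
Proof.
pose f (x : 'rV[R]_d) := \sum_(a < M) ee (a%:R * x 0 i) * ee (- (a%:R * t)).
have tf : trigp f.
  by apply: trigp_sum => a; apply: trigpM (trigp_cst _); exact: trigp_coord.
apply: trigp_ext (trigpM (trigpM tf (trigp_cj tf)) (trigp_cst (ofR (M%:R ^+ 2)^-1))).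
move=> x; rewrite /fejer ofRM cmod_sqrC; congr (_ * cj _ * _).
all: by apply: eq_bigr => a _; rewrite -eeD -mulrBr.
Qed.

(** Sum of chordal distances: a pseudometric on R^d vanishing exactly on pairs congruent modulo Z^d,
    so that what is built from it is periodic. *)
Definition rho x y : R := \sum_i cmod (ee (x 0 i) - ee (y 0 i)).

Lemma rho_ge0 x y : 0 <= rho x y.
Proof. by apply: sumr_ge0 => i _; exact: cmod_ge0. Qed.

Lemma rhoxx x : rho x x = 0.
Proof. by rewrite /rho big1// => i _; rewrite subrr cmod0. Qed.

Lemma rhoC x y : rho x y = rho y x.
Proof. by apply: eq_bigr => i _; rewrite -cmodN opprB. Qed.

Lemma rho_triangle x y z : rho x z <= rho x y + rho y z.
Proof.
rewrite -big_split; apply: ler_sum => i _; apply: le_trans (cmodD _ _).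
by rewrite addrA subrK.
Qed.

Definition fejerd (M : nat) (J : {ffun 'I_d -> 'I_M}) x : R :=
  \prod_i fejer M (x 0 i - (J i)%:R / M%:R).

Lemma fejerd_ge0 M (J : {ffun 'I_d -> 'I_M}) x : 0 <= fejerd J x.
Proof. by apply: prodr_ge0 => i _; exact: fejer_ge0. Qed.

Lemma sum_fejerd M x : (0 < M)%N -> \sum_J @fejerd M J x = 1.
Proof.
move=> M0; rewrite /fejerd.
rewrite -(bigA_distr_bigA (fun i (j : 'I_M) => fejer M (x 0 i - j%:R / M%:R))) /=.
by rewrite big1// => i _; exact: sum_fejer.
Qed.

(** For the i-th summand of [rho] the sum over the grid factors over the coordinates; all factors
    but the i-th equal 1, which leaves the one-dimensional first moment. *)
Lemma sum_fejerd_rho M x (s : R) : (0 < M)%N -> 0 < s ->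
  \sum_J @fejerd M J x * rho x (grid_point R J) <= d%:R * (s / 2 + 2 / (s * M%:R)).
Proof.
move=> M0 s0; rewrite /rho; under eq_bigr do rewrite mulr_sumr.
rewrite exchange_big /= -[in leRHS](card_ord d) mulr_natl -sumr_const.
apply: ler_sum => i _; apply: le_trans (sum_fejer_dist (x 0 i) M0 s0).
pose H l (j : 'I_M) := fejer M (x 0 l - j%:R / M%:R) *
  (if l == i then cmod (ee (x 0 i) - ee (j%:R / M%:R)) else 1).
rewrite (eq_bigr (fun J : {ffun 'I_d -> 'I_M} => \prod_l H l (J l))); last first.
  move=> J _; rewrite /H big_split /=; congr (_ * _).
  by rewrite -big_mkcond /= big_pred1_eq mxE.
rewrite -bigA_distr_bigA /= (bigD1 i)//= {1}/H eqxx [X in _ * X]big1 ?mulr1//.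
move=> l li; rewrite /H (negPf li); under eq_bigr do rewrite mulr1.
exact: sum_fejer.
Qed.

(* Infimal convolution with m rho turns a lower semicontinuous function into
   Lipschitz ones that increase to it; these are interpolated by Fejer kernels. *)
Lemma lsc_trig_approx (N : 'rV[R]_d -> R) (B : R) :
  (forall x, 0 <= N x <= B) ->
  (forall x, exists2 e, 0 < e & forall y, rho x y < e -> N x <= N y) ->
  exists P : nat -> 'rV[R]_d -> Cx R, [/\ forall m, trigp (P m),
    forall m x, cmod (P m x) <= B &
    forall x (e : R), 0 < e -> exists m0, forall m, (m0 <= m)%N ->
      cmod (P m x - ofR (N x)) <= e].
Proof.
move=> N0B Nlsc.
pose S (m : nat) x := [set N y + m%:R * rho x y | y in [set: 'rV[R]_d]].
pose G m x := inf (S m x).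
have Slb m x : lbound (S m x) 0.
  move=> _ [y _ <-]; have /andP[? _] := N0B y.
  by rewrite addr_ge0// mulr_ge0// rho_ge0.
have Sinf m x : has_inf (S m x).
  by split; [exists (N x + m%:R * rho x x), x|exists 0; exact: Slb].
have Gle m x y : G m x <= N y + m%:R * rho x y.
  by apply: ge_inf; [exists 0; exact: Slb|exists y].
have leG m x a : (forall y, a <= N y + m%:R * rho x y) -> a <= G m x.
  by move=> h; apply: lb_le_inf; [exact: (Sinf m x).1|move=> _ [y _ <-]].
have GN m x : G m x <= N x.
  by have := Gle m x x; rewrite rhoxx mulr0 addr0.
have G0 m x : 0 <= G m x.
  apply: leG => y; have /andP[? _] := N0B y.
  by rewrite addr_ge0// mulr_ge0// rho_ge0.
have Glip m x y : G m x - G m y <= m%:R * rho x y.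
  rewrite lerBlDr -lerBlDl; apply: leG => z; rewrite lerBlDl addrCA -mulrDr.
  apply: le_trans (Gle m x z) _; rewrite lerD2l ler_wpM2l//.
  exact: rho_triangle.
have Glip' m x y : `|G m x - G m y| <= m%:R * rho y x.
  rewrite ler_norml lerNl opprB Glip rhoC Glip//.
(* The fourth power, with s = (m+1)^-2, makes the first moment at most 5d / (2(m+1)^2), small enough
   to beat the Lipschitz constant m. *)
pose M m := (m.+1 ^ 4)%N.
have M0 m : (0 < M m)%N by rewrite expn_gt0.
pose P m x := \sum_(J : {ffun 'I_d -> 'I_(M m)})
  ofR (G m (grid_point R J)) * ofR (fejerd J x).
have PE m x : P m x = ofR (\sum_J G m (@grid_point R d (M m) J) * fejerd J x).
  by rewrite ofR_sum; apply: eq_bigr => J _; rewrite ofRM.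
have PG m x : cmod (P m x - ofR (G m x)) <= 3 * d%:R / m.+1%:R.
  have -> : P m x - ofR (G m x) =
      ofR (\sum_J (G m (@grid_point R d (M m) J) - G m x) * fejerd J x).
    rewrite PE -ofRN -ofRD; congr ofR.
    under [in RHS]eq_bigr do rewrite mulrBl.
    by rewrite sumrB -mulr_sumr sum_fejerd// mulr1.
  rewrite cmod_ofR; apply: le_trans (ler_norm_sum _ _ _) _.
  apply: (@le_trans _ _ (m%:R * \sum_J @fejerd (M m) J x * rho x (grid_point R J))).
    rewrite mulr_sumr; apply: ler_sum => J _.
    by rewrite normrM (ger0_norm (fejerd_ge0 _ _)) [leLHS]mulrC [leRHS]mulrCA ler_wpM2l ?fejerd_ge0.
  have s0 : 0 < (m.+1%:R ^+ 2)^-1 :> R by rewrite invr_gt0 exprn_gt0// ltr0n.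
  have m1 : 0 < m.+1%:R :> R by rewrite ltr0n.
  apply: (@le_trans _ _ (m.+1%:R * (d%:R * (3 / m.+1%:R ^+ 2)))).
    rewrite ler_pM ?ler_nat//.
      by apply: sumr_ge0 => J _; rewrite mulr_ge0 ?rho_ge0 ?fejerd_ge0.
    apply: le_trans (sum_fejerd_rho x (M0 m) s0) _; rewrite ler_wpM2l// /M natrX.
    have -> : (m.+1%:R ^+ 2)^-1 / 2 + 2 / ((m.+1%:R ^+ 2)^-1 * m.+1%:R ^+ 4) =
      (5 / 2) / m.+1%:R ^+ 2 :> R by field; rewrite gt_eqF.
    by rewrite ler_pM2r ?invr_gt0 ?exprn_gt0//; lra.
  rewrite le_eqVlt; apply/orP; left; apply/eqP.
  by field; rewrite gt_eqF.
exists P; split.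
- move=> m; apply: trigp_sum => J; apply: trigpM (trigp_cst _) _.
  apply: trigp_ext (trigp_prod (index_enum 'I_d) (fun i => trigp_fejer (M m) i ((J i)%:R / (M m)%:R))).
  by move=> x; rewrite -ofR_prod.
- move=> m x; rewrite PE cmod_ofR ger0_norm; last first.
    by apply: sumr_ge0 => J _; rewrite mulr_ge0 ?fejerd_ge0.
  rewrite -[leRHS]mulr1 -(sum_fejerd x (M0 m)) mulr_sumr; apply: ler_sum => J _.
  rewrite ler_wpM2r ?fejerd_ge0//; apply: le_trans (GN _ _) _.
  by have /andP[] := N0B (grid_point R J).
move=> x e e0; have [dl dl0 hdl] := Nlsc x.
have /andP[Nx0 NxB] := N0B x.
have B0 : 0 <= B by apply: le_trans NxB.
(* The first bound gives m dl >= B: points at distance at least dl from x cost at least B >= N x,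
   nearer ones have N y >= N x, so the infimum at x is N x itself. The second makes the
   interpolation error 3d/(m+1) at most e. *)
pose m0 := maxn (Num.Def.archi_bound (B / dl)) (Num.Def.archi_bound (3 * d%:R / e)).
exists m0 => m; rewrite geq_max => /andP[m1 m2].
have -> : N x = G m x.
  apply: le_anti; rewrite GN andbT; apply: leG => y.
  have [/hdl h|h] := ltP (rho x y) dl.
    by rewrite -[leLHS]addr0 lerD// mulr_ge0// rho_ge0.
  have : B / dl <= m%:R.
    apply: ltW; apply: lt_le_trans (archi_boundP _) _; last by rewrite ler_nat.
    by rewrite divr_ge0// ltW.
  rewrite ler_pdivrMr// => hm.
  have /andP[Ny0 _] := N0B y.
  apply: le_trans NxB _; apply: le_trans hm _; rewrite -[leLHS]add0r lerD//.
  by rewrite ler_wpM2l.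
apply: le_trans (PG m x) _; rewrite ler_pdivrMr ?ltr0n// [leRHS]mulrC -ler_pdivrMr//.
apply: ltW; apply: lt_le_trans (archi_boundP _) _.
  by rewrite divr_ge0// ?mulr_ge0// ltW.
by rewrite ler_nat; apply: leq_trans m2 _.
Qed.

End TrigApprox.

(** * Lebesgue measure and integration on the torus *)

Section BorelRd.
Variables (R : realType) (d : nat).
Local Notation V := ('rV[R]_d).
Local Notation T := (Rd R d).

Lemma open_measurable_Rd (U : set V) : open U -> measurable (U : set T).
Proof. by move=> oU; apply: sub_sigma_algebra. Qed.

Lemma measurable_fun_lsc (f : V -> R) : (forall a, open [set x | a < f x]) ->
  measurable_fun [set: T] (f : T -> R).
Proof.
move=> h; apply: (measurability _ (RGenOInfty.measurableE R)).
move=> _ [_ [a ->] <-]; rewrite setTI; apply: open_measurable_Rd.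
by rewrite preimage_itvoy; exact: h.
Qed.

Lemma continuous_measurable_Rd (f : V -> R) : continuous f ->
  measurable_fun [set: T] (f : T -> R).
Proof.
move=> cf; apply: measurable_fun_lsc => a.
apply: (@open_comp _ _ f [set r : R | a < r]); last exact: open_gt.
by move=> x _; exact: cf.
Qed.

Lemma open_nbhs_coord (U : set V) (x : V) : open U -> U x ->
  exists2 e : R, 0 < e & forall y : V, (forall i, `|x 0 i - y 0 i| < e) -> U y.
Proof.
move=> oU Ux; have /nbhs_ballP[e /= e0 he] : nbhs x U by apply: open_nbhs_nbhs; split.
by exists e => // y hy; apply: he; split => // i j; rewrite ord1; exact: hy.
Qed.

Lemma coord_nbhs_open (U : set V) :
  (forall x, U x -> exists2 e : R, 0 < e &
    forall y : V, (forall i, `|x 0 i - y 0 i| < e) -> U y) -> open U.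
Proof.
move=> h; rewrite openE => x /h[e e0 he]; apply/nbhs_ballP; exists e => //= y hy.
by case: hy => _ hy; apply: he => i; exact: hy.
Qed.

Lemma open_affine (r : R) (v : V) (U : set V) : open U ->
  open [set x : V | U (r *: x + v)].
Proof.
move=> oU; apply: coord_nbhs_open => x /(open_nbhs_coord oU)[e e0 he].
have r0 : 0 < `|r| + 1 by rewrite ltr_wpDl.
exists (e / (`|r| + 1)); first by rewrite divr_gt0.
move=> y hy; apply: he => i; rewrite !mxE opprD addrACA subrr addr0 -mulrBr normrM.
have := hy i; rewrite ltr_pdivlMr// => h.
by apply: le_lt_trans h; rewrite mulrC ler_wpM2l// lerDl.
Qed.

Lemma measurable_affine (r : R) (v : V) :
  measurable_fun [set: T] (fun x : T => (r *: (x : V) + v) : T).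
Proof.
apply: (@measurability _ _ T T _ _ (@open V)) => //.
by move=> _ [U oU <-]; rewrite setTI; apply: open_measurable_Rd; exact: open_affine.
Qed.

Lemma measurable_box (a b : V) : measurable (box a b : set T).
Proof.
have -> : box a b = \bigcap_(i in [set: 'I_d])
   ([set x : V | a 0 i <= x 0 i] `&` [set x : V | x 0 i <= b 0 i]).
  apply/seteqP; split => [x /= hx i _|x /= hx i]; first by have /andP[] := hx i.
  by have [] := hx i Logic.I => -> ->.
apply: (@fin_bigcap_measurable _ T); first exact: finite_finset.
have cl (C : set V) : closed C -> measurable (C : set T).
  move=> cC; rewrite -[X in measurable X]setCK; apply: measurableC.
  by apply: open_measurable_Rd; exact: closed_openC.
move=> i _; apply: (@measurableI _ T); apply: cl.
- apply: (@preimage_closed _ _ (fun x : V => x 0 i) [set r : R | a 0 i <= r]).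
    by move=> x _; exact: coord_continuous.
  exact: closed_ge.
- apply: (@preimage_closed _ _ (fun x : V => x 0 i) [set r : R | r <= b 0 i]).
    by move=> x _; exact: coord_continuous.
  exact: closed_le.
Qed.

(** A generating family on which [is_lebesgue_measure] determines the measure; empty boxes, with
    some a i > b i, make it closed under intersection. *)
Definition boxes : set (set V) := [set B | exists a b, B = box a b].

(** Each point of U lies in a box inside U with rational centre and radius 1/(n+1). Indices whose
    box leaves U contribute the empty set, so the union runs over a fixed countable type. *)
Lemma open_bigcup_boxes (U : set V) : open U ->
  U = \bigcup_(u in [set: 'rV[rat]_d * nat])
    [set x | let qv := map_mx ratr u.1 in let e := const_mx u.2.+1%:R^-1 in
       box (qv - e) (qv + e) x /\ box (qv - e) (qv + e) `<=` U].
Proof.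
move=> oU; apply/seteqP; split => [x Ux|x [u _ /= [hx]]]; last exact.
have [e e0 he] := open_nbhs_coord oU Ux.
pose m := Num.Def.archi_bound (2 / e).
have m2 : 2 / e < m.+1%:R.
  apply: lt_trans (archi_boundP _) _; first by rewrite divr_ge0// ltW.
  by rewrite ltr_nat.
have m0 : 0 < m.+1%:R :> R by rewrite ltr0n.
have me : m.+1%:R^-1 < e / 2.
  by rewrite -[e / 2]invrK invf_div ltf_pV2 ?posrE ?divr_gt0.
have [q hq] : exists q : 'I_d -> rat, forall i,
    x 0 i - m.+1%:R^-1 < ratr (q i) < x 0 i + m.+1%:R^-1.
  apply: (@fin_all_exists _ (fun=> rat) (fun i q =>
    is_true (x 0 i - m.+1%:R^-1 < ratr q < x 0 i + m.+1%:R^-1))) => i.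
  have [|q] := @rat_in_itvoo R (x 0 i - m.+1%:R^-1) (x 0 i + m.+1%:R^-1).
    by rewrite ltrD2l gtrN// invr_gt0.
  by rewrite in_itv /= => h; exists q.
exists (\row_i q i, m) => //=; split.
  move=> i; rewrite !mxE /=; have := hq i.
  by move: (m.+1%:R^-1) (ratr _) => dl b /andP[h1 h2]; apply/andP; split; lra.
move=> y hy; apply: he => j.
have := hy j; rewrite !mxE /=; have := hq j; rewrite ltr_norml; move: me.
move: (m.+1%:R^-1) (ratr _) => dl b h0 /andP[h1 h2] /andP[h3 h4].
by apply/andP; split; lra.
Qed.

Lemma measurable_boxesE : @measurable _ T = <<s boxes >>.
Proof.
apply/seteqP; split; last first.
  apply: smallest_sub; first exact: sigma_algebra_measurable.
  by move=> _ [a [b ->]]; exact: measurable_box.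
apply: smallest_sub; first exact: smallest_sigma_algebra.
move=> U oU; rewrite (open_bigcup_boxes oU).
apply: (@countable_bigcupT_measurable _ (g_sigma_algebraType boxes)).
  exact: countableP.
move=> u; set A := [set x | _].
have [h|h] := pselect (box (map_mx ratr u.1 - const_mx u.2.+1%:R^-1)
   (map_mx ratr u.1 + const_mx u.2.+1%:R^-1) `<=` U).
  rewrite (_ : A = box (map_mx ratr u.1 - const_mx u.2.+1%:R^-1)
   (map_mx ratr u.1 + const_mx u.2.+1%:R^-1)).
    by apply: sub_sigma_algebra; eexists; eexists.
  by apply/seteqP; split => x //= [].
rewrite (_ : A = set0); first exact: measurable0.
by apply/seteqP; split => x //= [].
Qed.

Lemma boxes_setI : setI_closed boxes.
Proof.
move=> _ _ [a [b ->]] [a' [b' ->]].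
exists (\row_i Num.max (a 0 i) (a' 0 i)), (\row_i Num.min (b 0 i) (b' 0 i)).
apply/seteqP; split => [x [/= h h'] i|x /= h].
  by rewrite !mxE ge_max le_min; have /andP[-> ->] := h i; have /andP[-> ->] := h' i.
by split => i; have := h i; rewrite !mxE ge_max le_min => /andP[/andP[? ?] /andP[? ?]];
  apply/andP; split.
Qed.

End BorelRd.

Section Restriction.
Context dd (T : measurableType dd) (R : realType).
Variables (mu : {measure set T -> \bar R}) (D : set T) (mD : measurable D).

(** [mu] is the sum of its restrictions to D and to the complement. For the first, f equals its
    cut-off to D almost everywhere; for the second, the cut-off vanishes almost everywhere. *)
Lemma ge0_integral_mrestr (f : T -> \bar R) : measurable_fun [set: T] f ->
  (forall x, 0 <= f x)%E ->
  (\int[mrestr mu mD]_x f x = \int[mu]_(x in D) f x)%E.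
Proof.
move=> mf f0; have mDC : measurable (~` D) by exact: measurableC.
have mfD : measurable_fun [set: T] (f \_ D).
  by apply/(measurable_restrictT f) => //; exact: measurable_funTS.
have fD0 x : (0 <= (f \_ D) x)%E by rewrite patchE; case: ifP.
rewrite [RHS]integral_mkcond.
transitivity (\int[measure_add (mrestr mu mD) (mrestr mu mDC)]_x (f \_ D) x)%E; last first.
  apply: eq_measure_integral => A mA _.
  apply: (etrans (measure_addE (mrestr mu mD) (mrestr mu mDC) A)).
  change (mu (A `&` D) + mu (A `&` ~` D) = mu A)%E.
  rewrite -measureU; [|exact: measurableI|exact: measurableI|].
    by rewrite -setIUr setUv setIT.
  by rewrite setIACA setICr setI0.
rewrite ge0_integral_measure_add//.
rewrite [X in (_ + X)%E](_ : _ = 0)%E ?adde0; last first.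
  rewrite -(@integral0 _ _ _ (mrestr mu mDC) setT); apply: ge0_ae_eq_integral => //.
  exists D; split => //; first by rewrite /= /mrestr setICr measure0.
  move=> x /= h; apply: contrapT => Dx; apply: h => _.
  by rewrite patchE memNset.
apply: ge0_ae_eq_integral => //.
exists (~` D); split => //; first by rewrite /= /mrestr setICl measure0.
move=> x /= h Dx; apply: h => _.
by rewrite patchE mem_set.
Qed.

End Restriction.

Section AffineChange.
Variables (R : realType) (d : nat) (lam : {measure set Rd R d -> \bar R}).
Hypothesis hlam : is_lebesgue_measure lam.
Local Notation V := ('rV[R]_d).
Local Notation T := (Rd R d).

(** Both sides are measures in A that agree on boxes, and the cubes [-k, k]^d, of finite measure,
    exhaust the space, so uniqueness of measures applies. *)
Lemma lebesgue_affine (r : R) (v : V) (A : set T) : 0 < r -> measurable A ->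
  lam [set x : V | A (r *: x + v)] = ((r ^- d)%:E * lam A)%E.
Proof.
move=> r0 mA.
have rd0 : 0 <= r ^- d by rewrite invr_ge0 exprn_ge0// ltW.
pose f (x : T) : T := r *: (x : V) + v.
have mf : measurable_fun [set: T] f by exact: measurable_affine.
pose m0 : {measure set T -> \bar R} := pushforward lam f.
pose m1 : {measure set T -> \bar R} := m0 mf.
pose m2 : {measure set T -> \bar R} := mscale (NngNum rd0) lam.
suff : m1 A = m2 A by [].
pose g (k : nat) : set T := box (const_mx (- k%:R)) (const_mx k%:R) : set V.
have fbox (a b : V) : f @^-1` (box a b : set V) =
    box (r^-1 *: (a - v)) (r^-1 *: (b - v)) :> set V.
  apply/seteqP; split => x /= h i; have := h i; rewrite !mxE.
    by rewrite ler_pdivrMl// ler_pdivlMl// lerBlDr lerBrDr.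
  by rewrite ler_pdivrMl// ler_pdivlMl// lerBlDr lerBrDr.
have m12 B : boxes B -> m1 B = m2 B.
  move=> [a [b ->]].
  have [ab|/existsNP[i /negP]] := pselect (forall i, a 0 i <= b 0 i); last first.
    rewrite -ltNge => ba; rewrite (_ : box a b = set0) ?measure0//.
    apply/seteqP; split => x //= /(_ i)/andP[h1 h2].
    by have := le_lt_trans (le_trans h1 h2) ba; rewrite ltxx.
  have -> : m1 (box a b) = lam (f @^-1` (box a b)) by [].
  have -> : m2 (box a b) = ((r ^- d)%:E * lam (box a b))%E by [].
  rewrite fbox (hlam ab) hlam => [|i]; last first.
    by rewrite !mxE ler_pM2l ?invr_gt0// lerD2r.
  rewrite -EFinM; congr EFin.
  under eq_bigr => i _.
    rewrite !mxE -mulrBr opprB addrA subrK; over.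
  by rewrite big_split /= prodr_const card_ord exprVn.
apply: (@measure_unique _ R T (@boxes R d) g) => //.
- exact: measurable_boxesE.
- exact: boxes_setI.
- by move=> k; exists (const_mx (- k%:R)), (const_mx k%:R).
- apply/seteqP; split => // x _.
  exists (\sum_i Num.Def.archi_bound `|(x : V) ord0 i|)%N => //= i; rewrite !mxE -ler_norml.
  apply: (@le_trans _ _ (Num.Def.archi_bound `|(x : V) ord0 i|)%:R).
    by apply: ltW; apply: archi_boundP.
  by rewrite ler_nat (bigD1 i)//= leq_addr.
- move=> k; have -> : m1 (g k) = m2 (g k).
    by apply: m12; exists (const_mx (- k%:R)), (const_mx k%:R).
  have -> : m2 (g k) = ((r ^- d)%:E * lam (g k))%E by [].
  rewrite /g hlam -?EFinM ?ltry// => i; rewrite !mxE.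
  by apply: (@le_trans _ _ 0); rewrite ?oppr_le0.
Qed.

Lemma ge0_integral_affine (r : R) (v : V) (f : T -> \bar R) : 0 < r ->
  measurable_fun [set: T] f -> (forall x, 0 <= f x)%E ->
  (\int[lam]_x f (r *: (x : V) + v)%R = (r ^- d)%:E * \int[lam]_x f x)%E.
Proof.
move=> r0 mf f0.
have rd0 : 0 <= r ^- d by rewrite invr_ge0 exprn_ge0// ltW.
pose t (x : T) : T := r *: (x : V) + v.
have mt : measurable_fun [set: T] t by exact: measurable_affine.
have := ge0_integral_pushforward mt lam measurableT mf (fun x _ => f0 x).
rewrite preimage_setT => <-.
have := ge0_integral_mscale lam measurableT (NngNum rd0) mf (fun x _ => f0 x).
move=> /= <-; apply: eq_measure_integral => A mA _.
exact: lebesgue_affine.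
Qed.

End AffineChange.

(** * Lattice translates of the unit cell and translation invariance on the torus *)

Section Folding.
Variables (R : realType) (d : nat).
Local Notation V := ('rV[R]_d).
Local Notation T := (Rd R d).
Local Notation tor := (@torus_dom R d).

Definition floorv (x : V) : 'rV[int]_d := \row_i Num.floor (x 0 i).

Lemma torus_floorv (x : V) (k : 'rV[int]_d) : tor (x - intvec R k) -> k = floorv x.
Proof.
move=> h; apply/rowP => i; rewrite mxE; apply/esym/floor_def.
have := h i; rewrite !mxE intrD => /andP[h1 h2].
by apply/andP; split; [rewrite -subr_ge0|rewrite addrC -ltrBlDr].
Qed.

Lemma mem_torus_floorv (x : V) : tor (x - intvec R (floorv x)).
Proof.
move=> i; rewrite !mxE subr_ge0 floor_le /= ltrBlDl.
by have := floorD1_gt (x 0 i); rewrite intrD.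
Qed.

Definition intbox (B : nat) : seq 'rV[int]_d :=
  undup [seq \row_i ((J i : nat)%:Z - B%:Z) | J : {ffun 'I_d -> 'I_(2 * B).+1}].

Lemma uniq_intbox B : uniq (intbox B). Proof. exact: undup_uniq. Qed.

Lemma mem_intbox B (k : 'rV[int]_d) : (forall i, (absz (k 0%R i) <= B)%N) -> k \in intbox B.
Proof.
move=> h; rewrite mem_undup; apply/mapP.
exists [ffun i => inord (absz (k 0 i + B%:Z))]; first by rewrite mem_enum.
apply/rowP => i; rewrite !mxE ffunE.
have hi := h i; rewrite inordK; move: (k 0 i) hi => a; lia.
Qed.

Lemma size_intbox B : (size (intbox B) <= (2 * B).+1 ^ d)%N.
Proof.
apply: leq_trans (size_undup _) _.
by rewrite size_image card_ffun !card_ord.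
Qed.

Lemma coord_bound (v : V) : exists B : nat, forall i, `|v 0 i| <= B%:R.
Proof.
exists (\sum_i Num.Def.archi_bound `|v ord0 i|)%N => i.
apply: (@le_trans _ _ (Num.Def.archi_bound `|v 0 i|)%:R).
  by apply: ltW; apply: archi_boundP.
by rewrite ler_nat (bigD1 i)//= leq_addr.
Qed.

Lemma absz_leP (k : int) (B : nat) : (absz k <= B)%N = (`|k%:~R| <= B%:R :> R).
Proof. by rewrite -intr_norm -[B%:R]/(B%:Z%:~R) ler_int -lez_nat abszE. Qed.

Lemma floorv_absz (x : V) (B : nat) : (forall i, `|x 0 i| <= B%:R) ->
  forall i, (absz (floorv x 0%R i) <= B.+1)%N.
Proof.
move=> h i; rewrite absz_leP mxE; have := h i.
have := floor_le (x 0 i); have := floorD1_gt (x 0 i); rewrite intrD -natr1.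
by move: (_%:~R) => a h1 h2; rewrite !ler_norml => /andP[h3 h4]; apply/andP; split; lra.
Qed.

Variable lam : {measure set T -> \bar R}.
Hypothesis hlam : is_lebesgue_measure lam.
Local Notation mu := (torus_measure lam).

Lemma measurable_translate (f : T -> \bar R) (v : V) : measurable_fun [set: T] f ->
  measurable_fun [set: T] (fun x : T => f ((x : V) + v)).
Proof.
move=> mf; have := measurableT_comp mf (measurable_affine (R := R) 1 v).
by under eq_fun do rewrite /= scale1r.
Qed.

Lemma ge0_integral_translate (v : V) (f : T -> \bar R) :
  measurable_fun [set: T] f -> (forall x, 0 <= f x)%E ->
  (\int[lam]_x f ((x : V) + v)%R = \int[lam]_x f x)%E.
Proof.
move=> mf f0; have := ge0_integral_affine hlam v ltr01 mf f0.
by under eq_integral do rewrite scale1r; rewrite expr1n invr1 mul1e.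
Qed.

Lemma measurable_torus_shift (v : V) : measurable ([set x : V | tor (x - v)] : set T).
Proof.
have := measurable_affine (R := R) 1 (- v) measurableT (@measurable_torus_dom R d).
by rewrite setTI /preimage; under eq_set do rewrite /= scale1r.
Qed.

(** The cells tor + k with k in s are disjoint and contain every point where g is nonzero; each is
    translated back to the unit cell. *)
Lemma ge0_integral_fold (s : seq 'rV[int]_d) (g : T -> \bar R) : uniq s ->
  measurable_fun [set: T] g -> (forall x, 0 <= g x)%E ->
  (forall x : V, floorv x \notin s -> g x = 0)%E ->
  (\int[lam]_x g x = \sum_(k <- s) \int[mu]_x g ((x : V) + intvec R k)%R)%E.
Proof.
move=> us mg g0 gs.
pose F (k : 'rV[int]_d) : set T := [set x : V | tor (x - intvec R k)].
have mF k : measurable (F k) by exact: measurable_torus_shift.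
have tF : trivIset [set` s] F.
  by move=> k l _ _ [x [/= /torus_floorv -> /torus_floorv ->]].
transitivity (\int[lam]_(x in \big[setU/set0]_(k <- s) F k) g x)%E.
  rewrite [RHS]integral_mkcond; apply: eq_integral => x _; rewrite patchE.
  case: ifPn => // /negP; rewrite inE -bigcup_seq => h.
  apply: gs; apply/negP => fs; apply: h; exists (floorv x) => //.
  exact: mem_torus_floorv.
rewrite ge0_integral_bigsetU//; last exact: measurable_funTS.
apply: eq_bigr => k _.
rewrite /torus_measure ge0_integral_mrestr; last first.
- by move=> x; exact: g0.
- exact: measurable_translate.
rewrite integral_mkcond [RHS]integral_mkcond.
rewrite -(ge0_integral_translate (intvec R k)); last first.
- by move=> x; rewrite patchE; case: ifP.
- by apply/(measurable_restrictT g) => //; exact: measurable_funTS.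
apply: eq_integral => x _; rewrite !patchE.
congr (if _ then _ else _).
by apply/asboolP/asboolP; rewrite /F /= addrK.
Qed.

(** Cut f off to the shifted cell tor + v. Its integral over R^d is the left side after a
    translation, and it folds back to the right side because every point of the unit cell has
    exactly one lattice translate in the shifted cell. *)
Lemma ge0_integral_torus_translate (v : V) (f : T -> \bar R) :
  measurable_fun [set: T] f -> (forall x, 0 <= f x)%E ->
  (forall (x : V) k, f (x + intvec R k) = f x) ->
  (\int[mu]_x f ((x : V) + v)%R = \int[mu]_x f x)%E.
Proof.
move=> mf f0 pf; have [B hB] := coord_bound v.
pose S : set T := [set x : V | tor (x - v)].
have mS : measurable S by exact: measurable_torus_shift.
pose g := f \_ S.
have g0 x : (0 <= g x)%E by rewrite /g patchE; case: ifP.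
have mg : measurable_fun [set: T] g.
  by apply/(measurable_restrictT f) => //; exact: measurable_funTS.
transitivity (\int[lam]_x g x)%E.
  rewrite -(ge0_integral_translate v)// /torus_measure ge0_integral_mrestr; last first.
  - by move=> x; exact: f0.
  - exact: measurable_translate.
  rewrite integral_mkcond; apply: eq_integral => x _; rewrite /g !patchE.
  congr (if _ then _ else _).
  by apply/asboolP/asboolP; rewrite /S /= addrK.
(* Points of the shifted cell have coordinates of size at most B+1, hence floors of size at most
   B+2. *)
rewrite (@ge0_integral_fold (intbox B.+2))//; [|exact: uniq_intbox|]; last first.
  move=> x; rewrite /g patchE; case: ifPn => // xS /negP[]; apply: mem_intbox.
  apply: floorv_absz => i; move: xS; rewrite inE => /(_ i); rewrite !mxE.
  have := hB i; rewrite !ler_norml -natr1 => /andP[h1 h2] /andP[h3 h4].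
  by apply/andP; split; lra.
rewrite -ge0_integral_sum//; last first.
- by move=> k; exact: measurable_translate.
rewrite /torus_measure [RHS]ge0_integral_mrestr//.
apply: etrans.
  apply: ge0_integral_mrestr; last by move=> x; apply: sume_ge0 => k _; exact: g0.
  by apply: emeasurable_sum => k; exact: measurable_translate.
apply: eq_integral => x; rewrite inE => xt.
have xb i : `|x ord0 i| <= 1.
  have /andP[h1 h2] := xt i.
  by rewrite ler_norml; apply/andP; split; lra.
pose k0 := - floorv (x - v).
have k0s : k0 \in intbox B.+2.
  apply: mem_intbox => i; rewrite mxE abszN; apply: floorv_absz => {}i.
  rewrite !mxE; apply: le_trans (ler_normB _ _) _; rewrite -natr1.
  by have := hB i; have := xb i; lra.
have kE k : S (x + intvec R k) <-> k = k0.
  have e : x + intvec R k - v = (x - v) - intvec R (- k) by rewrite intvecN opprK addrAC.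
  split; first by rewrite /S /= e => /torus_floorv; rewrite /k0 => <-; rewrite opprK.
  by move=> ->; rewrite /S /= addrAC /k0 intvecN; exact: mem_torus_floorv.
rewrite (bigD1_seq k0) ?uniq_intbox//= big1_seq ?adde0.
  by rewrite /g patchE mem_set ?pf//; exact/kE.
move=> k /andP[kk0 _]; rewrite /g patchE memNset// => /kE h.
by rewrite h eqxx in kk0.
Qed.

(** The measure is prescribed on closed boxes only, so the half-open cell is squeezed between
    [0, 1 - 1/(n+1)]^d and [0, 1]^d, with (1-e)^d >= 1 - d e by Bernoulli. *)
Lemma torus_measure_setT : mu [set: T] = 1%E.
Proof.
rewrite /torus_measure /mrestr setTI.
have b01 : lam (box (const_mx 0) (const_mx 1)) = 1%E.
  rewrite hlam => [|i]; last by rewrite !mxE.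
  by rewrite big1// => i _; rewrite !mxE subr0.
apply/eqP; rewrite eq_le; apply/andP; split.
  rewrite -b01; apply: le_measure; rewrite ?inE.
  - exact: measurable_torus_dom.
  - exact: measurable_box.
  by move=> x h i; rewrite !mxE; have /andP[-> /ltW ->] := h i.
have H (n : nat) : ((1 - d%:R / n.+1%:R)%:E <= lam tor)%E.
  have n1 : 0 <= (n.+1%:R^-1 : R) <= 1 by rewrite invr_ge0 ler0n /= invf_le1 ?ler1n// ltr0n.
  have -> : (d%:R / n.+1%:R : R) = d%:R * n.+1%:R^-1 by [].
  have e00 : 0 < n.+1%:R^-1 :> R by rewrite invr_gt0 ltr0n.
  move: (n.+1%:R^-1) n1 e00 => e /andP[e0 e1] e00.
  apply: (@le_trans _ _ (lam (box (const_mx 0) (const_mx (1 - e))))).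
    rewrite hlam => [|i]; last by rewrite !mxE subr_ge0.
    under eq_bigr do rewrite !mxE subr0.
    rewrite prodr_const card_ord lee_fin.
    elim: (d) => [|j IH]; first by rewrite mul0r subr0 expr0.
    have : 0 <= (1 - e) ^+ j by rewrite exprn_ge0// subr_ge0.
    have : 0 <= j%:R :> R by [].
    by rewrite exprS -natr1; nra.
  apply: le_measure; rewrite ?inE.
  - exact: measurable_box.
  - exact: measurable_torus_dom.
  move=> x h i; have := h i; rewrite !mxE => /andP[-> /= h2].
  by apply: le_lt_trans h2 _; lra.
apply/lee_subgt0Pr => e e0.
have [n hn] : exists n : nat, d%:R / n.+1%:R <= e.
  exists (Num.Def.archi_bound (d%:R / e)); rewrite ler_pdivrMr ?ltr0n// mulrC -ler_pdivrMr//.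
  apply: ltW; apply: lt_trans (archi_boundP _) _; last by rewrite ltr_nat.
  by rewrite divr_ge0// ltW.
by apply: le_trans (H n); rewrite -EFinB lee_fin lerB.
Qed.

End Folding.

(** * Bounded measurable functions and their means on a probability space *)

Section BoundedMeasurable.
Context dd (T : measurableType dd) (R : realType).
Implicit Types f g : T -> R.

Definition bm f := measurable_fun [set: T] f /\ exists B : R, forall x, `|f x| <= B.

Lemma bm_ext f g : f =1 g -> bm f -> bm g.
Proof. by move=> /funext ->. Qed.

Lemma bm_cst (a : R) : bm (fun=> a).
Proof. by split; [exact: measurable_cst|exists `|a|]. Qed.

Lemma bmD f g : bm f -> bm g -> bm (fun x => f x + g x).
Proof.
move=> [mf [B hB]] [mg [C hC]]; split; first exact: measurable_funD.
by exists (B + C) => x; apply: le_trans (ler_normD _ _) _; exact: lerD.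
Qed.

Lemma bmM f g : bm f -> bm g -> bm (fun x => f x * g x).
Proof.
move=> [mf [B hB]] [mg [C hC]]; split; first exact: measurable_funM.
by exists (B * C) => x; rewrite normrM ler_pM.
Qed.

Lemma bmZ (a : R) f : bm f -> bm (fun x => a * f x).
Proof. exact: bmM (bm_cst a). Qed.

Lemma bmN f : bm f -> bm (fun x => - f x).
Proof. by move=> bf; apply: bm_ext (bmM (bm_cst (-1)) bf) => x; rewrite mulN1r. Qed.

Lemma bmB f g : bm f -> bm g -> bm (fun x => f x - g x).
Proof. by move=> bf bg; exact: bmD (bmN bg). Qed.

Lemma bm_norm f : bm f -> bm (fun x => `|f x|).
Proof.
move=> [mf [B hB]]; split; last by exists B => x; rewrite normr_id.
by apply: (measurableT_comp (f := @Num.norm R R)) => //; exact: measurable_normr.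
Qed.

Lemma bm_powR f (p : R) : 0 <= p -> (forall x, 0 <= f x) -> bm f -> bm (fun x => f x `^ p).
Proof.
move=> p0 f0 [mf [B hB]]; split.
  by apply: (measurableT_comp (f := fun t : R => t `^ p)) => //; exact: measurable_powR.
exists (B `^ p) => x; rewrite ger0_norm ?powR_ge0//; apply: ler_powR2 => //.
by apply: le_trans (hB x); exact: ler_norm.
Qed.

Lemma bm_sum (I : Type) (s : seq I) (F : I -> T -> R) :
  (forall i, bm (F i)) -> bm (fun x => \sum_(i <- s) F i x).
Proof.
move=> h; elim: s => [|i s IH].
  by apply: bm_ext (bm_cst 0) => x; rewrite big_nil.
by apply: bm_ext (bmD (h i) IH) => x; rewrite big_cons.
Qed.

Lemma bm_indic (A : set T) : measurable A -> bm (\1_A : T -> R).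
Proof.
move=> mA; split; first exact: measurable_indic.
by exists 1 => x; rewrite indicE; case: (_ \in _); rewrite ?normr1 ?normr0.
Qed.

Variable mu : {measure set T -> \bar R}.

Lemma bm_integrable f (D : set T) : measurable D -> (mu D < +oo)%E -> bm f ->
  mu.-integrable D (EFin \o f).
Proof.
move=> mD muD [mf [B hB]]; apply: measurable_bounded_integrable => //.
  exact: measurable_funTS.
exists B; split; first exact: num_real.
by move=> x Bx y _; apply: le_trans (hB y) _; exact: ltW.
Qed.

Hypothesis mu1 : mu [set: T] = 1%E.
Local Notation E f := (Rintegral mu setT f).

Lemma bm_integrableT f : bm f -> mu.-integrable setT (EFin \o f).
Proof. by apply: bm_integrable => //; rewrite mu1 ltry. Qed.

Lemma EFin_E f : bm f -> (\int[mu]_x (f x)%:E = (E f)%:E)%E.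
Proof.
move=> bf; rewrite /Rintegral fineK//.
exact: integrable_fin_num (bm_integrableT bf).
Qed.

Lemma E_ext f g : f =1 g -> E f = E g. Proof. by move=> /funext ->. Qed.

Lemma E_cst (a : R) : E (fun=> a) = a.
Proof. by rewrite Rintegral_cst// mu1 mulr1. Qed.

Lemma E_D f g : bm f -> bm g -> E (fun x => f x + g x) = E f + E g.
Proof. by move=> bf bg; apply: RintegralD => //; exact: bm_integrableT. Qed.

Lemma E_B f g : bm f -> bm g -> E (fun x => f x - g x) = E f - E g.
Proof. by move=> bf bg; apply: RintegralB => //; exact: bm_integrableT. Qed.

Lemma E_Z (a : R) f : bm f -> E (fun x => a * f x) = a * E f.
Proof. by move=> bf; apply: RintegralZl => //; exact: bm_integrableT. Qed.

Lemma E_le f g : bm f -> bm g -> (forall x, f x <= g x) -> E f <= E g.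
Proof. by move=> bf bg h; apply: le_Rintegral => //; exact: bm_integrableT. Qed.

Lemma E_ge0 f : (forall x, 0 <= f x) -> 0 <= E f.
Proof. by move=> h; exact: Rintegral_ge0. Qed.

Lemma E_sum (I : Type) (s : seq I) (F : I -> T -> R) : (forall i, bm (F i)) ->
  E (fun x => \sum_(i <- s) F i x) = \sum_(i <- s) E (F i).
Proof.
move=> h; elim: s => [|i s IH].
  by rewrite big_nil -[RHS](E_cst 0); apply: E_ext => x; rewrite big_nil.
rewrite big_cons -IH -E_D//; last exact: bm_sum.
by apply: E_ext => x; rewrite big_cons.
Qed.

Lemma E_indic (A : set T) : measurable A -> (mu A = (E (\1_A : T -> R))%:E)%E.
Proof. by move=> mA; rewrite -EFin_E ?integral_indic ?setIT//; exact: bm_indic. Qed.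

End BoundedMeasurable.

(** * Lattice points *)

Section LatticeCount.
Variables (R : realType) (d : nat) (Om : set 'rV[R]_d) (r : R).
Hypotheses (oOm : open Om) (bOm : bounded_set Om) (r0 : 0 < r).
Local Notation V := ('rV[R]_d).
Local Notation T := (Rd R d).
Local Notation tor := (@torus_dom R d).

Definition dil : set V := [set z | Om (r^-1 *: z)].

Definition cnt (x : V) : R := fine (lattice_count Om r x).

Lemma open_dil : open dil.
Proof.
have := open_affine (r := r^-1) (v := 0) oOm.
by under eq_set do rewrite addr0.
Qed.

Lemma bounded_set_coord : exists A : nat, forall y, Om y -> forall i, `|y 0 i| <= A%:R.
Proof.
have [M [_ hM]] := bOm.
pose A := Num.Def.archi_bound `|M|.
have MA : M < A%:R by apply: le_lt_trans (ler_norm M) _; exact: archi_boundP.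
exists A.+1 => y Oy i; apply: ltW.
have : ball (0 : V) A.+1%:R y.
  rewrite -ball_normE /ball_ /= sub0r normrN.
  by apply: le_lt_trans (hM _ MA _ Oy) _; rewrite ltr_nat.
by move=> [_ /(_ 0 i)]; rewrite /ball /= mxE sub0r normrN.
Qed.

Lemma dil_coord A : (forall y, Om y -> forall i, `|y 0 i| <= A%:R) ->
  forall z, dil z -> forall i, `|z 0 i| <= r * A%:R.
Proof.
move=> h z /h hz i; have := hz i; rewrite mxE normrM normfV (gtr0_norm r0).
by rewrite ler_pdivrMl.
Qed.

Lemma dil_transE (x : V) (k : 'rV[int]_d) :
  \1_(dil_trans Om r x) (intvec R k) = \1_dil (x + intvec R k) :> R.
Proof.
rewrite !indicE; congr (nat_of_bool _)%:R; apply/asboolP/asboolP.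
  move=> [y Oy <-]; rewrite /dil /= addrCA subrr addr0 scalerA mulVf ?gt_eqF//.
  by rewrite scale1r.
move=> h; exists (r^-1 *: (x + intvec R k)) => //.
by rewrite scalerA divff ?gt_eqF// scale1r addrC addKr.
Qed.

Lemma cnt_sum (x : V) (s : seq 'rV[int]_d) : uniq s ->
  (forall k, dil (x + intvec R k) -> k \in s) ->
  cnt x = \sum_(k <- s) \1_dil (x + intvec R k).
Proof.
move=> us hs; rewrite /cnt /lattice_count.
under eq_esum do rewrite dil_transE.
have -> : (\esum_(k in [set: 'rV[int]_d]) (\1_dil (x + intvec R k) : R)%:E =
    \esum_(k in [set` s]) (\1_dil (x + intvec R k) : R)%:E)%E.
  rewrite [RHS]esum_mkcond; apply: eq_esum => k _.
  case: ifPn => //; rewrite notin_setE /= => ks.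
  by rewrite indicE memNset// => /hs.
rewrite esum_fset; [|exact: finite_seq|by move=> k _; rewrite lee_fin].
by rewrite -fsbig_seq// sumEFin.
Qed.

Lemma dil_intbox (A : nat) (x : V) (B : nat) :
  (forall y, Om y -> forall i, `|y 0 i| <= A%:R) ->
  (forall i, r * A%:R + `|x 0 i| <= B%:R) ->
  forall k, dil (x + intvec R k) -> k \in intbox d B.
Proof.
move=> hA hB k /(dil_coord hA) hk; apply: mem_intbox => i; rewrite (absz_leP R).
have := hk i; rewrite !mxE => h.
apply: le_trans (hB i).
have -> : (k 0 i)%:~R = (x 0 i + (k 0 i)%:~R) - x 0 i :> R by rewrite addrC addKr.
by apply: le_trans (ler_normB _ _) _; rewrite lerD2r.
Qed.

Lemma cnt_seq (x : V) : exists2 s : seq 'rV[int]_d, uniq s &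
  forall k, dil (x + intvec R k) -> k \in s.
Proof.
have [A hA] := bounded_set_coord; have [C hC] := coord_bound x.
pose B := (Num.Def.archi_bound (r * A%:R) + C)%N.
exists (intbox d B); first exact: uniq_intbox.
apply: (dil_intbox hA) => i; rewrite natrD lerD// ltW//; apply: archi_boundP.
by rewrite mulr_ge0// ltW.
Qed.

Lemma sum_indic_le_cnt (x : V) (s : seq 'rV[int]_d) : uniq s ->
  \sum_(k <- s) \1_dil (x + intvec R k) <= cnt x.
Proof.
move=> us; have [t ut ht] := cnt_seq x.
rewrite (@cnt_sum x (s ++ [seq k <- t | k \notin s])).
- by rewrite big_cat /= lerDl; apply: sumr_ge0 => k _.
- rewrite cat_uniq us filter_uniq// andbT; apply/hasPn => k.
  by rewrite mem_filter => /andP[].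
move=> k hk; rewrite mem_cat mem_filter (ht _ hk) andbT.
by case: (k \in s).
Qed.

Lemma cnt_nat (x : V) : exists n : nat, cnt x = n%:R.
Proof.
have [s us hs] := cnt_seq x; rewrite (cnt_sum us hs).
elim: (s) => [|k t [n IH]]; first by exists 0%N; rewrite big_nil.
by exists (((x + intvec R k)%R \in dil) + n)%N; rewrite big_cons IH natrD indicE.
Qed.

Lemma cnt_ge0 (x : V) : 0 <= cnt x.
Proof. by have [n ->] := cnt_nat x. Qed.

Lemma cnt_periodic (x : V) (m : 'rV[int]_d) : cnt (x + intvec R m) = cnt x.
Proof.
have [s us hs] := cnt_seq x; rewrite (cnt_sum us hs).
rewrite (@cnt_sum _ [seq k - m | k <- s]).
- rewrite big_map; apply: eq_bigr => k _.
  by rewrite intvecD intvecN addrACA subrr addr0 addrC.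
- by rewrite map_inj_uniq//; exact: addIr.
move=> k; rewrite -addrA -intvecD => /hs h.
by apply/mapP; exists (m + k); rewrite // addrC addKr.
Qed.

(** One list of lattice points serves all x of the unit cell, so the count can be integrated as a
    finite sum; the extra 1 bounds the coordinates of x. *)
Lemma cnt_torus_bound (A B : nat) :
  (forall y, Om y -> forall i, `|y 0 i| <= A%:R) -> r * A%:R <= B%:R ->
  forall x : V, tor x -> forall k, dil (x + intvec R k) -> k \in intbox d B.+1.
Proof.
move=> hA hB x tx; apply: (dil_intbox hA) => i; rewrite -natr1 lerD//.
by have /andP[h1 /ltW h2] := tx i; rewrite ger0_norm.
Qed.

Lemma cnt_le (A B : nat) : (forall y, Om y -> forall i, `|y 0 i| <= A%:R) ->
  r * A%:R <= B%:R -> forall x : V, cnt x <= (2 * B.+1).+1%:R ^+ d.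
Proof.
move=> hA hB x.
rewrite -[x](subrK (intvec R (floorv x))) cnt_periodic.
set y := x - _; have ty : tor y by exact: mem_torus_floorv.
rewrite (cnt_sum (uniq_intbox d B.+1) (cnt_torus_bound hA hB ty)).
apply: (@le_trans _ _ (\sum_(k <- intbox d B.+1) 1)).
  by apply: ler_sum => k _; rewrite indicE; case: (_ \in _).
rewrite big_const_seq iter_addr_0 count_predT -natrX ler_nat.
exact: size_intbox.
Qed.

(** The finitely many translates x + k in the open set r Om stay there when x moves slightly, and
    new ones can only raise the count. *)
Lemma cnt_lsc (x : V) : exists2 e : R, 0 < e &
  forall y : V, (forall i, `|x 0 i - y 0 i| < e) -> cnt x <= cnt y.
Proof.
have [s us hs] := cnt_seq x; rewrite (cnt_sum us hs).
suff [e e0 he] : exists2 e : R, 0 < e & forall y : V, (forall i, `|x 0 i - y 0 i| < e) ->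
    \sum_(k <- s) \1_dil (x + intvec R k) <= \sum_(k <- s) \1_dil (y + intvec R k) :> R.
  by exists e => // y /he /le_trans; apply; exact: sum_indic_le_cnt.
elim: s {us hs} => [|k s [e e0 he]]; first by exists 1 => // y _; rewrite !big_nil.
have [h|h] := pselect (dil (x + intvec R k)); last first.
  exists e => // y hy; rewrite !big_cons lerD//; last exact: he.
  by rewrite indicE memNset.
have [e' e'0 he'] := open_nbhs_coord open_dil h.
exists (Num.min e e'); first by rewrite lt_min e0.
move=> y hy; rewrite !big_cons lerD//; last first.
  by apply: he => i; apply: lt_le_trans (hy i) _; rewrite ge_min lexx.
rewrite !indicE [y + _ \in _]mem_set; first by case: (_ \in _).
apply: he' => i; rewrite !mxE opprD addrACA subrr addr0.
by apply: lt_le_trans (hy i) _; rewrite ge_min lexx orbT.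
Qed.

Lemma bm_cnt : bm (cnt : T -> R).
Proof.
split; last first.
  have [A hA] := bounded_set_coord; eexists => x.
  rewrite ger0_norm; [apply: (cnt_le hA (B := Num.Def.archi_bound (r * A%:R)))|exact: cnt_ge0].
  by apply: ltW; apply: archi_boundP; rewrite mulr_ge0// ltW.
apply: measurable_fun_lsc => a; apply: coord_nbhs_open => x /= ax.
have [e e0 he] := cnt_lsc x; exists e => // y /he; exact: lt_le_trans.
Qed.

End LatticeCount.

(** * Fourier coefficients of the lattice count *)

Section Coefficients.
Variables (R : realType) (d : nat).
Local Notation V := ('rV[R]_d).
Local Notation T := (Rd R d).
Local Notation tor := (@torus_dom R d).

Lemma cmod_1Bee_sqr (t : R) : cmod (1 - ee t) ^+ 2 = 2 - 2 * cos (2 * pi * t).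
Proof.
rewrite cmod_sqr !reimE; have := cos2Dsin2 (2 * pi * t); rewrite sub0r sqrrN.
by move: (cos _) (sin _) => c s; nra.
Qed.

Lemma cmod_eeB (s t : R) : cmod (ee s - ee t) = cmod (1 - ee (s - t)).
Proof.
have -> : ee s - ee t = - (ee t * (1 - ee (s - t))).
  by rewrite mulrBr mulr1 -eeD addrCA subrr addr0 opprB.
by rewrite cmodN cmodM cmod_ee mul1r.
Qed.

(** |1 - ee t|^2 = 2 - 2 cos(2 pi t'), where t' in [-1/2, 1/2] differs from t by an integer, and the
    cosine decreases on [0, pi]. The threshold is the chord of the angle 2 pi min(e, 1/4), the cap
    keeping this angle in [0, pi]. *)
Lemma ee_close (e : R) : 0 < e -> exists2 dl : R, 0 < dl &
  forall t, cmod (1 - ee t) < dl -> exists k : int, `|t - k%:~R| < e.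
Proof.
move=> e0; pose e1 := Num.min e 4^-1.
have e10 : 0 < e1 by rewrite lt_min e0 invr_gt0 ltr0n.
have e14 : e1 <= 4^-1 by rewrite ge_min lexx orbT.
have pi0 := pi_gt0 R.
have inpi (t : R) : 0 <= t -> t <= 2^-1 -> 2 * pi * t \in `[0, pi].
  move=> t0 t1; rewrite in_itv /= !mulr_ge0 ?(ltW pi0)//=.
  by have h : pi * t <= pi * 2^-1 by [rewrite ler_pM2l]; lra.
have c1 : cos (2 * pi * e1) < 1.
  rewrite -[ltRHS]cos0 ltr_cos ?mulr_gt0//.
    by rewrite in_itv /= lexx ltW.
  by apply: inpi; [exact: ltW|lra].
exists (Num.sqrt (2 - 2 * cos (2 * pi * e1))); first by rewrite sqrtr_gt0; lra.
move=> t ht; exists (Num.floor (t + 2^-1)).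
set k := Num.floor _; set t' := t - _.
have h1 : - 2^-1 <= t' by have := floor_le (t + 2^-1); rewrite -/k /t'; lra.
have h2 : t' <= 2^-1 by have := floorD1_gt (t + 2^-1); rewrite -/k /t' intrD; lra.
rewrite ltNge; apply/negP => et.
have : cmod (1 - ee t) ^+ 2 < 2 - 2 * cos (2 * pi * e1).
  rewrite -[ltRHS]sqr_sqrtr; last by lra.
  by rewrite ltr_pXn2r// ?nnegrE ?cmod_ge0// sqrtr_ge0.
have -> : ee t = ee t' by rewrite /t' eeD -mulrNz ee_int mulr1.
rewrite cmod_1Bee_sqr => hc.
have {hc} : cos (2 * pi * e1) < cos (2 * pi * `|t'|).
  case: (ger0P t') => _; first by lra.
  by rewrite mulrN cosN; lra.
rewrite ltr_cos.
- rewrite ltr_pM2l ?mulr_gt0// => h3; have : e1 <= `|t'| by apply: le_trans et; rewrite ge_min lexx.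
  by rewrite leNgt h3.
- by apply: inpi => //; rewrite ler_norml; apply/andP.
by apply: inpi; [exact: ltW|lra].
Qed.

Variables (Om : set V) (r : R).
Hypotheses (oOm : open Om) (bOm : bounded_set Om) (r0 : 0 < r).

(** Closeness in [rho] is coordinatewise closeness up to an integer vector, and adding that vector
    to y leaves the count unchanged. *)
Lemma cnt_lsc_rho (x : V) : exists2 dl : R, 0 < dl &
  forall y : V, rho x y < dl -> cnt Om r x <= cnt Om r y.
Proof.
have [e e0 he] := cnt_lsc oOm bOm r0 x.
have [dl dl0 hdl] := ee_close e0; exists dl => // y hy.
have [k hk] : exists k : 'I_d -> int, forall i, `|x 0 i - y 0 i - (k i)%:~R| < e.
  apply: (@fin_all_exists _ (fun=> int)
    (fun i k => is_true (`|x 0 i - y 0 i - k%:~R| < e))) => i.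
  apply: hdl; apply: le_lt_trans hy; rewrite -cmod_eeB /rho (bigD1 i)//= lerDl.
  by apply: sumr_ge0 => j _; exact: cmod_ge0.
rewrite -(cnt_periodic bOm r0 y (\row_i k i)); apply: he => i.
by rewrite !mxE opprD addrA.
Qed.

Lemma bm_cos_dot (u : V) : bm (fun x : T => cos (2 * pi * dotR u (x : V))).
Proof.
split; last by exists 1 => x; exact: cos_max.
apply: (@measurableT_comp _ _ _ _ _ _ (@cos R)).
  by apply: continuous_measurable_fun; exact: continuous_cos.
apply: measurable_funM; first exact: measurable_cst.
apply: measurable_sum => i; apply: measurable_funM; first exact: measurable_cst.
by apply: continuous_measurable_Rd; exact: coord_continuous.
Qed.

Lemma bm_sin_dot (u : V) : bm (fun x : T => sin (2 * pi * dotR u (x : V))).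
Proof.
split; last by exists 1 => x; exact: sin_max.
apply: (@measurableT_comp _ _ _ _ _ _ (@sin R)).
  by apply: continuous_measurable_fun; exact: continuous_sin.
apply: measurable_funM; first exact: measurable_cst.
apply: measurable_sum => i; apply: measurable_funM; first exact: measurable_cst.
by apply: continuous_measurable_Rd; exact: coord_continuous.
Qed.

Variable lam : {measure set T -> \bar R}.
Hypothesis hlam : is_lebesgue_measure lam.
Local Notation mu := (torus_measure lam).
Local Notation E f := (Rintegral mu setT f).

(** Unfolding: the sum over k of h(x + k) over those x + k in r Om, integrated over the unit cell,
    is the integral of h over r Om, which the substitution z = r y carries to Om. *)
Lemma ge0_integral_cnt (h : T -> R) : bm h -> (forall x, 0 <= h x) ->
  (forall (x : V) k, h (x + intvec R k) = h x) ->
  (\int[mu]_x (cnt Om r x * h x)%:E =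
   (r ^+ d)%:E * \int[lam]_(y in Om) (h (r *: (y : V)))%:E)%E.
Proof.
move=> bh h0 ph.
have mdil : measurable (dil Om r : set T) by apply: open_measurable_Rd; exact: open_dil.
pose g (x : T) : \bar R := (\1_(dil Om r) x * h x)%:E.
have g0 x : (0 <= g x)%E by rewrite lee_fin mulr_ge0.
have mg : measurable_fun [set: T] g.
  apply/measurable_EFinP; apply: measurable_funM; last exact: bh.1.
  exact: measurable_indic.
have [A hA] := bounded_set_coord bOm.
pose B := (Num.Def.archi_bound (r * A%:R)).+1.
have gs (x : V) : floorv x \notin intbox d B -> g x = 0%E.
  move=> fx; rewrite /g indicE memNset ?mul0r// => dx.
  move/negP: fx; apply; apply: mem_intbox; apply: floorv_absz => i.
  apply: le_trans (dil_coord r0 hA dx i) _; apply: ltW; apply: archi_boundP.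
  by rewrite mulr_ge0// ltW.
transitivity (\int[lam]_x g x)%E; last first.
  have := ge0_integral_affine hlam 0 r0 mg g0.
  under eq_integral do rewrite addr0.
  move=> /(congr1 (fun z => (r ^+ d)%:E * z)%E).
  rewrite muleA -EFinM divff ?mul1e; last by rewrite expf_neq0// gt_eqF.
  move=> <-; congr (_ * _)%E; rewrite [RHS]integral_mkcond.
  apply: eq_integral => x _; rewrite patchE /g indicE.
  have -> : (r *: (x : V) \in dil Om r) = (x \in Om).
    by apply/asboolP/asboolP; rewrite /dil /= scalerA mulVf ?gt_eqF// scale1r.
  by case: ifP => _; rewrite ?mul1r ?mul0r.
rewrite (ge0_integral_fold hlam (uniq_intbox d B) mg g0 gs).
rewrite -ge0_integral_sum//; last first.
  by move=> k; exact: measurable_translate.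
apply: etrans; last first.
  apply/esym/ge0_integral_mrestr; last by move=> x; apply: sume_ge0 => k _; exact: g0.
  by apply: emeasurable_sum => k; exact: measurable_translate.
rewrite /torus_measure ge0_integral_mrestr; last first.
- by move=> x; rewrite lee_fin mulr_ge0 ?cnt_ge0.
- apply/measurable_EFinP; apply: measurable_funM; last exact: bh.1.
  exact: (bm_cnt oOm bOm r0).1.
apply: eq_integral => x; rewrite inE => tx.
have hB : r * A%:R <= (Num.Def.archi_bound (r * A%:R))%:R.
  by apply: ltW; apply: archi_boundP; rewrite mulr_ge0// ltW.
rewrite (cnt_sum r0 (uniq_intbox d B) (cnt_torus_bound r0 hA hB tx)) mulr_suml -sumEFin.
by apply: eq_bigr => k _; rewrite /g ph.
Qed.

Lemma lebesgue_Om_lty : (lam Om < +oo)%E.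
Proof.
have [A hA] := bounded_set_coord bOm.
apply: (@le_lt_trans _ _ (lam (box (const_mx (- A%:R)) (const_mx A%:R)))).
  apply: le_measure; rewrite ?inE; [exact: open_measurable_Rd|exact: measurable_box|].
  by move=> y /hA hy i; rewrite !mxE -ler_norml.
rewrite hlam ?ltry// => i; rewrite !mxE.
by apply: (@le_trans _ _ 0); rewrite ?oppr_le0.
Qed.

(** Unfolding is available for nonnegative functions; applied to 1 and to 1 + h, nonnegative because
    |h| <= 1, it gives the case of h by subtraction. *)
Lemma E_cnt_mul (h : T -> R) : bm h -> bm (fun y : T => h (r *: (y : V))) ->
  (forall x, `|h x| <= 1) -> (forall (x : V) k, h (x + intvec R k) = h x) ->
  E (fun x => cnt Om r x * h x) = r ^+ d * Rintegral lam Om (fun y => h (r *: (y : V))).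
Proof.
move=> bh bhr h1 ph; have mu1 := torus_measure_setT hlam.
have mOm : measurable (Om : set T) by exact: open_measurable_Rd.
have lOm := lebesgue_Om_lty.
have bN := bm_cnt oOm bOm r0.
have key (f : T -> R) : bm f -> bm (fun y : T => f (r *: (y : V))) -> (forall x, 0 <= f x) ->
    (forall (x : V) k, f (x + intvec R k) = f x) ->
    E (fun x => cnt Om r x * f x) = r ^+ d * Rintegral lam Om (fun y => f (r *: (y : V))).
  move=> bf bfr f0 pf; have := ge0_integral_cnt bf f0 pf.
  rewrite (EFin_E mu1); last exact: bmM.
  rewrite -[(\int[lam]_(y in Om) _)%E]fineK; last first.
    exact: integrable_fin_num (bm_integrable mOm lOm bfr).
  by rewrite -EFinM => -[].
have b1 : bm (fun _ : T => 1 : R) by exact: bm_cst.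
have e1 := key (fun=> 1) b1 b1 (fun=> ler01) (fun _ _ => erefl).
have h0 x : 0 <= 1 + h x by have := h1 x; rewrite ler_norml => /andP[? ?]; lra.
have ph1 (x : V) k : 1 + h (x + intvec R k) = 1 + h x by rewrite ph.
have := key (fun x => 1 + h x) (bmD b1 bh) (bmD b1 bhr) h0 ph1.
rewrite (RintegralD mOm (bm_integrable mOm lOm b1) (bm_integrable mOm lOm bhr)).
rewrite mulrDr -e1.
rewrite (_ : E _ = E (fun x => cnt Om r x * 1 + cnt Om r x * h x)); last first.
  by apply: E_ext => x; rewrite mulrDr.
by rewrite (E_D mu1); [move/addrI|exact: bmM|exact: bmM].
Qed.

Lemma dotRZl (a : R) (u y : V) : dotR (a *: u) y = a * dotR u y.
Proof. by rewrite /dotR mulr_sumr; apply: eq_bigr => i _; rewrite mxE mulrA. Qed.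

Lemma dotRZr (a : R) (u y : V) : dotR u (a *: y) = a * dotR u y.
Proof. by rewrite /dotR mulr_sumr; apply: eq_bigr => i _; rewrite mxE mulrCA. Qed.

Lemma E_cnt : E (cnt Om r) = r ^+ d * fine (lam Om).
Proof.
have b1 : bm (fun _ : T => 1 : R) by exact: bm_cst.
have := E_cnt_mul b1 b1; rewrite Rintegral_cst ?mul1r; last exact: open_measurable_Rd.
move=> <-; [by apply: E_ext => x; rewrite mulr1|by move=> _; rewrite normr1|by []].
Qed.

Lemma E_cnt_cos (n : 'rV[int]_d) :
  E (fun x => cnt Om r x * cos (2 * pi * dotR (intvec R n) x)) =
  r ^+ d * ft_re lam Om (r *: intvec R n).
Proof.
rewrite E_cnt_mul.
- by congr (_ * _); apply: eq_Rintegral => y _; rewrite dotRZl dotRZr.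
- exact: bm_cos_dot.
- by apply: bm_ext (bm_cos_dot (r *: intvec R n)) => y; rewrite dotRZl dotRZr.
- by move=> x; exact: cos_max.
by move=> x k; have /(congr1 (@re R)) := ech_periodic n x k.
Qed.

Lemma E_cnt_sin (n : 'rV[int]_d) :
  E (fun x => cnt Om r x * sin (2 * pi * dotR (intvec R n) x)) =
  - (r ^+ d * ft_im lam Om (r *: intvec R n)).
Proof.
rewrite E_cnt_mul.
- rewrite /ft_im mulrN opprK; congr (_ * _); apply: eq_Rintegral => y _.
  by rewrite dotRZl dotRZr.
- exact: bm_sin_dot.
- by apply: bm_ext (bm_sin_dot (r *: intvec R n)) => y; rewrite dotRZl dotRZr.
- by move=> x; exact: sin_max.
by move=> x k; have /(congr1 (@im R)) := ech_periodic n x k.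
Qed.

End Coefficients.

(** * Fourier series *)

Section ComplexIntegral.
Context dd (T : measurableType dd) (R : realType).
Implicit Types f g : T -> Cx R.

Definition cbm f := bm (fun x => re (f x)) /\ bm (fun x => im (f x)).

Lemma cbm_ext f g : f =1 g -> cbm f -> cbm g.
Proof. by move=> /funext ->. Qed.

Lemma cbm_cst a : cbm (fun=> a).
Proof. by split; exact: bm_cst. Qed.

Lemma cbm_ofR (f : T -> R) : bm f -> cbm (fun x => ofR (f x)).
Proof. by move=> bf; split => //; exact: bm_cst. Qed.

Lemma cbmD f g : cbm f -> cbm g -> cbm (fun x => f x + g x).
Proof.
move=> [f1 f2] [g1 g2]; split.
  by apply: bm_ext (bmD f1 g1) => x; rewrite reD.
by apply: bm_ext (bmD f2 g2) => x; rewrite imD.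
Qed.

Lemma cbmM f g : cbm f -> cbm g -> cbm (fun x => f x * g x).
Proof.
move=> [f1 f2] [g1 g2]; split.
  by apply: bm_ext (bmB (bmM f1 g1) (bmM f2 g2)) => x; rewrite reM.
by apply: bm_ext (bmD (bmM f1 g2) (bmM f2 g1)) => x; rewrite imM.
Qed.

Lemma cbmZ a f : cbm f -> cbm (fun x => a * f x).
Proof. exact: cbmM (cbm_cst a). Qed.

Lemma cbmN f : cbm f -> cbm (fun x => - f x).
Proof. by move=> bf; apply: cbm_ext (cbmM (cbm_cst (-1)) bf) => x; rewrite mulN1r. Qed.

Lemma cbmB f g : cbm f -> cbm g -> cbm (fun x => f x - g x).
Proof. by move=> bf bg; exact: cbmD (cbmN bg). Qed.

Lemma cbm_cj f : cbm f -> cbm (fun x => cj (f x)).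
Proof. by move=> [f1 f2]; split => //; exact: bmN f2. Qed.

Lemma cbm_sum (I : Type) (s : seq I) (F : I -> T -> Cx R) :
  (forall i, cbm (F i)) -> cbm (fun x => \sum_(i <- s) F i x).
Proof.
move=> h; elim: s => [|i s IH].
  by apply: cbm_ext (cbm_cst 0) => x; rewrite big_nil.
by apply: cbm_ext (cbmD (h i) IH) => x; rewrite big_cons.
Qed.

Lemma bm_cmod_sqr f : cbm f -> bm (fun x => cmod (f x) ^+ 2).
Proof.
move=> [f1 f2]; apply: bm_ext (bmD (bmM f1 f1) (bmM f2 f2)) => x.
by rewrite cmod_sqr !expr2.
Qed.

Lemma bm_cmod f : cbm f -> bm (fun x => cmod (f x)).
Proof.
move=> /bm_cmod_sqr b2; have h0 x : 0 <= cmod (f x) ^+ 2 by exact: sqr_ge0.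
have h2 : 0 <= 2^-1 :> R by rewrite invr_ge0.
apply: bm_ext (bm_powR h2 h0 b2) => x.
by rewrite powR12_sqrt// sqrtr_sqr ger0_norm ?cmod_ge0.
Qed.

Variable mu : {measure set T -> \bar R}.
Hypothesis mu1 : mu [set: T] = 1%E.
Local Notation E f := (Rintegral mu setT f).

Definition CE f : Cx R := cplx (E (fun x => re (f x))) (E (fun x => im (f x))).

Lemma CE_ext f g : f =1 g -> CE f = CE g. Proof. by move=> /funext ->. Qed.

Lemma CE_cst a : CE (fun=> a) = a.
Proof. by apply: complex_ext; rewrite !reimE (E_cst mu1). Qed.

Lemma CE_ofR (f : T -> R) : CE (fun x => ofR (f x)) = ofR (E f).
Proof. by apply: complex_ext; rewrite !reimE ?(E_cst mu1). Qed.

Lemma CE_D f g : cbm f -> cbm g -> CE (fun x => f x + g x) = CE f + CE g.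
Proof.
move=> [f1 f2] [g1 g2]; apply: complex_ext; rewrite !reimE -(E_D mu1)//.
  by apply: E_ext => x; rewrite reD.
by apply: E_ext => x; rewrite imD.
Qed.

Lemma CE_Z a f : cbm f -> CE (fun x => a * f x) = a * CE f.
Proof.
move=> [f1 f2]; apply: complex_ext; rewrite !reimE -!(E_Z mu1)//.
  rewrite -(E_B mu1); [|exact: bmZ|exact: bmZ].
  by apply: E_ext => x; rewrite reM.
rewrite -(E_D mu1); [|exact: bmZ|exact: bmZ].
by apply: E_ext => x; rewrite imM.
Qed.

Lemma CE_N f : cbm f -> CE (fun x => - f x) = - CE f.
Proof.
by move=> bf; rewrite -mulN1r -CE_Z//; apply: CE_ext => x; rewrite mulN1r.
Qed.

Lemma CE_B f g : cbm f -> cbm g -> CE (fun x => f x - g x) = CE f - CE g.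
Proof. by move=> bf bg; rewrite -CE_N// -CE_D//; exact: cbmN. Qed.

Lemma CE_cj f : cbm f -> CE (fun x => cj (f x)) = cj (CE f).
Proof.
move=> [f1 f2]; apply: complex_ext; rewrite !reimE//.
rewrite -mulN1r -(E_Z mu1)//; apply: E_ext => x.
by rewrite mulN1r.
Qed.

Lemma CE_sum (I : Type) (s : seq I) (F : I -> T -> Cx R) : (forall i, cbm (F i)) ->
  CE (fun x => \sum_(i <- s) F i x) = \sum_(i <- s) CE (F i).
Proof.
move=> h; elim: s => [|i s IH].
  by rewrite big_nil -[RHS](CE_cst 0); apply: CE_ext => x; rewrite big_nil.
rewrite big_cons -IH -CE_D//; last exact: cbm_sum.
by apply: CE_ext => x; rewrite big_cons.
Qed.

Section Orthonormal.
Variables (I : eqType) (e : I -> T -> Cx R).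
Hypotheses (be : forall i, cbm (e i))
  (orth : forall i j, CE (fun x => e i x * cj (e j x)) = (i == j)%:R).

Lemma CE_expand (s : seq I) (a b : I -> Cx R) : uniq s ->
  CE (fun x => (\sum_(i <- s) a i * e i x) * cj (\sum_(i <- s) b i * e i x)) =
  \sum_(i <- s) a i * cj (b i).
Proof.
move=> us.
have bt i : cbm (fun x => a i * e i x) by exact: cbmZ (be i).
have bt' i j : cbm (fun x => a i * e i x * cj (b j * e j x)).
  by apply: cbmM (bt i) _; apply: cbm_cj; exact: cbmZ (be j).
transitivity (CE (fun x => \sum_(i <- s) \sum_(j <- s) a i * e i x * cj (b j * e j x))).
  apply: CE_ext => x; rewrite mulr_suml; apply: eq_bigr => i _.
  by rewrite cj_sum mulr_sumr.
rewrite CE_sum => [|i]; last exact: cbm_sum.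
rewrite big_seq [RHS]big_seq; apply: eq_bigr => i si; rewrite CE_sum//.
have E1 j : CE (fun x => a i * e i x * cj (b j * e j x)) = a i * cj (b j) * (i == j)%:R.
  rewrite -orth -CE_Z; last exact: cbmM (be i) (cbm_cj (be j)).
  by apply: CE_ext => x; rewrite cjM mulrACA.
rewrite (bigD1_seq i)//= E1 eqxx mulr1 big1 ?addr0// => j ji.
by rewrite E1 eq_sym (negPf ji) mulr0.
Qed.

Lemma E_cmod_sum_sqr (s : seq I) (a : I -> Cx R) : uniq s ->
  E (fun x => cmod (\sum_(i <- s) a i * e i x) ^+ 2) = \sum_(i <- s) cmod (a i) ^+ 2.
Proof.
move=> us; apply: (@ofR_inj R); rewrite ofR_sum -CE_ofR.
under [RHS]eq_bigr do rewrite cmod_sqrC.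
by rewrite -CE_expand//; apply: CE_ext => x; rewrite cmod_sqrC.
Qed.

(** Pythagoras: the right side exceeds the left one by exactly the sum of the cmod (a i - c i)^2. *)
Lemma best_approx f (s : seq I) (a c : I -> Cx R) : uniq s -> cbm f ->
  (forall i, c i = CE (fun x => f x * cj (e i x))) ->
  E (fun x => cmod (f x - \sum_(i <- s) c i * e i x) ^+ 2) <=
  E (fun x => cmod (f x - \sum_(i <- s) a i * e i x) ^+ 2).
Proof.
move=> us bf cE.
have bS b : cbm (fun x => \sum_(i <- s) b i * e i x).
  by apply: cbm_sum => i; exact: cbmZ (be i).
have fS b : CE (fun x => f x * cj (\sum_(i <- s) b i * e i x)) =
    \sum_(i <- s) c i * cj (b i).
  transitivity (CE (fun x => \sum_(i <- s) cj (b i) * (f x * cj (e i x)))).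
    apply: CE_ext => x; rewrite cj_sum mulr_sumr; apply: eq_bigr => i _.
    by rewrite cjM mulrCA.
  have bfe i : cbm (fun x => f x * cj (e i x)) by exact: cbmM bf (cbm_cj (be i)).
  rewrite CE_sum => [|i]; last exact: cbmZ (bfe i).
  by apply: eq_bigr => i _; rewrite CE_Z// cE mulrC.
have expand b : ofR (E (fun x => cmod (f x - \sum_(i <- s) b i * e i x) ^+ 2)) =
    CE (fun x => f x * cj (f x)) - \sum_(i <- s) c i * cj (b i)
    - \sum_(i <- s) cj (c i) * b i + \sum_(i <- s) b i * cj (b i).
  rewrite -CE_ofR -(CE_expand b b us).
  have -> : \sum_(i <- s) cj (c i) * b i =
      CE (fun x => (\sum_(i <- s) b i * e i x) * cj (f x)).
    rewrite -[RHS]cjK -CE_cj; last exact: cbmM (bS b) (cbm_cj bf).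
    rewrite (CE_ext (g := fun x => f x * cj (\sum_(i <- s) b i * e i x))); last first.
      by move=> x; rewrite cjM cjK mulrC.
    by rewrite fS cj_sum; apply: eq_bigr => i _; rewrite cjM cjK.
  rewrite -fS.
  have h1 := cbmM bf (cbm_cj bf); have h2 := cbmM bf (cbm_cj (bS b)).
  have h3 := cbmM (bS b) (cbm_cj bf); have h4 := cbmM (bS b) (cbm_cj (bS b)).
  rewrite -CE_B// -CE_B//; last exact: cbmB.
  rewrite -CE_D//; last by apply: cbmB => //; exact: cbmB.
  by apply: CE_ext => x; rewrite cmod_sqrC cjD cjN; ring.
have : E (fun x => cmod (f x - \sum_(i <- s) a i * e i x) ^+ 2) =
    E (fun x => cmod (f x - \sum_(i <- s) c i * e i x) ^+ 2) +
    \sum_(i <- s) cmod (a i - c i) ^+ 2.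
  apply: (@ofR_inj R); rewrite ofRD !expand ofR_sum.
  rewrite [X in _ = _ + X](eq_bigr (fun i => a i * cj (a i) - c i * cj (a i) - cj (c i) * a i
      + c i * cj (c i))); last first.
    by move=> i _; rewrite cmod_sqrC cjD cjN; ring.
  rewrite !(big_split, sumrN) /=.
  have -> : \sum_(i <- s) cj (c i) * c i = \sum_(i <- s) c i * cj (c i).
    by apply: eq_bigr => i _; rewrite mulrC.
  by ring.
by move=> ->; rewrite lerDl; apply: sumr_ge0 => i _; exact: sqr_ge0.
Qed.

End Orthonormal.

End ComplexIntegral.

(** * Characters and the Hausdorff-Young inequality on the torus *)

Section TorusFourier.
Variables (R : realType) (d : nat) (lam : {measure set Rd R d -> \bar R}).
Hypothesis hlam : is_lebesgue_measure lam.
Local Notation V := ('rV[R]_d).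
Local Notation T := (Rd R d).
Local Notation mu := (torus_measure lam).
Local Notation E f := (Rintegral mu setT f).
Let mu1 := torus_measure_setT hlam.

Lemma bm_translate (f : T -> R) (v : V) : bm f -> bm (fun x : T => f ((x : V) + v)).
Proof.
move=> [mf [B hB]]; split; last by exists B => x.
have := measurableT_comp mf (measurable_affine (R := R) 1 v).
by under eq_fun do rewrite /= scale1r.
Qed.

(** Invariance is available for nonnegative functions, so a bound of |f| is added first and
    cancelled afterwards. *)
Lemma E_translate (f : T -> R) (v : V) : bm f ->
  (forall (x : V) k, f (x + intvec R k) = f x) ->
  E (fun x : T => f ((x : V) + v)) = E f.
Proof.
move=> bf pf; have [mf [B hB]] := bf.
pose g (x : T) : R := f x + B.
have bB : bm (fun _ : T => B) by exact: bm_cst.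
have bg : bm g by exact: bmD.
have g0 x : 0 <= g x by have := hB x; rewrite ler_norml /g => /andP[? ?]; lra.
have mg : measurable_fun [set: T] (EFin \o g) by apply/measurable_EFinP; exact: bg.1.
have := ge0_integral_torus_translate hlam v mg (fun x => g0 x).
move=> /(_ (fun x k => congr1 (fun t => (t + B)%:E) (pf x k))).
rewrite /= (EFin_E mu1 bg) (EFin_E mu1 (bm_translate v bg)) => -[].
rewrite /g (E_D mu1 bf bB) (E_D mu1 (bm_translate v bf) bB).
by move/addIr.
Qed.

Lemma cbm_ech (n : 'rV[int]_d) : cbm (fun x : T => ech n (x : V)).
Proof. by split; [exact: bm_cos_dot|exact: bm_sin_dot]. Qed.

(* For n <> 0 a translation by v with n.v = 1/2 changes the sign of the integral. *)
Lemma CE_ech (n : 'rV[int]_d) : CE mu (fun x : T => ech n (x : V)) = (n == 0)%:R.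
Proof.
have [->|n0] := eqVneq n 0.
  by rewrite -[RHS](CE_cst mu1); apply: CE_ext => x; rewrite ech0.
have [i ni] : exists i, n 0 i != 0.
  apply/existsP; rewrite -negb_forall; apply: contra n0 => /forallP h.
  by apply/eqP/rowP => l; rewrite mxE; exact/eqP.
have ni' : (n 0 i)%:~R != 0 :> R by rewrite intr_eq0.
pose v : V := \row_j ((2 * (n 0 i)%:~R)^-1 *+ (j == i)).
have nv : ech n v = -1.
  rewrite /ech (_ : dotR _ _ = 2^-1) ?ee_half// /dotR (bigD1 i)//= big1 => [|j ji].
    by rewrite !mxE eqxx mulr1n addr0 invfM mulrCA divff ?mulr1.
  by rewrite !mxE (negPf ji) mulr0n mulr0.
have h : CE mu (fun x : T => ech n (x : V)) = CE mu (fun x : T => ech n ((x : V) + v)).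
  apply: complex_ext; rewrite !reimE; apply/esym.
    apply: (E_translate (f := fun x : T => re (ech n (x : V)))); first exact: (cbm_ech n).1.
    by move=> x k; rewrite ech_periodic.
  apply: (E_translate (f := fun x : T => im (ech n (x : V)))); first exact: (cbm_ech n).2.
  by move=> x k; rewrite ech_periodic.
have : CE mu (fun x : T => ech n (x : V)) = - CE mu (fun x : T => ech n (x : V)).
  rewrite {1}h -mulN1r -nv -(CE_Z mu1); last exact: cbm_ech.
  by apply: CE_ext => x; rewrite echDr mulrC.
set z := CE _ _ => hz; apply: complex_ext.
  by have := congr1 (@re R) hz; rewrite !reimE; lra.
by have := congr1 (@im R) hz; rewrite !reimE; lra.
Qed.

Lemma ech_orth (n m : 'rV[int]_d) :
  CE mu (fun x : T => ech n (x : V) * cj (ech m (x : V))) = (n == m)%:R.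
Proof.
rewrite -subr_eq0 -CE_ech; apply: CE_ext => x.
by rewrite cj_ech -echDl.
Qed.

(** All grid translates of the integrand have the same integral, and [grid_HY] bounds their sum
    pointwise by a quantity independent of x. *)
Lemma torus_HY (p q : R) (G : seq 'rV[int]_d) (c : 'rV[int]_d -> Cx R) :
  2 <= p -> q * (p - 1) = p -> uniq G ->
  E (fun x : T => cmod (\sum_(n <- G) c n * ech n (x : V)) `^ p) <=
  (\sum_(n <- G) cmod (c n) `^ q) `^ (p - 1).
Proof.
move=> p2 pq uG; have [B hB] := seq_int_bound G.
pose f (x : T) := cmod (\sum_(n <- G) c n * ech n (x : V)) `^ p.
have bf : bm f.
  apply: bm_powR; [by lra|by move=> x; exact: cmod_ge0|].
  by apply: bm_cmod; apply: cbm_sum => n; exact: cbmZ (cbm_ech n).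
have pf (x : V) k : f (x + intvec R k) = f x.
  by rewrite /f; under eq_bigr do rewrite ech_periodic.
pose J := {ffun 'I_d -> 'I_(2 * B).+1}.
have J0 : 0 < #|J|%:R :> R by rewrite ltr0n card_ffun !card_ord expn_gt0.
rewrite -(ler_pM2l J0).
have -> : #|J|%:R * E f = E (fun x : T => \sum_(j : J) f ((x : V) + grid_point R j)).
  rewrite (E_sum mu1) => [|j]; last exact: bm_translate.
  rewrite (eq_bigr (fun=> E f)) => [|j _]; last exact: E_translate.
  by rewrite sumr_const mulr_natl.
rewrite -[leRHS](E_cst mu1); apply: (E_le mu1).
- by apply: bm_sum => j; exact: bm_translate.
- exact: bm_cst.
by move=> x; exact: grid_HY.
Qed.

End TorusFourier.

Section TrigpExpand.
Variables (R : realType) (d : nat).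

(** The collected coefficients vanish off G0, so every larger G gives the same function; this allows
    comparison with Fourier sums over arbitrary large G. *)
Lemma trigp_expand (P : 'rV[R]_d -> Cx R) : trigp P ->
  exists (G0 : seq 'rV[int]_d) (A : 'rV[int]_d -> Cx R),
    forall G, uniq G -> {subset G0 <= G} -> forall x, P x = \sum_(n <- G) A n * ech n x.
Proof.
move=> [s hs]; exists [seq u.2 | u <- s], (fun n => \sum_(u <- s | u.2 == n) u.1).
move=> G uG sG x; rewrite hs.
under [RHS]eq_bigr => n _ do rewrite mulr_suml big_mkcond.
rewrite exchange_big /= big_seq [RHS]big_seq; apply: eq_bigr => u us.
rewrite (bigD1_seq u.2)//=; last by apply: sG; exact: map_f.
by rewrite eqxx big1 ?addr0// => n; rewrite eq_sym => /negPf ->.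
Qed.

End TrigpExpand.

(** * The Fourier series of the discrepancy *)

Section DiscrepancySeries.
Variables (R : realType) (d : nat) (lam : {measure set Rd R d -> \bar R}).
Hypothesis hlam : is_lebesgue_measure lam.
Variables (Om : set 'rV[R]_d) (r : R).
Hypotheses (oOm : open Om) (bOm : bounded_set Om) (r0 : 0 < r).
Local Notation V := ('rV[R]_d).
Local Notation T := (Rd R d).
Local Notation mu := (torus_measure lam).
Local Notation E f := (Rintegral mu setT f).
Local Notation D := (discrepancy lam Om r).
Let mu1 := torus_measure_setT hlam.

Lemma discrepancyE x : D x = cnt Om r x - r ^+ d * fine (lam Om).
Proof. by []. Qed.

Lemma bm_discrepancy : bm (D : T -> R).
Proof. by apply: bmB; [exact: bm_cnt|exact: bm_cst]. Qed.

Definition coef (n : 'rV[int]_d) : Cx R :=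
  CE mu (fun x : T => ofR (D x) * cj (ech n (x : V))).

Lemma coef_eq (n : 'rV[int]_d) : coef n =
  CE mu (fun x : T => ofR (cnt Om r x) * cj (ech n (x : V))) -
  ofR (r ^+ d * fine (lam Om)) *+ (n == 0).
Proof.
have bN := cbm_ofR (bm_cnt oOm bOm r0); have be := cbm_cj (cbm_ech R n).
rewrite -mulr_natr -(_ : CE mu (fun x : T => cj (ech n (x : V))) = (n == 0)%:R).
  rewrite -(CE_Z mu1 _ be) -(CE_B mu1 (cbmM bN be) (cbmZ _ be)).
  by apply: CE_ext => x; rewrite discrepancyE ofRD ofRN mulrBl.
rewrite (CE_cj mu1); last exact: cbm_ech.
by rewrite (CE_ech hlam); case: (_ == _); rewrite ?cj0 ?cj1.
Qed.

(** The mean of the count is r^d |Om|, so the discrepancy has mean zero; hence only n <> 0 enters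
    the norms of the coefficients. *)
Lemma coef0 : coef 0 = 0.
Proof.
have -> : coef 0 = CE mu (fun x : T => ofR (D x)).
  by apply: CE_ext => x; rewrite ech0 cj1 mulr1.
rewrite (CE_ofR mu1) (_ : E D = 0) ?ofR0//.
have h := E_B mu1 (bm_cnt oOm bOm r0) (bm_cst T (r ^+ d * fine (lam Om))).
by apply: (etrans h); rewrite (E_cst mu1) -(E_cnt oOm bOm r0 hlam); exact: subrr.
Qed.

Lemma cmod_coef (n : 'rV[int]_d) : n != 0 ->
  cmod (coef n) = r ^+ d * abs_ft_chi lam Om (r *: intvec R n).
Proof.
move=> n0; rewrite coef_eq (negPf n0) mulr0n subr0.
have -> : CE mu (fun x : T => ofR (cnt Om r x) * cj (ech n (x : V))) =
    cplx (r ^+ d * ft_re lam Om (r *: intvec R n)) (r ^+ d * ft_im lam Om (r *: intvec R n)).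
  apply: complex_ext; rewrite !reimE.
    rewrite -(E_cnt_cos oOm bOm r0 hlam); apply: E_ext => x.
    by rewrite !reimE mul0r subr0.
  rewrite -[RHS]opprK -(E_cnt_sin oOm bOm r0 hlam) -mulN1r -(E_Z mu1).
    by apply: E_ext => x; rewrite !reimE mul0r addr0 mulN1r mulrN.
  by apply: bmM; [exact: bm_cnt|exact: bm_sin_dot].
have rd : 0 <= r ^+ d by rewrite exprn_ge0// ltW.
rewrite /cmod !reimE /abs_ft_chi !exprMn -mulrDr sqrtrM ?sqr_ge0//.
by rewrite sqrtr_sqr ger0_norm.
Qed.

(** Dominated convergence brings a trigonometric polynomial close to the count in L^2. Subtracting
    the constant r^d |Om| gives one close to the discrepancy, and over any G containing its
    frequencies the Fourier sum does at least as well. *)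
Lemma discrepancy_L2 (e : R) : 0 < e -> exists G0 : seq 'rV[int]_d,
  forall G, uniq G -> {subset G0 <= G} ->
  E (fun x : T => cmod (ofR (D x) - \sum_(n <- G) coef n * ech n (x : V)) ^+ 2) <= e.
Proof.
move=> e0; have [A hA] := bounded_set_coord bOm.
pose B0 := Num.Def.archi_bound (r * A%:R).
have hB0 : r * A%:R <= B0%:R.
  by apply: ltW; apply: archi_boundP; rewrite mulr_ge0// ltW.
set B : R := (2 * B0.+1).+1%:R ^+ d.
have N0B x : 0 <= cnt Om r x <= B by rewrite cnt_ge0//= (cnt_le bOm r0 hA hB0).
have [P [tP PB Pcvg]] := lsc_trig_approx N0B (cnt_lsc_rho oOm bOm r0).
have B0' : 0 <= B by rewrite exprn_ge0.
have bN := cbm_ofR (bm_cnt oOm bOm r0).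
have bP m : cbm (fun x : T => P m x).
  have [s hs] := tP m.
  have : cbm (fun x : T => \sum_(u <- s) u.1 * ech u.2 (x : V)).
    by apply: cbm_sum => u; apply: cbmZ; exact: cbm_ech.
  by apply: cbm_ext => x; rewrite hs.
pose f m (x : T) := cmod (P m x - ofR (cnt Om r x)) ^+ 2.
have bf m : bm (f m) by apply: bm_cmod_sqr; exact: cbmB.
have [m fm] : exists m, E (f m) <= e.
  have c1 m : measurable_fun [set: T] (fun x : T => (f m x)%:E).
    by apply/measurable_EFinP; exact: (bf m).1.
  have c2 (x : T) : [set: T] x -> (f m x)%:E @[m --> \oo] --> cst 0%E x.
    move=> _ W hW.
    have /nbhs_ballP[e' /= e'0 he'] : nbhs (0 : R) (fun t => W t%:E) by exact: hW.
    pose dl := Num.min 1 (e' / 2).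
    have dl0 : 0 < dl by rewrite lt_min ltr01 divr_gt0.
    have dl1 : dl <= 1 by rewrite ge_min lexx.
    have dl2 : dl <= e' / 2 by rewrite ge_min lexx orbT.
    have [m0 hm0] := Pcvg x dl dl0.
    exists m0 => // m /= /hm0 hm; apply: he'.
    rewrite /ball /= sub0r normrN ger0_norm ?sqr_ge0//.
    by have := cmod_ge0 (P m x - ofR (cnt Om r x)); rewrite /f; nra.
  have c4 : mu.-integrable [set: T] (cst ((2 * B) ^+ 2)%:E).
    by apply: (bm_integrableT mu1 (f := fun=> (2 * B) ^+ 2)); exact: bm_cst.
  have c5 m (x : T) : [set: T] x -> (`|(f m x)%:E| <= cst ((2 * B) ^+ 2)%:E x)%E.
    move=> _; rewrite /= lee_fin ger0_norm ?sqr_ge0// /f.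
    have : cmod (P m x - ofR (cnt Om r x)) <= 2 * B.
      apply: le_trans (cmodD _ _) _; rewrite cmodN cmod_ofR mulr2n mulrDl mul1r lerD//.
      by have /andP[n1 n2] := N0B x; rewrite ger0_norm.
    by have := cmod_ge0 (P m x - ofR (cnt Om r x)); nra.
  have c3 (x : T) : [set: T] x -> cst ((2 * B) ^+ 2)%:E x \is a fin_num by [].
  have := dominated_cvg measurableT c1 c2 c3 c4 c5.
  rewrite integral0 => /(_ [set z | (z < e%:E)%E])[|m0 _ hm0].
    have : nbhs (0 : R) [set t : R | t < e].
      by apply: open_nbhs_nbhs; split; [exact: open_lt|].
    by move=> h; exact: h.
  exists m0; have := hm0 m0 (leqnn m0); rewrite /= (EFin_E mu1 (bf m0)) lte_fin.
  exact: ltW.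
have tQ : trigp (fun x => P m x - ofR (r ^+ d * fine (lam Om))).
  apply: trigpD (tP m) _; exact: trigp_cst.
have [G0 [a ha]] := trigp_expand tQ.
exists G0 => G uG sG; apply: le_trans fm.
have bD : cbm (fun x : T => ofR (D x)) by apply: cbm_ofR; exact: bm_discrepancy.
have := @best_approx _ T R mu mu1 _ (fun n (x : T) => ech n (x : V)) (@cbm_ech R d)
  (ech_orth hlam) (fun x : T => ofR (D x)) G a coef uG bD (fun=> erefl).
move=> /le_trans; apply; rewrite le_eqVlt; apply/orP; left; apply/eqP.
apply: E_ext => x; rewrite /f -(ha G uG sG) discrepancyE ofRD ofRN -cmodN.
by congr (cmod _ ^+ 2); ring.
Qed.

End DiscrepancySeries.

(** * Norm estimates *)

Section DyadicSums.
Variable R : realType.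

Lemma geom_sum_le (x : R) (K : nat) : 0 <= x -> x < 1 ->
  \sum_(k < K) x ^+ k <= (1 - x)^-1.
Proof.
move=> x0 x1; have h : 0 < 1 - x by lra.
rewrite -[leRHS]mul1r ler_pdivlMr// mulrC -opprB mulNr -subrX1 opprB lerBlDr lerDl.
exact: exprn_ge0.
Qed.

Lemma powR2_ge1 (K : nat) : K%:R + 1 <= 2 ^+ K :> R.
Proof.
elim: K => [|K IH]; first by rewrite add0r expr0.
by rewrite exprS -natr1; have : 0 <= K%:R :> R by []; lra.
Qed.

Variables (I : eqType) (b : I -> R) (q W : R).
Hypotheses (q1 : 1 < q) (q2 : q < 2) (W0 : 0 < W).
Implicit Types G : seq I.
Hypothesis weak : forall (u : R) G, 0 < u -> uniq G -> {in G, forall n, u < b n} ->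
  (size G)%:R * u `^ q <= W.

Let count_le (u : R) G : 0 < u -> uniq G ->
  \sum_(n <- G) (u < b n)%R%:R <= W * u `^ (- q).
Proof.
move=> u0 uG.
have -> : \sum_(n <- G) (u < b n)%R%:R = (size [seq n <- G | u < b n])%:R :> R.
  rewrite size_filter; elim: (G) => [|n s IH]; first by rewrite big_nil.
  by rewrite big_cons IH /= natrD.
rewrite powRN ler_pdivlMr ?powR_gt0//; apply: weak => //; first exact: filter_uniq.
by move=> n; rewrite mem_filter => /andP[].
Qed.

(** Geometric series over dyadic layers: 2 times the sum of 2^((1-q)k) above the level, and in
    [weakC2] 2^q times the sum of 2^((q-2)k) below it. *)
Definition weakC1 : R := 2 / (1 - 2 `^ (1 - q)).
Definition weakC2 : R := 2 `^ q / (1 - 2 `^ (q - 2)).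

Lemma powR2_lt1 (a : R) : a < 0 -> 2 `^ a < 1.
Proof.
move=> a0; rewrite -[a]opprK powRN invf_lt1 ?powR_gt0//.
rewrite -[ltLHS](_ : 1 `^ (- a) = 1); last by rewrite powR1.
by apply: gt0_ltr_powR; rewrite ?nnegrE ?oppr_gt0// ltr1n.
Qed.

Lemma weakC1_gt0 : 0 < weakC1.
Proof.
have h := q1; rewrite divr_gt0// subr_gt0; apply: powR2_lt1; lra.
Qed.

Lemma weakC2_gt0 : 0 < weakC2.
Proof.
have h := q2; rewrite divr_gt0 ?powR_gt0// subr_gt0; apply: powR2_lt1; lra.
Qed.

(** Layers upwards from s: a term t with s < t <= 2^L s is at most the sum of 2^(k+1) s over those k
    < L with 2^k s < t. At most W (2^k s)^-q terms exceed the k-th threshold, which leaves a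
    geometric series of ratio 2^(1-q). *)
Lemma weak_sum_large (s : R) G : 0 < s -> uniq G -> {in G, forall n, s < b n} ->
  \sum_(n <- G) b n <= weakC1 * W * s `^ (1 - q).
Proof.
move=> s0 uG sb; have hq1 := q1; have hW := W0.
have [K hK] : exists K : nat, {in G, forall n, b n <= 2 ^+ K * s}.
  pose M := \sum_(n <- G) `|b n|.
  exists (Num.Def.archi_bound (M / s)) => n nG.
  apply: (@le_trans _ _ M).
    apply: le_trans (ler_norm _) _; rewrite /M (bigD1_seq n)//= lerDl.
    by apply: sumr_ge0.
  rewrite -ler_pdivrMr//; apply: le_trans (powR2_ge1 _); apply: ltW.
  apply: lt_le_trans (archi_boundP _) _; last by rewrite lerDl.
  by rewrite divr_ge0 ?sumr_ge0// ltW.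
have pw (L : nat) (t : R) : s < t -> t <= 2 ^+ L * s ->
    t <= \sum_(k < L) 2 ^+ k.+1 * s * (2 ^+ k * s < t)%R%:R.
  move=> st; elim: L => [|L IH]; first by rewrite expr0 mul1r leNgt st.
  rewrite big_ord_recr /=; case: ltP => [h1 h2|h1 _].
    rewrite mulr1; apply: le_trans h2 _; rewrite lerDr; apply: sumr_ge0 => k _.
    by rewrite !mulr_ge0// ?exprn_ge0// ltW.
  by rewrite mulr0 addr0; exact: IH.
apply: (@le_trans _ _ (\sum_(k < K) 2 ^+ k.+1 * s * (W * (2 ^+ k * s) `^ (- q)))).
  apply: (@le_trans _ _ (\sum_(n <- G) \sum_(k < K) 2 ^+ k.+1 * s * (2 ^+ k * s < b n)%R%:R)).
    by rewrite !big_seq; apply: ler_sum => n nG; apply: pw; [exact: sb|exact: hK].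
  rewrite exchange_big /=; apply: ler_sum => k _; rewrite -mulr_sumr.
  rewrite ler_wpM2l ?mulr_ge0 ?exprn_ge0// ?(ltW s0)//.
  by apply: count_le => //; rewrite mulr_gt0 ?exprn_gt0.
have -> : \sum_(k < K) 2 ^+ k.+1 * s * (W * (2 ^+ k * s) `^ (- q)) =
    2 * W * s `^ (1 - q) * \sum_(k < K) (2 `^ (1 - q)) ^+ k.
  rewrite mulr_sumr; apply: eq_bigr => k _.
  rewrite powRM ?exprn_ge0 ?(ltW s0)// exprS powR_exprn//.
  rewrite !powRD ?powRr1 ?(ltW s0)//; try by apply/implyP => _; rewrite ?gt_eqF.
  by rewrite exprMn; ring.
rewrite /weakC1 [leRHS](_ : _ = 2 * W * s `^ (1 - q) * (1 - 2 `^ (1 - q))^-1); last by ring.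
rewrite ler_wpM2l ?mulr_ge0 ?powR_ge0 ?(ltW W0)//.
by apply: geom_sum_le; rewrite ?powR_ge0//; apply: powR2_lt1; lra.
Qed.

(** Layers downwards from s: the threshold s / 2^(k+1) is exceeded by at most W (s / 2^(k+1))^-q
    terms, and the ratio is 2^(q-2). Terms below the last threshold add an error that tends to 0
    with the number K of layers. *)
Lemma weak_sum_small (s : R) G : 0 < s -> uniq G ->
  {in G, forall n, 0 <= b n <= s} ->
  \sum_(n <- G) b n ^+ 2 <= weakC2 * W * s `^ (2 - q).
Proof.
move=> s0 uG sb; have hq2 := q2; have hW := W0.
have pw (L : nat) (t : R) : 0 <= t -> t <= s ->
    t ^+ 2 <= \sum_(k < L) (s / 2 ^+ k) ^+ 2 * (s / 2 ^+ k.+1 < t)%R%:R + (s / 2 ^+ L) ^+ 2.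
  move=> t0 ts; elim: L => [|L IH].
    by rewrite big_ord0 add0r expr0 divr1; nra.
  rewrite big_ord_recr /=; case: ltP => [h1|h1].
    by rewrite mulr1; apply: le_trans IH _; rewrite lerDl sqr_ge0.
  have S0 : 0 <= \sum_(k < L) (s / 2 ^+ k) ^+ 2 * (s / 2 ^+ k.+1 < t)%R%:R.
    by apply: sumr_ge0 => k _; rewrite mulr_ge0 ?sqr_ge0.
  by rewrite mulr0 addr0; move: (s / 2 ^+ L.+1) h1 S0 => z h1; nra.
(* The remainder (size G) s^2 / 4^K is weakened to a multiple of 1/(K+1), which the Archimedean
   property suffices to make small. *)
have main (K : nat) : \sum_(n <- G) b n ^+ 2 <=
    weakC2 * W * s `^ (2 - q) + (size G)%:R * s ^+ 2 / (K%:R + 1).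
  apply: (@le_trans _ _ (\sum_(k < K) (s / 2 ^+ k) ^+ 2 * (W * (s / 2 ^+ k.+1) `^ (- q)) +
      (size G)%:R * (s / 2 ^+ K) ^+ 2)).
    apply: (@le_trans _ _ (\sum_(n <- G) (\sum_(k < K) (s / 2 ^+ k) ^+ 2 *
        (s / 2 ^+ k.+1 < b n)%R%:R + (s / 2 ^+ K) ^+ 2))).
      by rewrite !big_seq; apply: ler_sum => n /sb/andP[h1 h2]; exact: pw.
    rewrite big_split /=; apply: lerD; last first.
      by rewrite big_const_seq iter_addr_0 count_predT mulr_natl.
    rewrite exchange_big /=; apply: ler_sum => k _; rewrite -mulr_sumr.
    rewrite ler_wpM2l ?sqr_ge0//.
    by apply: count_le => //; rewrite divr_gt0 ?exprn_gt0.
  apply: lerD.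
    have -> : \sum_(k < K) (s / 2 ^+ k) ^+ 2 * (W * (s / 2 ^+ k.+1) `^ (- q)) =
        2 `^ q * W * s `^ (2 - q) * \sum_(k < K) (2 `^ (q - 2)) ^+ k.
      rewrite mulr_sumr; apply: eq_bigr => k _.
      have ip : 0 <= (2 ^+ k.+1)^-1 :> R by rewrite invr_ge0 exprn_ge0.
      have inv2 : ((2 ^+ k.+1)^-1 : R) `^ (- q) = (2 `^ q) ^+ k.+1.
        rewrite -[(2 ^+ k.+1)^-1]powR_inv1 ?exprn_ge0// -powRrM mulN1r opprK.
        by rewrite powR_exprn.
      rewrite powRM ?(ltW s0)// inv2.
      rewrite (@powRD _ s) ?(@powRD _ 2); try by apply/implyP => _; rewrite ?gt_eqF// ?ltr0n.
      rewrite powR_mulrn ?(ltW s0)// [2 `^ (-2)]powRN [2 `^ 2]powR_mulrn//.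
      have e2 : ((2 ^+ 2)^-1) ^+ k = ((2 ^+ k) ^+ 2)^-1 :> R by rewrite exprVn exprAC.
      rewrite [_ ^+ k.+1]exprS [(_ * _) ^+ k]exprMn e2.
      have : 2 ^+ k != 0 :> R by rewrite expf_neq0.
      by move: (2 ^+ k) => z z0; field.
    rewrite /weakC2 [leRHS](_ : _ = 2 `^ q * W * s `^ (2 - q) * (1 - 2 `^ (q - 2))^-1); last by ring.
    rewrite ler_wpM2l ?mulr_ge0 ?powR_ge0 ?(ltW W0)//.
    by apply: geom_sum_le; rewrite ?powR_ge0//; apply: powR2_lt1; lra.
  rewrite -mulrA ler_wpM2l// expr_div_n ler_wpM2l ?sqr_ge0// lef_pV2 ?posrE ?exprn_gt0 ?ltr_wpDl//.
  apply: le_trans (powR2_ge1 K) _; rewrite -exprM muln2 -addnn exprD ler_peMr ?exprn_ge0//.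
  by apply: le_trans (powR2_ge1 K); rewrite lerDr.
apply/ler_addgt0Pr => e e0.
pose c := (size G)%:R * s ^+ 2.
have c0 : 0 <= c by rewrite mulr_ge0 ?sqr_ge0.
apply: le_trans (main (Num.Def.archi_bound (c / e))) _; rewrite lerD2l -/c.
rewrite ler_pdivrMr; last by rewrite ltr_wpDl.
rewrite mulrC -ler_pdivrMr//; apply: ltW.
apply: lt_le_trans (archi_boundP _) _; last by rewrite lerDl.
by rewrite divr_ge0// ltW.
Qed.

End DyadicSums.

(** * From L^2 approximation to strong and weak L^p bounds *)

Section Estimates.
Context dd (T : measurableType dd) (R : realType).
Variable mu : {measure set T -> \bar R}.
Hypothesis mu1 : mu [set: T] = 1%E.
Local Notation E f := (Rintegral mu setT f).

(** With z = CE f, |z|^2 is the real part of the mean of cj z * f, hence at most |z| times the mean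
    of |f|. *)
Lemma cmod_CE_le (f : T -> Cx R) : cbm f -> cmod (CE mu f) <= E (fun x => cmod (f x)).
Proof.
move=> bf; set z := CE mu f.
have [->|z0] := eqVneq (cmod z) 0.
  by apply: E_ge0 => x; exact: cmod_ge0.
have zp : 0 < cmod z by rewrite lt_neqAle eq_sym z0 cmod_ge0.
rewrite -(ler_pM2l zp) -expr2 cmod_sqrE.
have -> : z * cj z = CE mu (fun x => cj z * f x) by rewrite (CE_Z mu1) // mulrC.
rewrite reimE -(E_Z mu1); last exact: bm_cmod.
apply: (E_le mu1).
- exact: (cbmZ (cj z) bf).1.
- by apply: bmZ; exact: bm_cmod.
move=> x; apply: le_trans (ler_norm _) _; apply: le_trans (abs_re_le _) _.
by rewrite cmodM cmodJ.
Qed.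

(** Young's inequality with m = E|f|: m^p = E(|f| m^(p-1)) <= E|f|^p / p + m^p / q for the conjugate
    exponent q, and m^p / q is absorbed on the left. *)
Lemma E_abs_powR_le (f : T -> R) (p : R) : 1 < p -> bm f ->
  E (fun x => `|f x|) `^ p <= E (fun x => `|f x| `^ p).
Proof.
move=> p1 bf; have bF := bm_norm bf.
set m := E _.
have m0 : 0 <= m by apply: E_ge0.
pose q := p / (p - 1).
have q0 : 0 < q by rewrite divr_gt0; lra.
have pp : 0 < p by lra.
have pn0 : p != 0 by rewrite gt_eqF.
have pq : p^-1 + q^-1 = 1 by rewrite /q invf_div; field.
have bP : bm (fun x => `|f x| `^ p) by apply: bm_powR => //; lra.
have h : m `^ (p - 1) * m <= E (fun x => `|f x| `^ p) / p + m `^ p / q.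
  rewrite -(E_Z mu1)//.
  have -> : E (fun x => `|f x| `^ p) / p + m `^ p / q =
      E (fun x => p^-1 * `|f x| `^ p + m `^ p / q).
    rewrite (E_D mu1); [|exact: bmZ|exact: bm_cst].
    by rewrite (E_cst mu1) (E_Z mu1)// mulrC.
  apply: (E_le mu1); [exact: bmZ|apply: bmD; [exact: bmZ|exact: bm_cst]|].
  move=> x; have := @conjugate_powR R `|f x| (m `^ (p - 1)) p q (normr_ge0 _) (powR_ge0 _ _)
    pp q0 pq; rewrite -powRrM.
  have -> : (p - 1) * q = p by rewrite /q mulrC divfK// subr_eq0 gt_eqF//; lra.
  by rewrite [`|f x| * _]mulrC [p^-1 * _]mulrC.
have : m `^ p <= E (fun x => `|f x| `^ p) / p + m `^ p / q.
  apply: le_trans h; rewrite mulrC mulr_powRB1//; lra.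
have -> : q^-1 = 1 - p^-1 by move: pq; lra.
rewrite mulrBr mulr1 => h2.
have : m `^ p / p <= E (fun x => `|f x| `^ p) / p by lra.
by rewrite ler_pM2r ?invr_gt0.
Qed.

Variables (I : eqType) (e : I -> T -> Cx R).
Hypotheses (be : forall i, cbm (e i)) (e1 : forall i x, cmod (e i x) <= 1)
  (orth : forall i j, CE mu (fun x => e i x * cj (e j x)) = (i == j)%:R).
Variables (D : T -> R) (c : I -> Cx R).
Hypothesis bD : bm D.
Hypothesis L2approx : forall eps : R, 0 < eps -> exists G0 : seq I,
  forall G, uniq G -> {subset G0 <= G} ->
  E (fun x => cmod (ofR (D x) - \sum_(i <- G) c i * e i x) ^+ 2) <= eps.

Let S G x := \sum_(i <- G) c i * e i x.

Let bS G : cbm (S G).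
Proof. by apply: cbm_sum => i; exact: cbmZ. Qed.

Let bDS G : cbm (fun x => ofR (D x) - S G x).
Proof. by apply: cbmB (bS G); exact: cbm_ofR. Qed.

Let exG eps : 0 < eps -> exists2 G, uniq G & E (fun x => cmod (ofR (D x) - S G x) ^+ 2) <= eps.
Proof.
move=> /L2approx[G0 h]; exists (undup G0); first exact: undup_uniq.
by apply: h; [exact: undup_uniq|move=> n; rewrite mem_undup].
Qed.

(** As |D| <= B, one has |D|^p <= B^(p-1) |D - S| + |S| |D|^(p-1). The first term is small in mean
    by L^2 approximation; Young's inequality turns the second into |S|^p / p + |D|^p / q, whose last
    term is absorbed on the left. *)
Lemma strong_estimate (p q Y : R) : 2 <= p -> q * (p - 1) = p ->
  (forall G, uniq G -> E (fun x => cmod (S G x) `^ p) <= Y) ->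
  E (fun x => `|D x| `^ p) <= Y.
Proof.
move=> p2 pq hY; have [_ [B0 hB0]] := bD.
pose B := Num.max B0 0.
have B_ge0 : 0 <= B by rewrite le_max lexx orbT.
have hB x : `|D x| <= B by rewrite le_max hB0.
have p0 : 0 < p by lra.
have q0 : 0 < q by have : 0 < q * (p - 1) by [lra|]; rewrite pmulr_lgt0//; lra.
have pn0 : p != 0 by rewrite gt_eqF.
have pq1 : p^-1 + q^-1 = 1.
  have h : p - 1 != 0 by rewrite subr_eq0 gt_eqF//; lra.
  have -> : q = p / (p - 1) by apply: (mulIf h); rewrite divfK.
  by rewrite invf_div; field.
apply/ler_addgt0Pr => t t0.
(* Makes p B^(p-1) eta at most t; the added 1 covers B = 0. *)
pose eta := t / (p * (B `^ (p - 1) + 1)).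
have B1 : 0 < B `^ (p - 1) + 1 by rewrite ltr_wpDl ?powR_ge0.
have eta0 : 0 < eta by rewrite divr_gt0// mulr_gt0.
have [G uG hG] := exG (exprn_gt0 2 eta0).
have bP : bm (fun x => `|D x| `^ p) by apply: bm_powR => //; [exact: ltW|exact: bm_norm].
have bSp : bm (fun x => cmod (S G x) `^ p).
  by apply: bm_powR; [exact: ltW|move=> x; exact: cmod_ge0|exact: bm_cmod].
have bd : bm (fun x => cmod (ofR (D x) - S G x)) by exact: bm_cmod.
have bd2 : bm (fun x => cmod (ofR (D x) - S G x) ^+ 2) by exact: bm_cmod_sqr.
have E1 : E (fun x => cmod (ofR (D x) - S G x)) <= eta.
  apply: (@le_trans _ _ (E (fun x => eta / 2 + (2 * eta)^-1 * cmod (ofR (D x) - S G x) ^+ 2))).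
    apply: (E_le mu1) => //; first by apply: bmD; [exact: bm_cst|exact: bmZ].
    move=> x; set u := cmod _; rewrite -subr_ge0.
    have -> : eta / 2 + (2 * eta)^-1 * u ^+ 2 - u = (2 * eta)^-1 * (eta - u) ^+ 2.
      by field; rewrite gt_eqF.
    by rewrite mulr_ge0 ?sqr_ge0// invr_ge0 mulr_ge0// ltW.
  rewrite (E_D mu1); [|exact: bm_cst|exact: bmZ].
  rewrite (E_cst mu1) (E_Z mu1)//.
  apply: (@le_trans _ _ (eta / 2 + (2 * eta)^-1 * eta ^+ 2)).
    by rewrite lerD2l ler_wpM2l// invr_ge0 mulr_ge0// ltW.
  by rewrite le_eqVlt; apply/orP; left; apply/eqP; field; rewrite gt_eqF.
have main : E (fun x => `|D x| `^ p) <=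
    B `^ (p - 1) * eta + (p^-1 * Y + q^-1 * E (fun x => `|D x| `^ p)).
  apply: (@le_trans _ _ (E (fun x => B `^ (p - 1) * cmod (ofR (D x) - S G x) +
      (p^-1 * cmod (S G x) `^ p + q^-1 * `|D x| `^ p)))).
    apply: (E_le mu1) => //.
      by apply: bmD; [exact: bmZ|apply: bmD; exact: bmZ].
    move=> x; rewrite -(mulr_powRB1 (normr_ge0 _) p0).
    have Dle : `|D x| <= cmod (ofR (D x) - S G x) + cmod (S G x).
      by rewrite -cmod_ofR; apply: le_trans (cmodD _ _); rewrite subrK.
    apply: (@le_trans _ _ ((cmod (ofR (D x) - S G x) + cmod (S G x)) * `|D x| `^ (p - 1))).
      by rewrite ler_wpM2r ?powR_ge0.
    rewrite mulrDl; apply: lerD.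
      rewrite mulrC ler_wpM2r ?cmod_ge0//; apply: ler_powR2 => //; lra.
    have := @conjugate_powR R (cmod (S G x)) (`|D x| `^ (p - 1)) p q (cmod_ge0 _) (powR_ge0 _ _)
      p0 q0 pq1.
    rewrite -powRrM [(p - 1) * q]mulrC pq (mulr_powRB1 (normr_ge0 _) p0).
    by rewrite ![_^-1 * _]mulrC.
  rewrite (E_D mu1); [|exact: bmZ|by apply: bmD; exact: bmZ].
  rewrite (E_D mu1); [|exact: bmZ|exact: bmZ].
  rewrite !(E_Z mu1)// lerD// ?lerD2r ler_wpM2l ?powR_ge0//.
    by rewrite invr_ge0 ltW.
  exact: hY.
set X := E _ in main *.
have q1 : q^-1 = 1 - p^-1 by lra.
have : X / p <= B `^ (p - 1) * eta + Y / p by move: main; rewrite q1; lra.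
rewrite ler_pdivrMr// mulrDl divfK ?gt_eqF// => h; apply: le_trans h _.
rewrite addrC lerD2l /eta.
have -> : B `^ (p - 1) * (t / (p * (B `^ (p - 1) + 1))) * p =
    t * (B `^ (p - 1) / (B `^ (p - 1) + 1)) by field; rewrite !gt_eqF.
by rewrite ler_piMr ?(ltW t0)// ler_pdivrMr// mul1r lerDl.
Qed.

(** The 8 is 4, from Chebyshev's inequality at t/2, times 2, from (v+w)^2 <= 2v^2 + 2w^2; the last
    factor comes from s^(2-q) at the level s chosen in [weak_estimate]. *)
Definition weakK (p q : R) : R := 8 * weakC2 q * (2 * weakC1 q) `^ (p - 2).

Lemma measurable_super (t : R) : measurable [set x | t < `|D x|].
Proof.
have mN := (bm_norm bD).1.
rewrite -[X in measurable X]setTI; have := mN measurableT _ (measurable_itv `]t, +oo[).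
by rewrite preimage_itvoy.
Qed.

(* The level s is chosen such that the coefficients above s contribute at most t/2
   to the sup norm; the others are estimated in L^2 by Chebyshev's inequality. *)
Lemma weak_estimate (p q W : R) : 2 < p -> q * (p - 1) = p -> 0 <= W ->
  (forall (u : R) G, 0 < u -> uniq G -> {in G, forall n, u < cmod (c n)} ->
    (size G)%:R * u `^ q <= W) ->
  forall t : R, 0 < t ->
  t `^ p * E (\1_[set x | t < `|D x|]) <= weakK p q * W `^ (p - 1).
Proof.
move=> p2 pq W0 weak t t0.
have q1 : 1 < q.
  by have : (q - 1) * (p - 1) = 1 by [rewrite mulrBl pq; lra|]; nra.
have q2 : q < 2.
  rewrite ltNge; apply/negP => q2.
  by have : 2 * (p - 1) <= q * (p - 1) by [rewrite ler_wpM2r//; lra|]; rewrite pq; lra.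
have qp1 : (q - 1) * (p - 1) = 1 by rewrite mulrBl pq; lra.
have qp2 : (p - 1) * (2 - q) = p - 2 by rewrite mulrBr [(p - 1) * q]mulrC pq; lra.
have C1 := weakC1_gt0 q1; have C2 := weakC2_gt0 q2.
have mA := measurable_super t.
have b1 : bm (\1_[set x | t < `|D x|] : T -> R) by exact: bm_indic.
have I0 : 0 <= E (\1_[set x | t < `|D x|]) by apply: E_ge0 => x.
have cheb (F : T -> Cx R) : cbm F -> (forall x, t < `|D x| -> t / 2 <= cmod (F x)) ->
    t ^+ 2 * E (\1_[set x | t < `|D x|]) <= 4 * E (fun x => cmod (F x) ^+ 2).
  move=> bF hF; have bF2 := bm_cmod_sqr bF.
  rewrite -!(E_Z mu1)//; apply: (E_le mu1); [exact: bmZ|exact: bmZ|].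
  move=> x; rewrite indicE; have [h|h] := boolP (x \in _); last by rewrite mulr0 mulr_ge0 ?sqr_ge0.
  by move: h; rewrite inE /= => /hF h; rewrite mulr1; nra.
have tp : t `^ p = t `^ (p - 2) * t ^+ 2.
  rewrite -[t ^+ 2]powR_mulrn ?(ltW t0)// -powRD; first by congr (_ `^ _); lra.
  by apply/implyP => _; rewrite gt_eqF.
rewrite tp -mulrA.
suff : t ^+ 2 * E (\1_[set x | t < `|D x|]) <= weakK p q * W `^ (p - 1) * t `^ (2 - p).
  move=> h; apply: (@le_trans _ _ (t `^ (p - 2) * (weakK p q * W `^ (p - 1) * t `^ (2 - p)))).
    by rewrite ler_wpM2l ?powR_ge0.
  rewrite mulrCA -powRD; last by apply/implyP => _; rewrite gt_eqF.
  by rewrite (_ : p - 2 + (2 - p) = 0) ?powRr0 ?mulr1//; lra.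
(* For W = 0 the level s below would be 0; in this case all coefficients vanish, so D is 0 in
   L^2. *)
move: W0; rewrite le_eqVlt => /orP[/eqP W0|W0].
  have c0 n : cmod (c n) = 0.
    apply/eqP/negPn/negP => h; have cp : 0 < cmod (c n) by rewrite lt_neqAle eq_sym h cmod_ge0.
    have := weak (cmod (c n) / 2) [:: n]; rewrite -W0 divr_gt0// => /(_ isT isT).
    rewrite mul1r leNgt powR_gt0 ?divr_gt0// => H; suff : false by [].
    by apply: H => m; rewrite inE => /eqP ->; lra.
  rewrite -W0 powR0 ?mulr0 ?mul0r; last by rewrite gt_eqF//; lra.
  apply/ler_addgt0Pr => eps eps0; rewrite add0r.
  have [G uG hG] := exG (divr_gt0 eps0 (ltr0n R 4)).
  have := cheb _ (bDS G) _; move=> h; apply: le_trans (h _) _.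
    move=> x hx; rewrite /S big1_seq => [|n _].
      by rewrite subr0 cmod_ofR; lra.
    have -> : c n = 0; last by rewrite mul0r.
    have := cmod_sqr (c n); rewrite c0 expr0n /= => h0.
    have := sqr_ge0 (re (c n)); have := sqr_ge0 (im (c n)) => h1 h2.
    apply: complex_ext; rewrite !reimE; apply/eqP; rewrite -sqrf_eq0; apply/eqP; lra.
  by move: hG; rewrite ler_pdivlMr// mulrC.
(* This s solves [weakC1 q] W s^(1-q) = t/2, because (p-1)(1-q) = -1. *)
pose s := (2 * weakC1 q * W / t) `^ (p - 1).
have base0 : 0 < 2 * weakC1 q * W / t.
  by apply: divr_gt0 => //; apply: mulr_gt0 => //; apply: mulr_gt0.
have s0 : 0 < s by rewrite powR_gt0.
have s1 : s `^ (1 - q) = (2 * weakC1 q * W / t)^-1.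
  rewrite /s -powRrM (_ : (p - 1) * (1 - q) = -1).
    by rewrite powR_inv1// ltW.
  by rewrite mulrC -opprB mulNr qp1.
have s2 : s `^ (2 - q) = (2 * weakC1 q) `^ (p - 2) * W `^ (p - 2) * t `^ (2 - p).
  have h1 : 0 <= 2 * weakC1 q by lra.
  have h3 : 0 <= t^-1 by rewrite invr_ge0 ltW.
  rewrite /s -powRrM qp2 (powRM _ (mulr_ge0 h1 (ltW W0)) h3) (powRM _ h1 (ltW W0)).
  congr (_ * _); rewrite -powR_inv1 ?(ltW t0)// -powRrM; congr (_ `^ _); lra.
have WE : W * W `^ (p - 2) = W `^ (p - 1).
  rewrite -{1}[W]powRr1 ?(ltW W0)// -powRD; first by congr (_ `^ _); lra.
  by apply/implyP => _; rewrite gt_eqF.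
suff key : t ^+ 2 * E (\1_[set x | t < `|D x|]) <= 8 * (weakC2 q * W * s `^ (2 - q)).
  by apply: le_trans key _; rewrite s2 -WE /weakK le_eqVlt; apply/orP; left; apply/eqP; ring.
apply/ler_addgt0Pr => eps eps0.
have [G uG hG] := exG (divr_gt0 eps0 (ltr0n R 8)).
pose Gl := [seq n <- G | s < cmod (c n)]; pose Gs := [seq n <- G | ~~ (s < cmod (c n))].
have uGl : uniq Gl by exact: filter_uniq.
have uGs : uniq Gs by exact: filter_uniq.
have SE x : S G x = S Gl x + S Gs x.
  by rewrite /S /Gl /Gs !big_filter; rewrite (bigID (fun n => s < cmod (c n))).
have Slb x : cmod (S Gl x) <= t / 2.
  apply: le_trans (cmod_sum _ _ _) _.
  apply: (@le_trans _ _ (\sum_(n <- Gl) cmod (c n))).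
    by apply: ler_sum => n _; rewrite cmodM ler_piMr ?cmod_ge0.
  apply: le_trans (weak_sum_large q1 W0 weak s0 uGl _) _.
    by move=> n; rewrite mem_filter => /andP[].
  rewrite s1 le_eqVlt; apply/orP; left; apply/eqP.
  by field; rewrite !gt_eqF.
have := cheb (fun x => ofR (D x) - S Gl x) (bDS Gl) _; move=> h; apply: le_trans (h _) _.
  move=> x hx; have : `|D x| <= cmod (ofR (D x) - S Gl x) + cmod (S Gl x).
    by rewrite -cmod_ofR; apply: le_trans (cmodD _ _); rewrite subrK.
  by have := Slb x; lra.
(* D minus the large part is D - S G plus the small part; the choice of G makes the former
   negligible. *)
apply: (@le_trans _ _ (4 * (2 * E (fun x => cmod (ofR (D x) - S G x) ^+ 2) +
    2 * E (fun x => cmod (S Gs x) ^+ 2)))).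
  have bb1 := bm_cmod_sqr (bDS G); have bb2 := bm_cmod_sqr (bS Gs).
  rewrite ler_pM2l// -!(E_Z mu1)// -(E_D mu1); [|exact: bmZ|exact: bmZ].
  apply: (E_le mu1); [exact: bm_cmod_sqr|by apply: bmD; exact: bmZ|].
  move=> x; have : cmod (ofR (D x) - S Gl x) <= cmod (ofR (D x) - S G x) + cmod (S Gs x).
    by apply: le_trans (cmodD _ _); rewrite SE opprD addrA subrK.
  have := cmod_ge0 (ofR (D x) - S Gl x).
  move: (cmod (ofR (D x) - S Gl x)) (cmod (ofR (D x) - S G x)) (cmod (S Gs x)) => u v w u0 uvw.
  apply: (@le_trans _ _ ((v + w) ^+ 2)); first by rewrite lerXn2r ?nnegrE// (le_trans u0).
  by rewrite -subr_ge0 (_ : _ - _ = (v - w) ^+ 2) ?sqr_ge0//; ring.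
rewrite (E_cmod_sum_sqr mu1 be orth _ uGs).
have := weak_sum_small q2 W0 weak s0 uGs _; move=> h2.
have {}h2 : \sum_(n <- Gs) cmod (c n) ^+ 2 <= weakC2 q * W * s `^ (2 - q).
  by apply: h2 => n; rewrite mem_filter -leNgt cmod_ge0 => /andP[].
by move: hG; rewrite ler_pdivlMr//; lra.
Qed.

(* As D takes its values in a translate of the integers, all values of |D| that are
   at most 1/2 coincide, so a single level v takes care of them. *)
Lemma strong_of_weak (p Q a0 : R) (K : nat) : 2 < p ->
  (forall t : R, 0 < t -> t `^ p * E (\1_[set x | t < `|D x|]) <= Q) ->
  (forall x, exists n : nat, D x = n%:R - a0) -> (forall x, `|D x| <= 2 ^+ K) ->
  E (fun x => `|D x| `^ p) <= K.+2%:R * (2 `^ p * Q).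
Proof.
move=> p2 hQ Dint DK; have p0 : 0 < p by lra.
have Q0 : 0 <= Q.
  apply: le_trans (hQ 1 ltr01); rewrite mulr_ge0 ?powR_ge0//.
  by apply: E_ge0 => x.
have [v [v0 hv]] : exists v : R, 0 <= v /\ forall x, `|D x| <= 2^-1 -> `|D x| = v.
  have [[x0 hx0]|h] := pselect (exists x0, `|D x0| <= 2^-1); last first.
    by exists 0; split => // x hx; exfalso; apply: h; exists x.
  exists `|D x0|; split => // x hx.
  have [n hn] := Dint x; have [n0 hn0] := Dint x0.
  move: hx hx0; rewrite hn hn0 !ler_norml => /andP[h1 h2] /andP[h3 h4].
  (* Two distinct values differ by at least 1, so if both lie in [-1/2, 1/2] they are -1/2 and 1/2,
     again of equal modulus. *)
  have [->//|nn] := eqVneq n n0.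
  move: nn; rewrite neq_ltn => /orP[nn|nn].
    have : n%:R + 1 <= n0%:R :> R by rewrite natr1 ler_nat.
    move=> h5; have e6 : n%:R - a0 = - 2^-1 by lra.
    have e7 : n0%:R - a0 = 2^-1 by lra.
    by rewrite e6 e7 normrN.
  have : n0%:R + 1 <= n%:R :> R by rewrite natr1 ler_nat.
  move=> h5; have e6 : n%:R - a0 = 2^-1 by lra.
  have e7 : n0%:R - a0 = - 2^-1 by lra.
  by rewrite e6 e7 normrN.
have b1 t : bm (\1_[set x | t < `|D x|] : T -> R) by apply: bm_indic; exact: measurable_super.
have hQ2 (t : R) : 0 < t -> (2 * t) `^ p * E (\1_[set x | t < `|D x|]) <= 2 `^ p * Q.
  by move=> t0; rewrite powRM ?(ltW t0)// -mulrA ler_wpM2l ?powR_ge0// hQ.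
have bP : bm (fun x => `|D x| `^ p) by apply: bm_powR => //; [exact: ltW|exact: bm_norm].
(* The layers k = 0, ..., K cover 1/2 < |D| <= 2^K and [H] covers |D| <= 1/2: K+2 terms, each
   bounded by the weak estimate at half its level. *)
pose F k x : R := (2 ^+ k) `^ p * \1_[set x | 2 ^+ k / 2 < `|D x|] x.
pose H x : R := v `^ p * \1_[set x | v / 2 < `|D x|] x.
have bF k : bm (F k) by exact: bmZ.
have bH : bm H by exact: bmZ.
have F0 k x : 0 <= F k x by rewrite mulr_ge0 ?powR_ge0.
have H0 x : 0 <= H x by rewrite mulr_ge0 ?powR_ge0.
have pw x : `|D x| `^ p <= H x + \sum_(k < K.+1) F k x.
  have [h|h] := leP `|D x| 2^-1.
    rewrite -[leLHS]addr0 lerD ?sumr_ge0// /H -(hv x h).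
    have [->|Dx] := eqVneq (D x) 0; first by rewrite normr0 powR0 ?mul0r// gt_eqF.
    rewrite indicE mem_set ?mulr1//=.
    have : 0 < `|D x| by rewrite normr_gt0.
    by lra.
  apply: (@le_trans _ _ (\sum_(k < K.+1) F k x)); last by rewrite lerDr.
  have := DK x; elim: (K) => [|L IH].
    rewrite expr0 => h1; rewrite big_ord1 /F expr0 div1r indicE mem_set ?mulr1//.
    by apply: ler_powR2 => //; exact: ltW.
  move=> h1; have [h2|h2] := leP `|D x| (2 ^+ L).
    by rewrite big_ord_recr /= -[leLHS]addr0 lerD// IH.
  rewrite big_ord_recr /= -[leLHS]add0r lerD ?sumr_ge0//.
  rewrite /F indicE mem_set ?mulr1; first by apply: ler_powR2 => //; exact: ltW.
  by rewrite /= exprS mulrAC divff ?mul1r.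
apply: (@le_trans _ _ (E (fun x => H x + \sum_(k < K.+1) F k x))).
  by apply: (E_le mu1) => //; apply: bmD => //; exact: bm_sum.
rewrite (E_D mu1)//; last exact: bm_sum.
rewrite (E_sum mu1)// -[K.+2%:R]natr1 mulrDl mul1r addrC lerD//.
  rewrite mulr_natl -[X in _ *+ X](card_ord K.+1) -sumr_const; apply: ler_sum => k _.
  rewrite /F (E_Z mu1)//; have e2 : 2 ^+ k = 2 * (2 ^+ k / 2) :> R by rewrite mulrC divfK.
  by rewrite {1}e2; apply: hQ2; rewrite divr_gt0 ?exprn_gt0.
rewrite /H (E_Z mu1)//; move: v0; rewrite le_eqVlt => /orP[/eqP <-|v0].
  by rewrite powR0 ?gt_eqF// mul0r mulr_ge0 ?powR_ge0.
have e2 : v = 2 * (v / 2) by rewrite mulrC divfK.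
by rewrite {1}e2; apply: hQ2; rewrite divr_gt0.
Qed.

End Estimates.

Section Norms.
Context dd (T : measurableType dd) (R : realType).
Variable mu : {measure set T -> \bar R}.
Hypothesis mu1 : mu [set: T] = 1%E.
Local Notation E f := (Rintegral mu setT f).

Lemma Lnorm_bm (f : T -> R) (p : R) : 0 < p -> bm f ->
  Lnorm mu p%:E (EFin \o f) = (E (fun x => `|f x| `^ p) `^ p^-1)%:E.
Proof.
move=> p0 bf; rewrite unlock.
have bP : bm (fun x => `|f x| `^ p) by apply: bm_powR => //; [exact: ltW|exact: bm_norm].
have -> : (\int[mu]_x (`|(EFin \o f) x| `^ p) = (E (fun x => `|f x| `^ p))%:E)%E.
  exact: (EFin_E mu1 bP).
by rewrite poweR_EFin.
Qed.

(** Jensen for finite p; for p = +oo, |f| is almost everywhere at most its essential supremum, and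
    the total mass is 1. *)
Lemma E_abs_le_Lnorm (f : T -> R) (p : \bar R) : bm f -> (1 <= p)%E ->
  ((E (fun x => `|f x|))%:E <= Lnorm mu p (EFin \o f))%E.
Proof.
move=> bf; case: p => [p||//].
  rewrite lee_fin => p1; rewrite Lnorm_bm ?lee_fin//; last by lra.
  have m0 : 0 <= E (fun x => `|f x|) by apply: E_ge0.
  have p0 : 0 < p by lra.
  have h : E (fun x => `|f x|) `^ p <= E (fun x => `|f x| `^ p).
    move: p1; rewrite le_eqVlt => /orP[/eqP <-|p1]; last exact: E_abs_powR_le.
    rewrite powRr1// le_eqVlt; apply/orP; left; apply/eqP.
    by apply: E_ext => x; rewrite powRr1.
  rewrite -[leLHS]powRr1// -(divff (lt0r_neq0 p0)) powRrM.
  by apply: ler_powR2; rewrite ?invr_ge0 ?powR_ge0// ltW.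
move=> _; rewrite unlock mu1 lte01 -(EFin_E mu1); last exact: bm_norm.
have := ess_sup_ge mu (abse \o (EFin \o f)).
have : (0 <= ess_sup mu (abse \o (EFin \o f)))%E.
  by apply: ess_sup_gee; [rewrite mu1 lte01|apply/nearW => x; exact: abse_ge0].
case: (ess_sup mu _) => [s||//] s0 hs; last by rewrite leey.
have -> : (s%:E = \int[mu]_x (cst s%:E) x)%E by rewrite integral_cst// mu1 mule1.
apply: ae_ge0_le_integral => //.
- by apply/measurable_EFinP; exact: (bm_norm bf).1.
- by apply: filterS hs => x h _.
Qed.

End Norms.

(** * Sequence norms and the number of dyadic levels *)

Section SequenceNorms.
Variables (R : realType).

Lemma sum_le_esum (I : choiceType) (A : set I) (a : I -> \bar R) (G : seq I) :
  (forall n, 0 <= a n)%E -> uniq G -> {in G, forall n, A n} ->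
  (\sum_(n <- G) a n <= \esum_(n in A) a n)%E.
Proof.
move=> a0 uG GA; apply: esum_ge; exists [set` G]; last by rewrite fsbig_seq.
by split; [exact: finite_seq|move=> n /= /GA].
Qed.

Lemma conj_exponent (p q : R) : 2 <= p -> p^-1 + q^-1 = 1 ->
  [/\ 0 < q, q * (p - 1) = p & (p - 1) / p = q^-1].
Proof.
move=> p2 pq; have p0 : p != 0 by rewrite gt_eqF//; lra.
have p1 : p - 1 != 0 by rewrite subr_eq0 gt_eqF//; lra.
have qi : q^-1 = (p - 1) / p by rewrite mulrBl divff// mul1r; lra.
have qE : q = p / (p - 1) by rewrite -[q]invrK qi invf_div.
split; rewrite ?qi//; first by rewrite qE divr_gt0; lra.
by rewrite qE divfK.
Qed.

Variable d : nat.
Implicit Types a : 'rV[int]_d -> R.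

Lemma seq_Lnorm_sum (q S0 : R) a (G : seq 'rV[int]_d) :
  (\esum_(n in [set n : 'rV[int]_d | n != 0%R]) (`|a n| `^ q)%:E = S0%:E)%E ->
  uniq G -> {in G, forall n, n != 0} -> \sum_(n <- G) `|a n| `^ q <= S0.
Proof.
move=> hS uG G0; rewrite -lee_fin -hS -sumEFin; exact: sum_le_esum.
Qed.

Lemma seq_weakLnorm_ge0 (q : R) a : (0 <= seq_weakLnorm q a)%E.
Proof.
apply: (@le_trans _ _ (((1 `^ q)%:E *
    \esum_(n in [set n : 'rV[int]_d | n != 0%R /\ (1 < `|a n|)%R]) 1) `^ q^-1)%E).
  exact: poweR_ge0.
by apply: ereal_sup_ubound; exists 1 => //; exact: ltr01.
Qed.

Lemma seq_weakLnorm_count (q w u : R) a (G : seq 'rV[int]_d) : 0 < q -> 0 < u ->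
  seq_weakLnorm q a = w%:E -> uniq G ->
  {in G, forall n, n != 0 /\ u < `|a n|} -> (size G)%:R * u `^ q <= w `^ q.
Proof.
move=> q0 u0 hw uG hG.
have w0 : 0 <= w by rewrite -lee_fin -hw seq_weakLnorm_ge0.
have h1 : (((u `^ q)%:E * \esum_(n in [set n : 'rV[int]_d | n != 0%R /\ (u < `|a n|)%R]) 1)
    `^ q^-1 <= w%:E)%E.
  by rewrite -hw; apply: ereal_sup_ubound; exists u.
have h2 : ((size G)%:R%:E <=
    \esum_(n in [set n : 'rV[int]_d | n != 0%R /\ (u < `|a n|)%R]) 1 :> \bar R)%E.
  have -> : ((size G)%:R%:E = \sum_(n <- G) 1 :> \bar R)%E.
    by rewrite sumEFin big_const_seq iter_addr_0 count_predT.
  exact: sum_le_esum.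
have h3 : (((u `^ q * (size G)%:R)%:E `^ q^-1) <= w%:E)%E.
  apply: le_trans h1; apply: gt0_ler_poweR; rewrite ?invr_ge0 ?(ltW q0)//.
  - by rewrite in_itv /= lee_fin leey andbT mulr_ge0 ?powR_ge0.
  - rewrite in_itv /= leey andbT mule_ge0 ?lee_fin ?powR_ge0//.
    by apply: le_trans h2; rewrite lee_fin.
  by rewrite EFinM lee_wpmul2l// lee_fin powR_ge0.
move: h3; rewrite poweR_EFin lee_fin => h3.
have h0 : 0 <= u `^ q * (size G)%:R by rewrite mulr_ge0 ?powR_ge0.
rewrite mulrC; move: (u `^ q * _) h0 h3 => z h0 h3.
rewrite -[leLHS]powRr1// -(mulVf (lt0r_neq0 q0)) powRrM.
by apply: ler_powR2; rewrite ?powR_ge0// ltW.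
Qed.

(** The bound (2(B+1)+1)^d of the count is polynomial in r when B is about r A, so the exponent K of
    a power of 2 above it is O(ln(2+r)), with a constant depending only on A and d. *)
Lemma level_count (A : nat) : exists2 C : R, 0 < C & forall r : R, 0 < r ->
  exists B K : nat, [/\ r * A%:R <= B%:R, (2 * B.+1).+1%:R ^+ d <= 2 ^+ K :> R &
    K.+2%:R <= C * ln (2 + r)].
Proof.
have l2 : 0 < ln 2 :> R by apply: ln_gt0; rewrite ltr1n.
(* Chosen so that 2y = 4rA + 10 <= (4A + 10)(2 + r) for the [y] below. *)
pose c := ln (4 * A%:R + 10 : R).
have A0 : 0 <= A%:R :> R by [].
have c0 : 0 <= c by apply: ln_ge0; lra.
(* K will be k d with k ln 2 <= c + ln(2+r); constants are absorbed through ln(2+r) >= ln 2, and 2 /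
   ln 2 pays for the two extra levels. *)
pose C := d%:R * ((c / ln 2 + 1) / ln 2) + 2 / ln 2.
have C0 : 0 < C.
  rewrite ltr_wpDl ?divr_gt0// mulr_ge0// divr_ge0 ?(ltW l2)// addr_ge0// divr_ge0//.
  exact: ltW.
exists C => // r r0; have rA0 : 0 <= r * A%:R by rewrite mulr_ge0// ltW.
pose B := (Num.truncn (r * A%:R)).+1.
have hB : r * A%:R <= B%:R by apply: ltW; exact: truncnS_gt.
have hB2 : B%:R <= r * A%:R + 1.
  by have := truncn_le (r * A%:R); rewrite rA0 -natr1 lerD2r => ->.
pose y : R := 2 * (r * A%:R) + 5.
have By : (2 * B.+1).+1%:R <= y.
  by rewrite -natr1 natrM -natr1 /y; lra.
have y1 : 1 <= y by rewrite /y; lra.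
have ex : exists k : nat, y <= 2 ^+ k.
  exists (Num.Def.archi_bound y); apply: le_trans (powR2_ge1 R _).
  have := archi_boundP (le_trans ler01 y1); lra.
case: (ex_minnP ex) => k hk kmin.
have k2 : 2 ^+ k <= 2 * y.
  case: (k) kmin hk => [|j] kmin hk; first by rewrite expr0; lra.
  rewrite exprS ler_pM2l//; apply: ltW; rewrite ltNge; apply/negP => /kmin.
  by rewrite ltnn.
exists B, (k * d)%N; split => //.
  by rewrite exprM lerXn2r ?nnegrE ?exprn_ge0//; apply: le_trans hk.
have L2 : ln 2 <= ln (2 + r) by rewrite ler_ln ?posrE//; lra.
set L := ln (2 + r) in L2 *.
have kl : k%:R * ln 2 <= c + L.
  have -> : k%:R * ln 2 = ln (2 ^+ k) :> R by rewrite lnXn// mulr_natl.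
  rewrite /c /L -lnM ?posrE; [|lra|lra].
  rewrite ler_ln ?posrE ?exprn_gt0//; last by apply: mulr_gt0; lra.
  apply: le_trans k2 _; rewrite /y; nra.
have cl : c <= c / ln 2 * L.
  by rewrite mulrAC ler_pdivlMr// ler_wpM2l.
have kL : k%:R <= (c / ln 2 + 1) / ln 2 * L.
  by rewrite mulrAC ler_pdivlMr// mulrDl mul1r; lra.
have tL : 2 <= 2 / ln 2 * L by rewrite mulrAC ler_pdivlMr// ler_pM2l.
rewrite -[(k * d).+2]addn2 natrD natrM /C mulrDl lerD//.
by rewrite mulrC -mulrA ler_wpM2l.
Qed.

End SequenceNorms.

(** * The four bounds for the discrepancy *)

Section DiscrepancyBounds.
Variables (R : realType) (d : nat) (lam : {measure set Rd R d -> \bar R}).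
Hypothesis hlam : is_lebesgue_measure lam.
Variable Om : set 'rV[R]_d.
Hypotheses (oOm : open Om) (bOm : bounded_set Om).
Local Notation V := ('rV[R]_d).
Local Notation T := (Rd R d).
Local Notation mu := (torus_measure lam).
Local Notation E f := (Rintegral mu setT f).
Local Notation D r := (discrepancy lam Om r).
Local Notation aft r := (fun n => abs_ft_chi lam Om (r *: intvec R n)).
Let mu1 := torus_measure_setT hlam.

Let cmod_ech_le1 (n : 'rV[int]_d) (x : T) : cmod (ech n (x : V)) <= 1.
Proof. by rewrite cmod_ech. Qed.

Let aft_ge0 r n : 0 <= aft r n. Proof. exact: sqrtr_ge0. Qed.

Lemma discrepancy_Lp (p q r : R) : 2 <= p -> p^-1 + q^-1 = 1 -> 0 < r ->
  (Lnorm mu p%:E (EFin \o D r) <= (r ^+ d)%:E * seq_Lnorm q (aft r))%E.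
Proof.
move=> p2 pq r0; have [q0 pq1 pq2] := conj_exponent p2 pq.
have rd : 0 < r ^+ d by rewrite exprn_gt0.
have p0 : 0 < p by lra.
have bD := bm_discrepancy lam oOm bOm r0.
rewrite (Lnorm_bm mu1 p0 bD) /seq_Lnorm.
have es0 : (0 <= \esum_(n in [set n : 'rV[int]_d | n != 0%R]) (`|aft r n| `^ q)%:E)%E.
  by apply: esum_ge0 => n _; rewrite lee_fin powR_ge0.
case hS: (esum _ _) es0 => [S0||//] S00; last first.
  by rewrite poweRyr ?invr_neq0 ?(lt0r_neq0 q0)// gt0_muley ?lte_fin// leey.
rewrite lee_fin in S00; rewrite poweR_EFin -EFinM lee_fin.
have sumG G : uniq G -> \sum_(n <- G) cmod (coef lam Om r n) `^ q <= (r ^+ d) `^ q * S0.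
  move=> uG; rewrite (bigID (fun n => n != 0)) /= [X in _ + X]big1 ?addr0; last first.
    move=> n; rewrite negbK => /eqP ->.
    by rewrite (coef0 hlam oOm bOm r0) cmod0 powR0// lt0r_neq0.
  rewrite -big_filter; set G' := [seq n <- G | n != 0].
  have G'0 : {in G', forall n, n != 0} by move=> n; rewrite mem_filter => /andP[].
  have uG' : uniq G' by exact: filter_uniq.
  apply: (@le_trans _ _ ((r ^+ d) `^ q * \sum_(n <- G') `|aft r n| `^ q)).
    rewrite mulr_sumr big_seq [leRHS]big_seq; apply: ler_sum => n nG.
    rewrite (cmod_coef hlam oOm bOm r0 (G'0 _ nG)) powRM ?(ltW rd)//.
    by rewrite ger0_norm.
  by rewrite ler_wpM2l ?powR_ge0//; apply: seq_Lnorm_sum hS uG' G'0.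
have X : E (fun x => `|D r x| `^ p) <= ((r ^+ d) `^ q * S0) `^ (p - 1).
  apply: (strong_estimate mu1 (@cbm_ech R d) bD (discrepancy_L2 hlam oOm bOm r0) p2 pq1).
  move=> G uG; apply: le_trans (torus_HY hlam _ p2 pq1 uG) _.
  apply: ler_powR2; [lra|by apply: sumr_ge0 => n _; exact: powR_ge0|exact: sumG].
apply: (@le_trans _ _ ((((r ^+ d) `^ q * S0) `^ (p - 1)) `^ p^-1)).
  apply: ler_powR2 => //; first by rewrite invr_ge0 ltW.
  by apply: E_ge0 => x; exact: powR_ge0.
rewrite -powRrM pq2 powRM ?powR_ge0// -powRrM divff ?(lt0r_neq0 q0)//.
by rewrite powRr1// ltW.
Qed.

(** For n <> 0 the n-th coefficient exceeds u exactly when [abs_ft_chi] exceeds u / r^d, so W = (r^d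
    w)^q is admissible in the weak estimate, and W^(p-1) = (r^d w)^p. The constant depends on p and
    q only. *)
Lemma discrepancy_weak_level (p q r w t : R) : 2 < p -> p^-1 + q^-1 = 1 -> 0 < r ->
  seq_weakLnorm q (aft r) = w%:E -> 0 < t ->
  t `^ p * E (\1_[set x | t < `|D r x|]) <= weakK p q * (r ^+ d * w) `^ p.
Proof.
move=> p2 pq r0 hw t0; have [q0 pq1 pq2] := conj_exponent (ltW p2) pq.
have rd : 0 < r ^+ d by rewrite exprn_gt0.
have w0 : 0 <= w by rewrite -lee_fin -hw seq_weakLnorm_ge0.
have bD := bm_discrepancy lam oOm bOm r0.
have -> : (r ^+ d * w) `^ p = ((r ^+ d * w) `^ q) `^ (p - 1) by rewrite -powRrM pq1.
apply: (weak_estimate mu1 (@cbm_ech R d) cmod_ech_le1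
  (ech_orth hlam) bD (discrepancy_L2 hlam oOm bOm r0) p2 pq1) => //.
  exact: powR_ge0.
move=> u G u0 uG hG.
have uE : u = r ^+ d * (u / r ^+ d) by rewrite mulrC divfK// lt0r_neq0.
have z0 : 0 <= u / r ^+ d by rewrite divr_ge0 ?(ltW u0) ?(ltW rd).
rewrite uE (powRM _ (ltW rd) z0) (powRM _ (ltW rd) w0) mulrCA ler_wpM2l ?powR_ge0//.
apply: (seq_weakLnorm_count q0 _ hw uG); first by rewrite divr_gt0.
move=> n nG; have un := hG n nG.
have n0 : n != 0.
  apply: contraTneq un => ->; rewrite (coef0 hlam oOm bOm r0) cmod0 -leNgt.
  exact: ltW.
split => //; rewrite ger0_norm// ltr_pdivrMr// mulrC.
by rewrite -(cmod_coef hlam oOm bOm r0 n0).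
Qed.

Lemma weakK_gt0 (p q : R) : 1 < q -> q < 2 -> 0 < weakK p q.
Proof.
move=> q1 q2; have h1 := weakC1_gt0 q1; have h2 := weakC2_gt0 q2.
apply: mulr_gt0; first by apply: mulr_gt0.
by apply: powR_gt0; apply: mulr_gt0.
Qed.

Let exponent_bounds (p q : R) : 2 < p -> p^-1 + q^-1 = 1 -> 1 < q /\ q < 2.
Proof.
move=> p2 pq; have [q0 pq1 pq2] := conj_exponent (ltW p2) pq; split; first by nra.
by rewrite ltNge; apply/negP => h; nra.
Qed.

Let powR_root (p x : R) : 0 < p -> 0 <= x -> (x `^ p) `^ p^-1 = x.
Proof. by move=> p0 x0; rewrite -powRrM divff ?lt0r_neq0// powRr1. Qed.

Lemma discrepancy_weakLp (p q : R) : 2 < p -> p^-1 + q^-1 = 1 ->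
  exists C : R, forall r : R, 0 < r ->
  (weakLnorm mu p (D r) <= (C * r ^+ d)%:E * seq_weakLnorm q (aft r))%E.
Proof.
move=> p2 pq; have [q1 q2] := exponent_bounds p2 pq.
have K0 := weakK_gt0 p q1 q2; have p0 : 0 < p by lra.
exists (weakK p q `^ p^-1) => r r0.
have rd : 0 < r ^+ d by rewrite exprn_gt0.
have C0 : 0 < weakK p q `^ p^-1 * r ^+ d by rewrite mulr_gt0// powR_gt0.
have := seq_weakLnorm_ge0 q (aft r).
case hw: (seq_weakLnorm q _) => [w||//] w0; last first.
  by rewrite gt0_muley ?lte_fin// leey.
rewrite lee_fin in w0; apply: ub_ereal_sup => _ [t t0 <-].
have bD := bm_discrepancy lam oOm bOm r0.
have := E_indic mu1 (measurable_super bD t) => /= hE.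
rewrite [X in (_ * X)%E]hE -!EFinM poweR_EFin lee_fin.
have h := discrepancy_weak_level p2 pq r0 hw t0.
apply: (@le_trans _ _ ((weakK p q * (r ^+ d * w) `^ p) `^ p^-1)).
  apply: ler_powR2 => //; first by rewrite invr_ge0 ltW.
  by rewrite mulr_ge0 ?powR_ge0//; apply: E_ge0 => x.
rewrite powRM ?powR_ge0 ?(ltW K0)// powR_root ?mulr_ge0 ?(ltW rd)//.
by rewrite mulrA.
Qed.

(** Both the count and r^d |Om|, which is its mean, lie in [0, 2^K]. *)
Lemma discrepancy_bound (A B K : nat) (r : R) : 0 < r ->
  (forall y, Om y -> forall i, `|y 0 i| <= A%:R) -> r * A%:R <= B%:R ->
  (2 * B.+1).+1%:R ^+ d <= 2 ^+ K :> R -> forall x, `|D r x| <= 2 ^+ K.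
Proof.
move=> r0 hA hB hK x.
have cB y : cnt Om r y <= 2 ^+ K by apply: le_trans (cnt_le bOm r0 hA hB y) hK.
have bN := bm_cnt oOm bOm r0.
have a1 : r ^+ d * fine (lam Om) <= 2 ^+ K.
  rewrite -(E_cnt oOm bOm r0 hlam) -[leRHS](E_cst mu1).
  by apply: (E_le mu1) => //; exact: bm_cst.
have a0 : 0 <= r ^+ d * fine (lam Om).
  by rewrite -(E_cnt oOm bOm r0 hlam); apply: E_ge0 => y; exact: cnt_ge0.
have c0 := cnt_ge0 bOm r0 x; have c1 := cB x.
by rewrite discrepancyE ler_norml; apply/andP; split; lra.
Qed.

Lemma discrepancy_Lp_log (p q : R) : 2 < p -> p^-1 + q^-1 = 1 ->
  exists C : R, forall r : R, 0 < r ->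
  (Lnorm mu p%:E (EFin \o D r) <=
   (C * r ^+ d * ln (2 + r) `^ p^-1)%:E * seq_weakLnorm q (aft r))%E.
Proof.
move=> p2 pq; have [q1 q2] := exponent_bounds p2 pq.
have K0 := weakK_gt0 p q1 q2; have p0 : 0 < p by lra.
have [A hA] := bounded_set_coord bOm.
have [L L0 hL] := level_count R d A.
have M0 : 0 < L * (2 `^ p * weakK p q).
  by apply: mulr_gt0 => //; apply: mulr_gt0 => //; exact: powR_gt0.
exists ((L * (2 `^ p * weakK p q)) `^ p^-1) => r r0.
have rd : 0 < r ^+ d by rewrite exprn_gt0.
have ln0 : 0 < ln (2 + r) by apply: ln_gt0; lra.
have C0 : 0 < (L * (2 `^ p * weakK p q)) `^ p^-1 * r ^+ d * ln (2 + r) `^ p^-1.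
  by apply: mulr_gt0; [apply: mulr_gt0 => //|]; exact: powR_gt0.
have := seq_weakLnorm_ge0 q (aft r).
case hw: (seq_weakLnorm q _) => [w||//] w0; last first.
  by rewrite gt0_muley ?lte_fin// leey.
rewrite lee_fin in w0.
have bD := bm_discrepancy lam oOm bOm r0.
rewrite (Lnorm_bm mu1 p0 bD) -EFinM lee_fin.
have [B [K [hB hK hKL]]] := hL r r0.
have Dint (x : T) : exists n : nat, D r x = n%:R - r ^+ d * fine (lam Om).
  by have [n hn] := cnt_nat bOm r0 x; exists n; rewrite discrepancyE hn.
have X := strong_of_weak mu1 bD p2 (fun t => discrepancy_weak_level p2 pq r0 hw) Dint
  (discrepancy_bound r0 hA hB hK).
have X2 : E (fun x => `|D r x| `^ p) <=
    L * (2 `^ p * weakK p q) * ln (2 + r) * (r ^+ d * w) `^ p.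
  apply: le_trans X _.
  have -> : L * (2 `^ p * weakK p q) * ln (2 + r) * (r ^+ d * w) `^ p =
    (L * ln (2 + r)) * (2 `^ p * (weakK p q * (r ^+ d * w) `^ p)) by ring.
  rewrite ler_wpM2r//; apply: mulr_ge0; first exact: powR_ge0.
  by apply: mulr_ge0; [exact: ltW|exact: powR_ge0].
apply: (@le_trans _ _ ((L * (2 `^ p * weakK p q) * ln (2 + r) * (r ^+ d * w) `^ p) `^ p^-1)).
  apply: ler_powR2 => //; first by rewrite invr_ge0 ltW.
  by apply: E_ge0 => x; exact: powR_ge0.
have h1 : 0 <= L * (2 `^ p * weakK p q) * ln (2 + r) by rewrite mulr_ge0// ltW.
rewrite (powRM _ h1 (powR_ge0 _ _)) (powRM _ (ltW M0) (ltW ln0)).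
rewrite powR_root ?mulr_ge0 ?(ltW rd)//.
by rewrite le_eqVlt; apply/orP; left; apply/eqP; ring.
Qed.

Lemma discrepancy_lower (p : \bar R) (r : R) : (1 <= p)%E -> 0 < r ->
  (ereal_sup [set (`|r ^+ d| * aft r n)%:E | n in [set n : 'rV[int]_d | n != 0%R]]
    <= Lnorm mu p (EFin \o D r))%E.
Proof.
move=> p1 r0; have bD := bm_discrepancy lam oOm bOm r0.
have rd : 0 < r ^+ d by rewrite exprn_gt0.
apply: ub_ereal_sup => _ [n /= n0 <-]; apply: le_trans (E_abs_le_Lnorm mu1 bD p1).
rewrite lee_fin (gtr0_norm rd) -(cmod_coef hlam oOm bOm r0 n0).
apply: le_trans (cmod_CE_le mu1 _) _.
  by apply: cbmM; [exact: cbm_ofR|apply: cbm_cj; exact: cbm_ech].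
rewrite le_eqVlt; apply/orP; left; apply/eqP; apply: E_ext => x.
by rewrite cmodM cmod_ofR cmodJ cmod_ech mulr1.
Qed.

End DiscrepancyBounds.

Theorem theorem2 (R : realType) (d : nat) (hd : (1 <= d)%N)
  (lam : {measure set Rd R d -> \bar R}) (hlam : is_lebesgue_measure lam)
  (Om : set 'rV[R]_d) (hOm_open : open Om) (hOm_bdd : bounded_set Om) :
  (* (1) *)
  (forall p q : R, 2 <= p -> p^-1 + q^-1 = 1 ->
    forall r : R, 0 < r ->
      (Lnorm (torus_measure lam) p%:E (EFin \o discrepancy lam Om r)
        <= (r ^+ d)%:E * seq_Lnorm q (fun n => abs_ft_chi lam Om (r *: intvec R n)))%E)
  /\
  (* (2) *)
  (forall p q : R, 2 < p -> p^-1 + q^-1 = 1 ->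
    exists C : R, forall r : R, 0 < r ->
      (weakLnorm (torus_measure lam) p (discrepancy lam Om r)
        <= (C * r ^+ d)%:E
           * seq_weakLnorm q (fun n => abs_ft_chi lam Om (r *: intvec R n)))%E)
  /\
  (* (3) *)
  (forall p q : R, 2 < p -> p^-1 + q^-1 = 1 ->
    exists C : R, forall r : R, 0 < r ->
      (Lnorm (torus_measure lam) p%:E (EFin \o discrepancy lam Om r)
        <= (C * r ^+ d * ln (2 + r) `^ p^-1)%:E
           * seq_weakLnorm q (fun n => abs_ft_chi lam Om (r *: intvec R n)))%E)
  /\
  (* (4) *)
  (forall p : \bar R, (1 <= p)%E ->
    forall r : R, 0 < r ->
      (ereal_sup [set (`|r ^+ d| * abs_ft_chi lam Om (r *: intvec R n))%:E
                   | n in [set n : 'rV[int]_d | n != 0%R]]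
        <= Lnorm (torus_measure lam) p (EFin \o discrepancy lam Om r))%E).

Proof.
split; first by move=> p q p2 pq r r0; exact: discrepancy_Lp.
split; first by move=> p q; exact: discrepancy_weakLp.
split; first by move=> p q; exact: discrepancy_Lp_log.
by move=> p p1 r r0; exact: discrepancy_lower.
Qed.
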